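(* The Spence-Kummer web $\mathcal W_{\mathcal{SK}}$, i.e. the planar web formed by the nine foliations of $\mathbb{CP}^2$ by the level curves of the functions $$U_1=x,\quad U_2=y,\quad U_3=\frac xy,\quad U_4=\frac{1-y}{1-x},\quad U_5=\frac{y(1-x)}{x(1-y)},$$ $$U_6=xy,\quad U_7=\frac{x(1-y)}{x-1},\quad U_8=\frac{1-y}{y(x-1)},\quad U_9=\frac{x(1-y)^2}{y(1-x)^2},$$ is an exceptional $9$-web.
   Context: A planar $d$-web is an unordered set of $d$ foliations by curves of a domain in a complex surface whose leaves are pairwise transverse. For rational functions $U_1,\dots,U_d$ on $\mathbb{CP}^2$ whose level curves are generically pairwise transverse, the associated (singular) web is considered locally at generic points (outside the singular locus, where some foliation is singular or two foliations are not transverse). An abelian relation of a web given near a point by the level curves of holomorphic submersions $U_1,\dots,U_d$ is a relation $\sum_{i=1}^d G_i(U_i)\,dU_i=0$ with $G_i$ germs of holomorphic functions of one variable; the rank of the web is the dimension over $\mathbb C$ of the space of abelian relations. It is always at most $(d-1)(d-2)/2$, and the web has maximal rank if equality holds. A web is linearizable if there is a local biholomorphism mapping all its leaves to pieces of straight lines. A web is exceptional if it is of maximal rank and not linearizable. *)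

(* Defs.v *)
From mathcomp Require Import all_boot all_order all_algebra.
From mathcomp Require Import all_classical all_reals all_analysis.
From mathcomp Require Import complex.
Set Implicit Arguments.
Unset Strict Implicit.
Unset Printing Implicit Defensive.
Import Order.TTheory GRing.Theory Num.Theory.
Import numFieldNormedType.Exports.
Local Open Scope classical_set_scope.
Local Open Scope ring_scope.

(** The field [R[i]] of complex numbers, typed so that its normed-module and
    topological structures are found; differentiability below is
    differentiability over this field, i.e. complex differentiability. *)
Definition Cplx (R : realType) : numClosedFieldType := R[i].

Section Webs.
Variable R : realType.
Local Notation C := (Cplx R).

Definition holomorphic_at (V W : normedModType C) (f : V -> W) (p : V) : Prop :=
  \forall q \near p, differentiable f q.

Section Web.
Variables (d : nat) (U : 'I_d -> C * C -> C).

(** [p] lies outside the singular locus of the web of the level curves of the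
    [U i].  Each [U i] is a holomorphic submersion near [p]; the tangent lines
    at [p] of two leaves are the kernels of the differentials, and
    transversality says that these lines meet only in [0]. *)
Definition web_regular_at (p : C * C) : Prop :=
  [/\ forall i, holomorphic_at (U i) p,
      forall i, exists v, 'd (U i) p v != 0
    & forall i j, i != j ->
        forall v, 'd (U i) p v = 0 -> 'd (U j) p v = 0 -> v = 0].

(** Each [G i] represents a germ at [U i p]; the equation is
    [\sum_i G i (U i) d(U i) = 0] as an identity of 1-forms near [p]. *)
Definition abelian_relation (p : C * C) (G : 'I_d -> C -> C) : Prop :=
  (forall i, holomorphic_at (G i) (U i p)) /\
  \forall q \near p, forall v, \sum_(i < d) G i (U i q) * 'd (U i) q v = 0.

(** The complex vector space of abelian relations at [p] has a basis with [r]
    elements.  Its vectors are families of germs, so that two families [G], [H]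
    are equal as soon as each [G i] coincides with [H i] near [U i p]. *)
Definition has_rank (p : C * C) (r : nat) : Prop :=
  exists B : 'I_r -> 'I_d -> C -> C,
  [/\ forall k, abelian_relation p (B k),
      forall c : 'I_r -> C,
        (forall i, \forall z \near U i p, \sum_(k < r) c k * B k i z = 0) ->
        forall k, c k = 0
    & forall G, abelian_relation p G ->
        exists c : 'I_r -> C, forall i,
          \forall z \near U i p, G i z = \sum_(k < r) c k * B k i z].

Definition maximal_rank (p : C * C) : Prop :=
  has_rank p (d.-1 * d.-2)./2.

Definition leaf (A : set (C * C)) (i : 'I_d) (q : C * C) : set (C * C) :=
  connected_component (A `&` [set q' | U i q' = U i q]) q.

End Web.

Definition biholomorphism (A B : set (C * C)) (f : C * C -> C * C) : Prop :=
  [/\ open A, open B, set_bij A B f, forall q, A q -> differentiable f q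
    & exists g : C * C -> C * C,
        (forall q, A q -> g (f q) = q) /\ forall q, B q -> differentiable g q].

Definition contained_in_line (L : set (C * C)) : Prop :=
  exists a b c : C, (a, b) != (0, 0) /\
    L `<=` [set q | a * q.1 + b * q.2 = c].

Definition linearizable (d : nat) (U : 'I_d -> C * C -> C) (p : C * C) : Prop :=
  exists (A B : set (C * C)) (f : C * C -> C * C),
  [/\ A p, biholomorphism A B f
    & forall i q, A q -> contained_in_line (f @` leaf U A i q)].

Definition exceptional_at (d : nat) (U : 'I_d -> C * C -> C) (p : C * C) : Prop :=
  maximal_rank U p /\ ~ linearizable U p.

(** For the singular web of the level curves of [d] rational functions: the
    functions do define a [d]-web at generic points, and at each point outside
    the singular locus this web is exceptional. *)
Definition exceptional_web (d : nat) (U : 'I_d -> C * C -> C) : Prop :=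
  dense [set p | web_regular_at U p] /\
  forall p, web_regular_at U p -> exceptional_at U p.

(** The functions are given in the affine chart with coordinates [x], [y].  The
    line at infinity and the polar lines [x = 0], [y = 0], [x = 1], [y = 1] are
    each a common leaf of two of the foliations (e.g. of the pencils of lines
    [U_2] and [U_3] for [y = 0]), so no point outside the singular locus of the
    web on the projective plane is lost.  By the convention [z / 0 = 0], a
    function is discontinuous along its polar lines, so their points do not
    satisfy [web_regular_at]. *)
Definition spence_kummer (i : 'I_9) (p : C * C) : C :=
  let: (x, y) := p in
  tnth [tuple x;
              y;
              x / y;
              (1 - y) / (1 - x);
              (y * (1 - x)) / (x * (1 - y));
              x * y;
              (x * (1 - y)) / (x - 1);
              (1 - y) / (y * (x - 1));
              (x * (1 - y) ^+ 2) / (y * (1 - x) ^+ 2)] i.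

End Webs.

(* Main.v *)
(** Linearizability. Through each point pass four leaves that are lines, those of
    [x], [y], [x / y] and [(1 - y) / (1 - x)]. For a linearization [f] the cubic
    form [df(t) /\ D^2 f(t, t)] of the tangent vector [t] vanishes in these four
    directions, hence identically; then a leaf of [x y], which is a curved conic,
    can be mapped into a line only if [df] is degenerate.

    Rank at least 28. Up to sign, the [U_i] and the [1 - U_i] are monomials in the
    letters [x], [y], [1 - x], [1 - y], [x - y], [1 - x y]. Hence the relations
    between [log], dilogarithms and trilogarithms of the [U_i] are relations between
    tensors in these letters: there are 12, 9 and 2 of them (the last two are the
    equations of Spence and Kummer). Four relations between rational functions and
    one between the [arctanh (sqrt U_i)], [i = 3, 6, 9], complete the basis.

    Rank at most 28. Let [F_i] be the primitives of the components of an abelian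
    relation that vanish at the base point, and [m] the lowest degree in which a
    Taylor coefficient occurs. The coefficients of degree [m] form a linear relation
    between the [m]-th powers of the linear forms [d U_i]; any [m + 1] of these
    powers are independent. So the relation is determined by the coefficients of
    degree [m] of the [F_i] with [i > m + 1], and there are [7 + 6 + ... + 1] of them. *)
Require Import Defs.
From mathcomp Require Import all_boot all_order all_algebra.
From mathcomp Require Import all_classical all_reals all_analysis.
From mathcomp Require Import complex ring lra.
Set Implicit Arguments. Unset Strict Implicit. Unset Printing Implicit Defensive.
Import Order.TTheory GRing.Theory Num.Theory.
Import numFieldNormedType.Exports.
Local Open Scope classical_set_scope.
Local Open Scope ring_scope.

(** * Complex derivatives and path integrals *)

(** All branches of logarithms and dilogarithms are normalized to vanish at the base point.
    Relations between them then hold without additive constants, and two germs agree as soon as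
    their gradients do. So the tensor relations become polynomial identities in the logarithms of
    the letters and their differentials. Dilogarithms survive only in weight three; there the
    coefficient of each letter is a function that is 0 at the base point and has zero gradient.

    The two bounds are joined by linear algebra: the Taylor coefficients of the upper bound map
    abelian relations injectively to vectors of length 28, the 28 independent relations give an
    invertible matrix, and solving a linear system expresses any relation in them.

    All this takes place where none of the six letters vanishes. Regular points are such points,
    because each curve on which a letter vanishes is tangent to two foliations at once.

    The function theory uses squares and finite Taylor remainders. Only orders of magnitude matter,
    so the integral of [dz / z] around a square is merely shown to be nonzero. *)

Section ComplexNorm.
Variable R : realType.
Local Notation C := (Cplx R).

(** The norm of [Cplx R] takes its values in [Cplx R]; estimates need values in a totally ordered
    field. *)
Definition cabs (z : C) : R := complex.Re `|z|.
Local Notation N := cabs.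

Lemma cabsE (z : C) : `|z| = (N z)%:C%C.
Proof. by rewrite /cabs RRe_real // normr_real. Qed.

Lemma cabs_ge0 z : 0 <= N z.
Proof. by rewrite -ler0c -cabsE. Qed.

Lemma ler_cabsD z w : N (z + w) <= N z + N w.
Proof. by rewrite -lecR rmorphD /= -!cabsE ler_normD. Qed.

Lemma cabsM z w : N (z * w) = N z * N w.
Proof. by apply: (@complexI R); rewrite rmorphM /= -!cabsE normrM. Qed.

Lemma cabsN z : N (- z) = N z.
Proof. by rewrite /cabs normrN. Qed.

Lemma cabsB z w : N (z - w) = N (w - z).
Proof. by rewrite /cabs distrC. Qed.

Lemma cabs0 : N 0 = 0.
Proof. by rewrite /cabs normr0. Qed.

Lemma cabs1 : N 1 = 1.
Proof. by rewrite /cabs normr1. Qed.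

Lemma cabs_eq0 z : (N z == 0) = (z == 0).
Proof.
apply/idP/idP => [/eqP h|/eqP ->]; last by rewrite cabs0.
by rewrite -normr_eq0 cabsE h.
Qed.

Lemma cabs_gt0 z : (0 < N z) = (z != 0).
Proof. by rewrite lt_def cabs_eq0 cabs_ge0 andbT. Qed.

Lemma cabsV z : N z^-1 = (N z)^-1.
Proof.
by apply: (@complexI R); rewrite -cabsE normfV cabsE fmorphV.
Qed.

Lemma cabsX z n : N (z ^+ n) = N z ^+ n.
Proof.
elim: n => [|n ih]; first by rewrite !expr0 cabs1.
by rewrite !exprS cabsM ih.
Qed.

Lemma cabsR (x : R) : N (x%:C%C) = `|x|.
Proof. by rewrite /cabs normc_def /= expr0n addr0 sqrtr_sqr. Qed.

Lemma cabsi : N ('i%C : C) = 1.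
Proof. by rewrite /cabs normc_def /= expr0n add0r expr1n sqrtr1. Qed.

Lemma Re_le_cabs (z : C) : `|complex.Re z| <= N z.
Proof. by rewrite -lecR -cabsE normc_ge_Re. Qed.

Lemma Im_le_cabs (z : C) : `|complex.Im z| <= N z.
Proof. by have := Re_le_cabs (z * 'i%C); rewrite ReiNIm normrN cabsM cabsi mulr1. Qed.

Lemma cabs_le_ReIm (z : C) : N z <= `|complex.Re z| + `|complex.Im z|.
Proof.
rewrite {1}[z]complexE (le_trans (ler_cabsD _ _))// cabsM cabsi mul1r.
by rewrite !cabsR.
Qed.

Lemma cabs_lerB z w : N z - N w <= N (z - w).
Proof.
by rewrite lerBlDr -{1}(subrK w z) ler_cabsD.
Qed.

End ComplexNorm.

Section RealPaths.
Variable R : realType.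
Local Notation C := (Cplx R).
Local Notation N := (@cabs R).
Local Notation mu := (@lebesgue_measure R).
Local Notation ReR := (@complex.Re R).
Local Notation ImR := (@complex.Im R).

(** A path has a real parameter and values in a space normed over [C], so continuity and derivative
    are stated by estimates rather than over one common field. *)
Definition pcont (g : R -> C) (t : R) := forall e : R, 0 < e ->
  exists2 d : R, 0 < d & forall s, `|s| < d -> N (g (t + s) - g t) < e.

Definition pder (g : R -> C) (t : R) (a : C) := forall e : R, 0 < e ->
  exists2 d : R, 0 < d & forall s, `|s| < d ->
    N (g (t + s) - g t - s%:C%C * a) <= e * `|s|.

Lemma pcont_Re g t : pcont g t -> {for t, continuous (ReR \o g)}.
Proof.
move=> h; apply/cvgrPdist_lt => e e0; have [d d0 hd] := h e e0.
apply/nbhs_ballP; exists d => //= s; rewrite /ball /= => hs.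
rewrite distrC in hs; have := hd _ hs.
rewrite addrCA subrr addr0 => /(le_lt_trans _); apply.
by rewrite distrC /= -raddfB; exact: Re_le_cabs.
Qed.

Lemma pcont_Im g t : pcont g t -> {for t, continuous (ImR \o g)}.
Proof.
move=> h; apply/cvgrPdist_lt => e e0; have [d d0 hd] := h e e0.
apply/nbhs_ballP; exists d => //= s; rewrite /ball /= => hs.
rewrite distrC in hs; have := hd _ hs.
rewrite addrCA subrr addr0 => /(le_lt_trans _); apply.
by rewrite distrC /= -raddfB; exact: Im_le_cabs.
Qed.

Lemma real_pder (g : R -> R) t a :
  (forall e : R, 0 < e ->
    exists2 d : R, 0 < d & forall s, `|s| < d ->
      `|g (t + s) - g t - s * a| <= e * `|s|) -> is_derive t 1 g a.
Proof.
move=> h.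
have hc : h^-1 *: ((g \o shift t) (h *: 1) - g t) @[h --> 0^'] --> a.
  apply/cvgrPdist_le => e e0; have [d d0 hd] := h e e0.
  apply/nbhs_ballP; exists d => //= s; rewrite /ball /= sub0r normrN => hs s0.
  have hd' := hd s hs; rewrite /= [_%:A]mulr1.
  have s0' : 0 < `|s| by rewrite normr_gt0.
  rewrite -(ler_pM2r s0'); apply: le_trans hd'.
  rewrite -normrM -normrN -mulNr opprB mulrBl /GRing.scale /= mulrAC mulVf // mul1r.
  by rewrite [a * s]mulrC [t + s]addrC.
by apply: DeriveDef; [apply/cvg_ex; exists a|apply/cvg_lim].
Qed.

Lemma pder_Re g t a : pder g t a -> is_derive t 1 (ReR \o g) (ReR a).
Proof.
move=> h; apply: real_pder => e e0; have [d d0 hd] := h e e0.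
exists d => // s /hd; apply: le_trans; apply: le_trans (Re_le_cabs _).
by rewrite !raddfB /=; case: a {h hd} => a b /=; rewrite mul0r subr0.
Qed.

Lemma pder_Im g t a : pder g t a -> is_derive t 1 (ImR \o g) (ImR a).
Proof.
move=> h; apply: real_pder => e e0; have [d d0 hd] := h e e0.
exists d => // s /hd; apply: le_trans; apply: le_trans (Im_le_cabs _).
by rewrite !raddfB /=; case: a {h hd} => a b /=; rewrite mul0r addr0.
Qed.

Definition cint (a b : R) (g : R -> C) : C :=
  ((\int[mu]_(t in `[a, b]) ReR (g t)) +i*
   (\int[mu]_(t in `[a, b]) ImR (g t)))%C.

Definition pconts (a b : R) (g : R -> C) :=
  forall t, a <= t <= b -> pcont g t.

Lemma pconts_ReI a b g : pconts a b g ->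
  mu.-integrable `[a, b] (EFin \o (ReR \o g)).
Proof.
move=> h; apply: continuous_compact_integrable; first exact: segment_compact.
apply: continuous_in_subspaceT => t /set_mem/=; rewrite in_itv /= => /h.
exact: pcont_Re.
Qed.

Lemma pconts_ImI a b g : pconts a b g ->
  mu.-integrable `[a, b] (EFin \o (ImR \o g)).
Proof.
move=> h; apply: continuous_compact_integrable; first exact: segment_compact.
apply: continuous_in_subspaceT => t /set_mem/=; rewrite in_itv /= => /h.
exact: pcont_Im.
Qed.

Lemma eq_cint a b f g : (forall t, a <= t <= b -> f t = g t) ->
  cint a b f = cint a b g.
Proof.
move=> h; congr (_ +i* _)%C; apply: eq_Rintegral => t /set_mem/=;
by rewrite in_itv /= => /h ->.
Qed.

Lemma cintD a b f g : pconts a b f -> pconts a b g ->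
  cint a b (fun t => f t + g t) = cint a b f + cint a b g.
Proof.
move=> hf hg; rewrite /cint.
under eq_Rintegral do rewrite raddfD /=.
rewrite RintegralD //; [|exact: (pconts_ReI hf)|exact: (pconts_ReI hg)].
under [X in (_ +i* X)%C]eq_Rintegral do rewrite raddfD /=.
by rewrite RintegralD //; [exact: (pconts_ImI hf)|exact: (pconts_ImI hg)].
Qed.

Lemma cintZ a b c f : pconts a b f ->
  cint a b (fun t => c * f t) = c * cint a b f.
Proof.
move=> hf; case: c => c1 c2; rewrite /cint.
have hr := pconts_ReI hf; have hi := pconts_ImI hf.
have mI : measurable `[a, b]%classic by exact: measurable_itv.
have HZ (k : R) (h : R -> R) : mu.-integrable `[a, b] (EFin \o h) ->
    mu.-integrable `[a, b] (EFin \o (fun t => k * h t)).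
  by move=> H; apply: (integrableZl _ k H); exact: measurable_itv.
congr (_ +i* _)%C.
  rewrite -!RintegralZl // -RintegralB //.
  - by apply: eq_Rintegral => t _; case: (f t).
  - exact: (HZ c1 _ hr).
  - exact: (HZ c2 _ hi).
rewrite -!RintegralZl // -RintegralD //.
- by apply: eq_Rintegral => t _; case: (f t).
- exact: (HZ c1 _ hi).
- exact: (HZ c2 _ hr).
Qed.

Lemma real_int_norm (a b M : R) (f : R -> R) : a <= b ->
  mu.-integrable `[a, b] (EFin \o f) ->
  (forall t, a <= t <= b -> `|f t| <= M) ->
  `|\int[mu]_(t in `[a, b]) f t| <= M * (b - a).
Proof.
move=> ab hf hM.
have mI : measurable `[a, b]%classic by exact: measurable_itv.
apply: le_trans (le_normr_Rintegral _ hf) _; first exact: measurable_itv.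
have -> : M * (b - a) = \int[mu]_(t in `[a, b]) M.
  rewrite Rintegral_cst //; congr (_ * _).
  suff E : mu `[a, b] = (b - a)%:E by exact: (esym (congr1 fine E)).
  apply: etrans (lebesgue_measure_itv _) _; rewrite /= lte_fin.
  case: ltP => [_|ba]; first by rewrite -EFinB.
  have -> : b = a by apply/eqP; rewrite eq_le ba ab.
  by rewrite subrr.
apply: le_Rintegral => //; first exact: (integrable_norm hf).
apply: continuous_compact_integrable; first exact: segment_compact.
by apply: continuous_subspaceT => x; exact: cvg_cst.
Qed.

(** Real and imaginary parts are bounded separately, whence the factor 2 in place of the sharp
    constant 1. *)
Lemma cint_norm a b M g : a <= b -> pconts a b g ->
  (forall t, a <= t <= b -> N (g t) <= M) ->
  N (cint a b g) <= 2 * M * (b - a).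
Proof.
move=> ab hg hM; apply: le_trans (cabs_le_ReIm _) _ => /=.
have h1 := real_int_norm ab (pconts_ReI hg)
  (fun t ht => le_trans (Re_le_cabs (g t)) (hM t ht)).
have h2 := real_int_norm ab (pconts_ImI hg)
  (fun t ht => le_trans (Im_le_cabs (g t)) (hM t ht)).
by rewrite -mulrA mulr_natl mulr2n lerD.
Qed.

Lemma cint_split a m b g : a <= m <= b -> pconts a b g ->
  cint a b g = cint a m g + cint m b g.
Proof.
move=> /andP[am mb] hg.
have H (f : R -> R) : mu.-integrable `[a, b] (EFin \o f) ->
    \int[mu]_(t in `[a, b]) f t =
    \int[mu]_(t in `[a, m]) f t + \int[mu]_(t in `[m, b]) f t.
  move=> hf; have := @Rintegral_itvB _ f (BLeft a) (BRight b) m hf.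
  rewrite !bnd_simp => /(_ am mb) E.
  apply/eqP; rewrite addrC -subr_eq E; apply/eqP.
  apply: Rintegral_itv_obnd_cbnd; apply: integrableS hf => //.
  by apply: subset_itvr; rewrite bnd_simp.
by congr (_ +i* _)%C; apply: H; [exact: pconts_ReI|exact: pconts_ImI].
Qed.

Lemma cint_id a g : cint a a g = 0.
Proof. by rewrite /cint !set_itv1 !Rintegral_set1. Qed.

Lemma real_FTC (a b : R) (f F : R -> R) : a < b ->
  (forall t, a <= t <= b -> {for t, continuous f}) ->
  (forall t, a <= t <= b -> is_derive t 1 F (f t)) ->
  \int[mu]_(t in `[a, b]) f t = F b - F a.
Proof.
move=> ab fc Fd.
have Fc t : a <= t <= b -> {for t, continuous F}.
  move=> /Fd h; apply: differentiable_continuous.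
  by apply/derivable1_diffP; exact: ex_derive.
rewrite /Rintegral (@continuous_FTC2 _ f F) //.
- apply: continuous_in_subspaceT => t /set_mem/=; rewrite in_itv /=; exact: fc.
- split.
  + by move=> t; rewrite in_itv /= => /andP[h1 h2]; have := Fd t;
      rewrite !ltW // => /(_ isT) h; exact: ex_derive.
  + by apply: cvg_at_right_filter; apply: Fc; rewrite lexx ltW.
  + by apply: cvg_at_left_filter; apply: Fc; rewrite lexx ltW.
- move=> t; rewrite in_itv /= => /andP[h1 h2]; have := Fd t.
  by rewrite !ltW // => /(_ isT) h; rewrite derive1E derive_val.
Qed.

Lemma cint_FTC a b f F : a <= b -> pconts a b f ->
  (forall t, a <= t <= b -> pder F t (f t)) -> cint a b f = F b - F a.
Proof.
rewrite le_eqVlt => /predU1P[<- _ _|ab fc Fd].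
  by rewrite cint_id subrr.
have E1 := @real_FTC a b (ReR \o f) (ReR \o F) ab
  (fun t h => pcont_Re (fc t h)) (fun t h => pder_Re (Fd t h)).
have E2 := @real_FTC a b (ImR \o f) (ImR \o F) ab
  (fun t h => pcont_Im (fc t h)) (fun t h => pder_Im (Fd t h)).
rewrite /cint; move: E1 E2 => /= -> ->.
by case: (F a) (F b) => u v [u' v'].
Qed.

Lemma pder0_const a b F : a <= b ->
  (forall t, a <= t <= b -> pder F t 0) -> F b = F a.
Proof.
move=> ab h; have := cint_FTC ab (f := fun=> 0) _ h.
have c0 : pconts a b (fun=> 0).
  by move=> t _ e e0; exists 1 => // s _; rewrite subrr cabs0.
move=> /(_ c0) E; apply/eqP; rewrite -subr_eq0 -E.
have := cint_norm (M := 0) ab c0.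
rewrite mulr0 mul0r => H; rewrite -cabs_eq0 eq_le cabs_ge0 andbT.
by apply: H => t _; rewrite cabs0.
Qed.

End RealPaths.

Section ComplexDerivative.
Variable R : realType.
Local Notation C := (Cplx R).
Local Notation N := (@cabs R).

Definition ccont (f : C -> C) (z : C) := forall e : R, 0 < e ->
  exists2 d : R, 0 < d & forall w, N w < d -> N (f (z + w) - f z) < e.

(** Without quotients the estimate also covers [w = 0], which saves a case distinction in the chain
    rule. *)
Definition cder (f : C -> C) (z a : C) := forall e : R, 0 < e ->
  exists2 d : R, 0 < d &
    forall w, N w < d -> N (f (z + w) - f z - a * w) <= e * N w.

Lemma near_cabsP (z : C) (P : C -> Prop) :
  (\forall q \near z, P q) <->
  exists2 d : R, 0 < d & forall w, N w < d -> P (z + w).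
Proof.
split=> [/nbhs_ballP[e e0 he]|[d d0 hd]].
  have eE : (complex.Re e)%:C%C = e by rewrite RRe_real // gtr0_real.
  exists (complex.Re e); first by rewrite -ltcR eE.
  move=> w hw; apply: he; rewrite /ball /= opprD addrA subrr sub0r normrN.
  by rewrite cabsE -eE ltcR.
apply/nbhs_ballP; exists (d%:C%C) => /=; first by rewrite ltcR.
move=> w; rewrite /ball /= distrC cabsE ltcR => /hd.
by rewrite addrC subrK.
Qed.

Lemma near_cabs_pairP (p : C * C) (P : C * C -> Prop) :
  (\forall q \near p, P q) <->
  exists2 d : R, 0 < d &
    forall u v, N u < d -> N v < d -> P (p.1 + u, p.2 + v).
Proof.
case: p => x y; split=> [/nbhs_ballP[e e0 he]|[d d0 hd]].
  have eE : (complex.Re e)%:C%C = e by rewrite RRe_real // gtr0_real.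
  exists (complex.Re e); first by rewrite -ltcR eE.
  move=> u v hu hv; apply: he; split; rewrite /ball /= opprD addrA subrr sub0r normrN.
    by rewrite cabsE -eE ltcR.
  by rewrite cabsE -eE ltcR.
apply/nbhs_ballP; exists (d%:C%C) => /=; first by rewrite ltcR.
move=> [u v] [] /=; rewrite /ball /= distrC cabsE ltcR => hu.
rewrite distrC cabsE ltcR => hv.
by have := hd _ _ hu hv; rewrite /= ![_ + (_ - _)]addrC !subrK.
Qed.

Lemma cderP f z a : cder f z a <-> is_derive z 1 f a.
Proof.
split=> h.
  have hc : h^-1 *: ((f \o shift z) (h *: (1 : C)) - f z) @[h --> (0:C)^'] --> a.
    apply/cvgrPdist_le => e e0.
    have eE : (complex.Re e)%:C%C = e by rewrite RRe_real // gtr0_real.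
    have [|d d0 hd] := h (complex.Re e); first by rewrite -ltcR eE.
    apply/near_cabsP; exists d => // w hw; rewrite add0r => w0.
    have := hd w hw; rewrite /= [_%:A]mulr1 cabsE -eE lecR => hd'.
    have w0' : 0 < N w by rewrite cabs_gt0.
    rewrite -(ler_pM2r w0'); apply: le_trans hd'.
    rewrite -cabsM -cabsN -mulNr opprB mulrBl /GRing.scale /= mulrAC mulVf // mul1r.
    by rewrite [w + z]addrC.
  by apply: DeriveDef; [apply/cvg_ex; exists a|apply/cvg_lim].
move=> e e0.
have [/cvg_ex[l hl] da] := h.
have la : l = a by rewrite -da; apply/esym/cvg_lim.
move: hl; rewrite la => /cvgrPdist_le /(_ (e%:C%C)).
rewrite ltcR => /(_ e0) /near_cabsP[d d0 hd].
exists d => // w hw.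
have [->|w0] := eqVneq w 0; first by rewrite addr0 subrr mulr0 subr0 cabs0 mulr0.
have := hd w hw; rewrite add0r => /(_ w0).
rewrite /= [_%:A]mulr1 cabsE lecR.
have w0' : 0 < N w by rewrite cabs_gt0.
rewrite -(ler_pM2r w0'); apply: le_trans.
rewrite -cabsM -[leRHS]cabsN -[X in _ <= N X]mulNr opprB mulrBl /GRing.scale /= mulrAC mulVf // mul1r.
by rewrite [w + z]addrC.
Qed.

Lemma cder_diff f z a : cder f z a -> differentiable f z.
Proof. by move=> /cderP h; apply/derivable1_diffP; exact: ex_derive. Qed.

Lemma diff_cder f z : differentiable f z -> cder f z ('d f z 1).
Proof.
by move=> h; apply/cderP; rewrite -deriveE //; apply/derivableP/derivable1_diffP.
Qed.

Lemma cder_ccont f z a : cder f z a -> ccont f z.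
Proof.
move=> h e e0; have [d d0 hd] := h 1 ltr01.
have A0 : 0 < N a + 2 by rewrite ltr_wpDl ?cabs_ge0.
exists (Num.min d (e / (N a + 2))); first by rewrite lt_min d0 divr_gt0.
move=> w; rewrite lt_min => /andP[/hd h1 h2].
rewrite -(subrK (a * w) (_ - _)); apply: le_lt_trans (ler_cabsD _ _) _.
apply: le_lt_trans (_ : (N a + 1) * N w < _).
  by rewrite cabsM; lra.
move: h2; rewrite ltr_pdivlMr //; apply: le_lt_trans.
by rewrite mulrC ler_wpM2l ?cabs_ge0 // lerD2l ler1n.
Qed.

Lemma cder_eq_near f g z a d : 0 < d -> (forall w, N w < d -> f (z + w) = g (z + w)) ->
  cder f z a -> cder g z a.
Proof.
move=> d0 E h e e0; have [d1 d10 hd] := h e e0.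
exists (Num.min d d1); first by rewrite lt_min d0.
move=> w; rewrite lt_min => /andP[h1 h2].
rewrite -E // -{2}[z]addr0 -E ?cabs0 // addr0.
exact: hd.
Qed.

Lemma cder_pder f (z e : C) t a : cder f (z + t%:C%C * e) a ->
  pder (fun s : R => f (z + s%:C%C * e)) t (a * e).
Proof.
move=> h eps eps0.
have E0 : 0 < N e + 1 by rewrite ltr_wpDl ?cabs_ge0.
have [d d0 hd] := h (eps / (N e + 1)) (divr_gt0 eps0 E0).
exists (d / (N e + 1)); first exact: divr_gt0.
move=> s; rewrite ltr_pdivlMr // => hs.
have Ew : N (s%:C%C * e) = `|s| * N e by rewrite cabsM cabsR.
have hw : N (s%:C%C * e) < d.
  by rewrite Ew; apply: le_lt_trans hs; rewrite ler_wpM2l // lerDl.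
have := hd _ hw; rewrite rmorphD /= mulrDl addrA.
rewrite [s%:C%C * (a * e)]mulrCA => /le_trans; apply.
rewrite Ew mulrAC ler_pdivrMr // mulrA ler_wpM2l ?mulr_ge0 //; first exact: ltW.
by rewrite lerDl.
Qed.

Lemma ccont_pcont f (z e : C) t : ccont f (z + t%:C%C * e) ->
  pcont (fun s : R => f (z + s%:C%C * e)) t.
Proof.
move=> h eps eps0.
have E0 : 0 < N e + 1 by rewrite ltr_wpDl ?cabs_ge0.
have [d d0 hd] := h eps eps0.
exists (d / (N e + 1)); first exact: divr_gt0.
move=> s; rewrite ltr_pdivlMr // => hs.
have hw : N (s%:C%C * e) < d.
  by rewrite cabsM cabsR; apply: le_lt_trans hs; rewrite ler_wpM2l // lerDl.
by have := hd _ hw; rewrite rmorphD /= mulrDl addrA.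
Qed.

Lemma cder_cst c z : cder (fun=> c) z 0.
Proof. by apply/cderP; exact: is_derive_cst. Qed.

Lemma cder_id z : cder id z 1.
Proof. by apply/cderP; exact: is_derive_id. Qed.

Lemma cderD f g z a b : cder f z a -> cder g z b -> cder (fun x => f x + g x) z (a + b).
Proof. by move=> /cderP h /cderP k; apply/cderP; exact: is_deriveD. Qed.

Lemma cderN f z a : cder f z a -> cder (fun x => - f x) z (- a).
Proof. by move=> /cderP h; apply/cderP; exact: is_deriveN. Qed.

Lemma cderB f g z a b : cder f z a -> cder g z b -> cder (fun x => f x - g x) z (a - b).
Proof. by move=> h k; apply: cderD => //; exact: cderN. Qed.

Lemma cderM f g z a b : cder f z a -> cder g z b ->
  cder (fun x => f x * g x) z (a * g z + f z * b).
Proof.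
move=> /cderP h /cderP k; apply/cderP.
apply: is_derive_eq (is_deriveM h k) _.
by rewrite addrC /GRing.scale /= [g z * a]mulrC.
Qed.

Lemma cderZ c f z a : cder f z a -> cder (fun x => c * f x) z (c * a).
Proof. by move=> h; have := cderM (cder_cst c z) h; rewrite mul0r add0r. Qed.

Lemma cderV f z a : f z != 0 -> cder f z a -> cder (fun x => (f x)^-1) z (- a / f z ^+ 2).
Proof.
move=> f0 /cderP h; apply/cderP.
have d := @ex_derive _ _ _ _ _ _ _ h.
apply: DeriveDef; first exact: derivableV.
by rewrite deriveV // derive_val /GRing.scale /= mulNr mulrC mulNr.
Qed.

Lemma cder_div f g z a b : g z != 0 -> cder f z a -> cder g z b ->
  cder (fun x => f x / g x) z ((a * g z - f z * b) / g z ^+ 2).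
Proof.
move=> g0 hf hg; have := cderM hf (cderV g0 hg).
by congr (cder _ _ _); field.
Qed.

Lemma cderX f z a n : cder f z a -> cder (fun x => f x ^+ n) z (n%:R * f z ^+ n.-1 * a).
Proof.
move=> h; elim: n => [|n ih].
  by rewrite !mul0r; have := cder_cst 1 z.
have := cderM h ih; under eq_fun do rewrite -exprS; congr cder.
case: n {ih} => [|n]; first by rewrite expr0 /=; ring.
by rewrite /= -[n.+2]addn1 natrD exprS; ring.
Qed.

Lemma cder_comp f g z a b : cder f z a -> cder g (f z) b ->
  cder (fun x => g (f x)) z (b * a).
Proof.
move=> hf hg e e0.
have A0 : 0 < N a + 1 by rewrite ltr_wpDl ?cabs_ge0.
have B0 : 0 < N b + 1 by rewrite ltr_wpDl ?cabs_ge0.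
have [|d d0 hd] := hg (e / 2 / (N a + 1)); first by rewrite !divr_gt0.
have [d1 d10 hd1] := hf 1 ltr01.
have [|d2 d20 hd2] := hf (e / 2 / (N b + 1)); first by rewrite !divr_gt0.
exists (Num.min d1 (Num.min d2 (d / (N a + 1)))).
  by rewrite !lt_min d10 d20 divr_gt0.
move=> w; rewrite !lt_min => /and3P[/hd1 h1 /hd2 h2]; rewrite ltr_pdivlMr // => h3.
set k := f (z + w) - f z.
have kE : f (z + w) = f z + k by rewrite /k addrCA subrr addr0.
have hk : N k <= (N a + 1) * N w.
  rewrite -(subrK (a * w) k) (le_trans (ler_cabsD _ _)) // cabsM; lra.
have hk' : N k < d by apply: le_lt_trans hk _; rewrite mulrC.
rewrite kE.
have -> : g (f z + k) - g (f z) - b * a * w =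
  (g (f z + k) - g (f z) - b * k) + b * (k - a * w) by ring.
apply: le_trans (ler_cabsD _ _) _; rewrite cabsM.
have h4 : N (g (f z + k) - g (f z) - b * k) <= e / 2 * N w.
  apply: le_trans (hd _ hk') _; rewrite mulrAC ler_pdivrMr // -[leRHS]mulrA.
  by rewrite ler_wpM2l ?divr_ge0 ?(ltW e0) // mulrC.
have h5 : N b * N (k - a * w) <= e / 2 * N w.
  apply: le_trans (_ : (N b + 1) * N (k - a * w) <= _).
    by rewrite ler_wpM2r ?cabs_ge0 // lerDl.
  by move: h2; rewrite mulrAC ler_pdivlMr // [leLHS]mulrC.
lra.
Qed.

Lemma cder_unique f z a b : cder f z a -> cder f z b -> a = b.
Proof. by move=> /cderP h /cderP k; rewrite -(@derive_val _ _ _ _ _ _ _ h) derive_val. Qed.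

Lemma ccont_sub f g z : ccont f z -> ccont g z -> ccont (fun x => f x - g x) z.
Proof.
move=> hf hg e e0; have e2 : 0 < e / 2 by rewrite divr_gt0.
have [d d0 hd] := hf _ e2; have [k k0 hk] := hg _ e2.
exists (Num.min d k); first by rewrite lt_min d0.
move=> w; rewrite lt_min => /andP[/hd h1 /hk h2].
have -> : f (z + w) - g (z + w) - (f z - g z) =
  (f (z + w) - f z) - (g (z + w) - g z) by ring.
by apply: le_lt_trans (ler_cabsD _ _) _; rewrite cabsN; lra.
Qed.

Lemma ccont_near_bounded f z : ccont f z ->
  exists2 d : R, 0 < d & forall w, N w < d -> N (f (z + w)) < N (f z) + 1.
Proof.
move=> /(_ 1 ltr01)[d d0 hd]; exists d => // w /hd h.
by have := cabs_lerB (f (z + w)) (f z); lra.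
Qed.

Lemma ccontM f g z : ccont f z -> ccont g z -> ccont (fun x => f x * g x) z.
Proof.
move=> hf hg e e0.
have [d1 d10 hd1] := ccont_near_bounded hf.
have G0 : 0 < N (g z) + 1 by rewrite ltr_wpDl ?cabs_ge0.
have F0 : 0 < N (f z) + 1 by rewrite ltr_wpDl ?cabs_ge0.
have [|d d0 hd] := hf (e / 2 / (N (g z) + 1)); first by rewrite !divr_gt0.
have [|k k0 hk] := hg (e / 2 / (N (f z) + 1)); first by rewrite !divr_gt0.
exists (Num.min d1 (Num.min d k)); first by rewrite !lt_min d0 d10.
move=> w; rewrite !lt_min => /and3P[/hd1 h1 /hd h2 /hk h3].
have -> : f (z + w) * g (z + w) - f z * g z =
  f (z + w) * (g (z + w) - g z) + (f (z + w) - f z) * g z by ring.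
apply: le_lt_trans (ler_cabsD _ _) _; rewrite !cabsM.
rewrite ltr_pdivlMr // in h2; rewrite ltr_pdivlMr // in h3.
have h4 : N (f (z + w)) * N (g (z + w) - g z) <= e / 2.
  apply: le_trans (ltW h3); rewrite mulrC ler_wpM2l ?cabs_ge0 //; exact: ltW.
have h5 : N (f (z + w) - f z) * N (g z) < e / 2.
  by apply: le_lt_trans h2; rewrite ler_wpM2l ?cabs_ge0 // lerDl.
lra.
Qed.

End ComplexDerivative.

(** * Cauchy's theorem and Taylor expansions *)

Section Rectangles.
Variable R : realType.
Local Notation C := (Cplx R).
Local Notation N := (@cabs R).
Local Notation I := ('i%C : C).

(** The factor 1 brings a horizontal segment to the form [z + t * e] of [cder_pder] and
    [ccont_pcont]. *)
Definition hline (f : C -> C) (c t : R) : C := f (I * c%:C%C + t%:C%C * 1).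
Definition vline (f : C -> C) (a t : R) : C := f (a%:C%C + t%:C%C * I).

(** The counterclockwise integral of [f z dz] around the boundary of a rectangle. *)
Definition rint (f : C -> C) (a b c d : R) : C :=
  cint a b (hline f c) - cint a b (hline f d)
  + I * (cint c d (vline f b) - cint c d (vline f a)).

Definition mkz (s t : R) : C := s%:C%C + t%:C%C * I.

Lemma mkzC s t : I * t%:C%C + s%:C%C * 1 = mkz s t.
Proof. by rewrite /mkz; ring. Qed.

Definition hcont f a b c := forall s, a <= s <= b -> ccont f (mkz s c).
Definition vcont f c d a := forall t, c <= t <= d -> ccont f (mkz a t).

Lemma hcontP f a b c : hcont f a b c -> pconts a b (hline f c).
Proof. by move=> h t ht; apply: ccont_pcont; rewrite mkzC; exact: h. Qed.

Lemma vcontP f c d a : vcont f c d a -> pconts c d (vline f a).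
Proof. by move=> h t ht; apply: ccont_pcont; exact: h. Qed.

Definition bcont f a b c d :=
  [/\ hcont f a b c, hcont f a b d, vcont f c d a & vcont f c d b].

Lemma rint_hsplit f a m b c d : a <= m <= b -> hcont f a b c -> hcont f a b d ->
  rint f a b c d = rint f a m c d + rint f m b c d.
Proof.
move=> amb hc hd; rewrite /rint (cint_split amb (hcontP hc)).
by rewrite (cint_split amb (hcontP hd)); ring.
Qed.

Lemma rint_vsplit f a b c m d : c <= m <= d -> vcont f c d a -> vcont f c d b ->
  rint f a b c d = rint f a b c m + rint f a b m d.
Proof.
move=> cmd ha hb; rewrite /rint (cint_split cmd (vcontP ha)).
by rewrite (cint_split cmd (vcontP hb)); ring.
Qed.

Lemma rintD f g a b c d : bcont f a b c d -> bcont g a b c d ->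
  rint (fun z => f z + g z) a b c d = rint f a b c d + rint g a b c d.
Proof.
move=> [f1 f2 f3 f4] [g1 g2 g3 g4]; rewrite /rint.
rewrite !(cintD (hcontP f1) (hcontP g1), cintD (hcontP f2) (hcontP g2)).
rewrite !(cintD (vcontP f3) (vcontP g3), cintD (vcontP f4) (vcontP g4)).
by ring.
Qed.

Lemma rintZ k f a b c d : bcont f a b c d ->
  rint (fun z => k * f z) a b c d = k * rint f a b c d.
Proof.
move=> [f1 f2 f3 f4]; rewrite /rint.
rewrite !(cintZ k (hcontP f1), cintZ k (hcontP f2)).
rewrite !(cintZ k (vcontP f3), cintZ k (vcontP f4)).
by ring.
Qed.

Definition on_boundary (a b c d s t : R) :=
  (a <= s <= b) && (c <= t <= d) && [|| s == a, s == b, t == c | t == d].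

Lemma bcont_boundary f a b c d : a <= b -> c <= d ->
  (forall s t, on_boundary a b c d s t -> ccont f (mkz s t)) -> bcont f a b c d.
Proof.
by move=> ab cd h; split=> s hs; apply: h; rewrite /on_boundary !lexx hs ?ab ?cd ?eqxx ?orbT.
Qed.

Lemma eq_rint f g a b c d : a <= b -> c <= d ->
  (forall s t, on_boundary a b c d s t -> f (mkz s t) = g (mkz s t)) ->
  rint f a b c d = rint g a b c d.
Proof.
move=> ab cd h; rewrite /rint; congr (_ - _ + _ * (_ - _)); apply: eq_cint => t ht;
  rewrite /hline /vline ?mkzC; apply: h;
  by rewrite /on_boundary !lexx ht ?ab ?cd ?eqxx ?orbT.
Qed.

Lemma rint_norm f a b c d M : a <= b -> c <= d -> bcont f a b c d ->
  (forall s t, on_boundary a b c d s t -> N (f (mkz s t)) <= M) ->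
  N (rint f a b c d) <= 4 * M * ((b - a) + (d - c)).
Proof.
move=> ab cd [f1 f2 f3 f4] hM.
have h1 : N (cint a b (hline f c)) <= 2 * M * (b - a).
  apply: cint_norm ab (hcontP f1) _ => t ht; rewrite /hline mkzC; apply: hM.
  by rewrite /on_boundary ht lexx cd eqxx !orbT.
have h2 : N (cint a b (hline f d)) <= 2 * M * (b - a).
  apply: cint_norm ab (hcontP f2) _ => t ht; rewrite /hline mkzC; apply: hM.
  by rewrite /on_boundary ht lexx cd eqxx !orbT.
have h3 : N (cint c d (vline f a)) <= 2 * M * (d - c).
  apply: cint_norm cd (vcontP f3) _ => t ht; apply: hM.
  by rewrite /on_boundary ht lexx ab eqxx.
have h4 : N (cint c d (vline f b)) <= 2 * M * (d - c).
  apply: cint_norm cd (vcontP f4) _ => t ht; apply: hM.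
  by rewrite /on_boundary ht lexx ab eqxx !orbT.
rewrite /rint; apply: le_trans (ler_cabsD _ _) _.
rewrite cabsM cabsi mul1r.
have := ler_cabsD (cint a b (hline f c)) (- cint a b (hline f d)).
have := ler_cabsD (cint c d (vline f b)) (- cint c d (vline f a)).
rewrite !cabsN; lra.
Qed.

(** Each side contributes the difference of [F] at its ends, and these differences cancel around the
    rectangle. *)
Lemma rint_FTC f F a b c d : a <= b -> c <= d -> bcont f a b c d ->
  (forall s t, on_boundary a b c d s t -> cder F (mkz s t) (f (mkz s t))) ->
  rint f a b c d = 0.
Proof.
move=> ab cd [f1 f2 f3 f4] hF.
have H y : (c <= y <= d) && ((y == c) || (y == d)) -> pconts a b (hline f y) ->
    cint a b (hline f y) = F (mkz b y) - F (mkz a y).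
  move=> /andP[cyd yE] hc; rewrite (cint_FTC ab (F := hline F y) hc) /hline ?mkzC //.
  move=> t ht; rewrite /hline -[X in pder _ _ X]mulr1; apply: cder_pder.
  by rewrite !mkzC; apply: hF; rewrite /on_boundary ht cyd /= yE !orbT.
have V x : (a <= x <= b) && ((x == a) || (x == b)) -> pconts c d (vline f x) ->
    I * cint c d (vline f x) = F (mkz x d) - F (mkz x c).
  move=> /andP[axb xE] hc; rewrite -cintZ //.
  have hc' : pconts c d (fun t => I * vline f x t).
    move=> t ht e e0; have [del del0 hd] := hc t ht e e0; exists del => // s /hd.
    by rewrite -mulrBr cabsM cabsi mul1r.
  rewrite (cint_FTC cd (F := vline F x) hc') /vline //.
  move=> t ht; rewrite /vline mulrC; apply: cder_pder.
  by apply: hF; rewrite /on_boundary ht axb /= orbA xE.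
rewrite /rint mulrBr.
rewrite (H c) ?lexx ?cd ?eqxx //; last exact: hcontP.
rewrite (H d) ?lexx ?cd ?eqxx ?orbT //; last exact: hcontP.
rewrite (V a) ?lexx ?ab ?eqxx //; last exact: vcontP.
rewrite (V b) ?lexx ?ab ?eqxx ?orbT //; last exact: vcontP.
by ring.
Qed.

Definition rdiff f a b c d := forall s t, a <= s <= b -> c <= t <= d ->
  exists k, cder f (mkz s t) k.

Lemma rdiff_bcont f a b c d : a <= b -> c <= d -> rdiff f a b c d -> bcont f a b c d.
Proof.
move=> ab cd h; apply: bcont_boundary => // s t /andP[/andP[hs ht] _].
by have [k hk] := h s t hs ht; exact: cder_ccont hk.
Qed.

Lemma rdiff_sub f a b c d a' b' c' d' : a <= a' -> b' <= b -> c <= c' -> d' <= d ->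
  rdiff f a b c d -> rdiff f a' b' c' d'.
Proof.
move=> h1 h2 h3 h4 h s t /andP[s1 s2] /andP[t1 t2]; apply: h.
  by rewrite (le_trans h1 s1) (le_trans s2 h2).
by rewrite (le_trans h3 t1) (le_trans t2 h4).
Qed.

Lemma nested_intervals (a b : nat -> R) :
  (forall n, a n <= a n.+1) -> (forall n, b n.+1 <= b n) -> (forall n, a n <= b n) ->
  exists x, forall n, a n <= x <= b n.
Proof.
move=> ha hb hab.
have ma n k : a n <= a (n + k)%N.
  by elim: k => [|k ih]; rewrite ?addn0 // addnS (le_trans ih).
have mb n k : b (n + k)%N <= b n.
  by elim: k => [|k ih]; rewrite ?addn0 // addnS (le_trans _ ih).
have H m n : a m <= b n.
  by apply: le_trans (ma m n) _; apply: le_trans (hab _) _; rewrite addnC mb.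
exists (sup (range a)) => n; apply/andP; split.
  apply: ub_le_sup; last by exists n.
  by exists (b 0%N) => _ [m _ <-].
apply: ge_sup; first by exists (a 0%N); exists 0%N.
by move=> _ [m _ <-].
Qed.

Lemma pow2_large (w e : R) : 0 < e -> exists n, w < e * 2 ^+ n.
Proof.
move=> e0; exists (Num.bound `|w / e|).
rewrite mulrC -ltr_pdivrMr //; apply: le_lt_trans (ler_norm _) _.
apply: lt_trans (archi_boundP (normr_ge0 _)) _.
by rewrite -natrX ltr_nat ltn_expl.
Qed.

Section Goursat.
Variables (f : C -> C) (w h eps : R).
Hypotheses (w0 : 0 <= w) (h0 : 0 <= h).

(** The threshold is quadratic in the side lengths, so it drops by the factor 4 when a rectangle is
    quartered. *)
Definition large_at (n : nat) (a c : R) :=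
  eps * ((w + h) / 2 ^+ n) ^+ 2 < N (rint f a (a + w / 2 ^+ n) c (c + h / 2 ^+ n)).

Definition in_corner (n : nat) (p : R * R) :=
  rdiff f p.1 (p.1 + w / 2 ^+ n) p.2 (p.2 + h / 2 ^+ n).

Lemma half_pow (x : R) n : x / 2 ^+ n = x / 2 ^+ n.+1 + x / 2 ^+ n.+1.
Proof.
have : (2 : R) ^+ n != 0 by rewrite expf_neq0.
by rewrite exprS => ?; field.
Qed.

Definition corner_of (n : nat) (p q : R * R) :=
  [/\ p.1 <= q.1, q.1 <= p.1 + w / 2 ^+ n.+1, p.2 <= q.2 & q.2 <= p.2 + h / 2 ^+ n.+1].

(** The integrals around the four quarters add up to the whole one, and the threshold is four times
    that of a quarter; hence some quarter stays above its threshold. *)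
Lemma quarter n p : in_corner n p -> large_at n p.1 p.2 ->
  exists q, [/\ corner_of n p q, in_corner n.+1 q & large_at n.+1 q.1 q.2].
Proof.
case: p => a c; rewrite /in_corner /large_at /= => dif big.
set w' := w / 2 ^+ n.+1; set h' := h / 2 ^+ n.+1.
have w'0 : 0 <= w' by rewrite divr_ge0 // exprn_ge0.
have h'0 : 0 <= h' by rewrite divr_ge0 // exprn_ge0.
have Ew : w / 2 ^+ n = w' + w' := half_pow w n.
have Eh : h / 2 ^+ n = h' + h' := half_pow h n.
rewrite Ew Eh in dif big.
have [f1 f2 f3 f4] : bcont f a (a + (w' + w')) c (c + (h' + h')).
  by apply: rdiff_bcont dif; rewrite lerDl addr_ge0.
have sub a' c' : a <= a' <= a + w' -> c <= c' <= c + h' ->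
    rdiff f a' (a' + w') c' (c' + h').
  by move=> /andP[? ?] /andP[? ?]; apply: rdiff_sub dif => //; rewrite addrA lerD2r.
have sub' a' : a <= a' <= a + w' -> rdiff f a' (a' + w') c (c + (h' + h')).
  by move=> /andP[? ?]; apply: rdiff_sub dif => //; rewrite addrA lerD2r.
have La : a <= a <= a + w' by rewrite lexx lerDl.
have La' : a <= a + w' <= a + w' by rewrite lexx lerDl w'0.
have Lc : c <= c <= c + h' by rewrite lexx lerDl.
have Lc' : c <= c + h' <= c + h' by rewrite lexx lerDl h'0.
have [_ _ g3 g4] : bcont f a (a + w') c (c + (h' + h')).
  by apply: rdiff_bcont (sub' _ La); rewrite lerDl ?addr_ge0.
have [_ _ k3 k4] : bcont f (a + w') (a + w' + w') c (c + (h' + h')).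
  by apply: rdiff_bcont (sub' _ La'); rewrite lerDl ?addr_ge0.
have amb : a <= a + w' <= a + (w' + w') by rewrite addrA !lerDl w'0.
have cmd : c <= c + h' <= c + (h' + h') by rewrite addrA !lerDl h'0.
rewrite (rint_hsplit amb f1 f2) in big.
have Ea : a + (w' + w') = a + w' + w' := addrA _ _ _.
have Ec : c + (h' + h') = c + h' + h' := addrA _ _ _.
rewrite Ec in g3 g4 k3 k4 cmd; rewrite Ea Ec in big.
rewrite (rint_vsplit cmd g3 g4) (rint_vsplit cmd k3 k4) in big.
have S4 : eps * ((w + h) / 2 ^+ n) ^+ 2 =
    eps * ((w + h) / 2 ^+ n.+1) ^+ 2 * 4.
  by rewrite [_ / 2 ^+ n]half_pow; ring.
rewrite S4 in big; move: big.
set S := eps * _.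
set r1 := rint _ _ _ _ _; set r2 := rint _ _ _ _ _.
set r3 := rint _ _ _ _ _; set r4 := rint _ _ _ _ _ => big.
have n1 := ler_cabsD (r1 + r2) (r3 + r4).
have n2 := ler_cabsD r1 r2.
have n3 := ler_cabsD r3 r4.
have Q a' c' : a <= a' <= a + w' -> c <= c' <= c + h' ->
    S < N (rint f a' (a' + w') c' (c' + h')) ->
    exists q : R * R, [/\ corner_of n (a, c) q,
      rdiff f q.1 (q.1 + w') q.2 (q.2 + h')
      & S < N (rint f q.1 (q.1 + w') q.2 (q.2 + h'))].
  move=> ha hc hS; exists (a', c'); split => //; last exact: sub.
  by case/andP: ha => ? ?; case/andP: hc.
have [b1|b1] := ltP S (N r1); first exact: Q b1.
have [b2|b2] := ltP S (N r2); first exact: Q b2.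
have [b3|b3] := ltP S (N r3); first exact: Q b3.
have [b4|b4] := ltP S (N r4); first exact: Q b4.
exfalso; move: big; rewrite ltNge => /negP; apply.
apply: le_trans n1 _; apply: le_trans (lerD n2 n3) _.
have -> : S * 4 = S + S + (S + S) by ring.
exact: lerD (lerD b1 b2) (lerD b3 b4).
Qed.

(** Nested quarters above their thresholds would shrink to a point. Near it [f] is affine up to an
    error that is small against the diameter; the affine part has a primitive, and the error stays
    below the threshold. *)
Lemma goursat_aux a c : 0 < eps -> rdiff f a (a + w) c (c + h) ->
  N (rint f a (a + w) c (c + h)) <= eps * (w + h) ^+ 2.
Proof.
move=> eps0 dif; rewrite leNgt; apply/negP => big.
(* The hypotheses of [quarter] are part of the property, so that [choice] yields a total successor
   function. *)
pose good (np : nat * (R * R)) (q : R * R) :=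
  in_corner np.1 np.2 -> large_at np.1 np.2.1 np.2.2 ->
  [/\ corner_of np.1 np.2 q, in_corner np.1.+1 q & large_at np.1.+1 q.1 q.2].
have [nxt nxtP] : {g & forall np, good np (g np)}.
  apply: choice.
  move=> [n p]; rewrite /good /=.
  have [[h1 h2]|nh] := pselect (in_corner n p /\ large_at n p.1 p.2).
    by have [q hq] := quarter h1 h2; exists q.
  by exists p => h1 h2; case: nh.
pose q := fix q n := if n is m.+1 then nxt (m, q m) else (a, c).
have qP n : in_corner n (q n) /\ large_at n (q n).1 (q n).2.
  elim: n => [|n [ih1 ih2]].
    by rewrite /in_corner /large_at /= expr0 !divr1.
  by have [_ h1 h2] := nxtP (n, q n) ih1 ih2.
have qC n : corner_of n (q n) (q n.+1).
  by have [h1 h2] := qP n; have [] := nxtP (n, q n) h1 h2.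
have p2 n : (0 : R) < 2 ^+ n by rewrite exprn_gt0.
have [x xP] : exists x, forall n, (q n).1 <= x <= (q n).1 + w / 2 ^+ n.
  apply: nested_intervals => n; first by have [] := qC n.
    by have [_ + _ _] := qC n; rewrite (half_pow w n) addrA lerD2r.
  by rewrite lerDl divr_ge0 // ltW.
have [y yP] : exists y, forall n, (q n).2 <= y <= (q n).2 + h / 2 ^+ n.
  apply: nested_intervals => n; first by have [] := qC n.
    by have [_ _ _ +] := qC n; rewrite (half_pow h n) addrA lerD2r.
  by rewrite lerDl divr_ge0 // ltW.
have [k kP] : exists k, cder f (mkz x y) k.
  have [+ _] := qP 0%N; rewrite /in_corner /= => d0.
  by apply: d0; [exact: (xP 0%N)|exact: (yP 0%N)].
(* [rint_norm] costs a factor 4, so [eps / 8] uses only half of the threshold. *)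
have [|d d0 hd] := kP (eps / 8); first by rewrite divr_gt0.
have [n hn] := pow2_large (w + h) d0.
rewrite -ltr_pdivrMr // in hn.
have [din] := qP n; rewrite /large_at ltNge => /negP; apply.
move: din; rewrite /in_corner.
set w' := w / _; set h' := h / _; set a' := (q n).1; set c' := (q n).2 => din.
have w'0 : 0 <= w' by rewrite divr_ge0 // ltW.
have h'0 : 0 <= h' by rewrite divr_ge0 // ltW.
rewrite [X in _ <= eps * X ^+ 2]mulrDl -/w' -/h'.
have wh : w' + h' < d by rewrite -mulrDl.
have ab : a' <= a' + w' by rewrite lerDl.
have cd : c' <= c' + h' by rewrite lerDl.
pose z0 := mkz x y.
pose L := fun z : C => f z0 - k * z0 + k * z.
have cderL z : cder L z k.
  have := cderD (cder_cst (f z0 - k * z0) z) (cderZ k (cder_id z)).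
  by rewrite add0r mulr1.
pose FL := fun z : C => (f z0 - k * z0) * z + (k / 2) * (z * z).
have cderFL z : cder FL z (L z).
  have := cderD (cderZ (f z0 - k * z0) (cder_id z))
     (cderZ (k / 2) (cderM (cder_id z) (cder_id z))).
  by congr (cder _ _ _); rewrite /L; field.
have Lb : bcont L a' (a' + w') c' (c' + h').
  by apply: bcont_boundary => // s t _; exact: cder_ccont (cderL _).
have L0 : rint L a' (a' + w') c' (c' + h') = 0.
  by apply: (rint_FTC (F := FL) ab cd Lb).
have fb := rdiff_bcont ab cd din.
pose r := fun z => f z + (- 1) * L z.
have NLb : bcont (fun z => (- 1) * L z) a' (a' + w') c' (c' + h').
  apply: bcont_boundary => // s t _; exact: cder_ccont (cderZ (-1) (cderL _)).
have rE : rint r a' (a' + w') c' (c' + h') = rint f a' (a' + w') c' (c' + h').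
  by rewrite /r rintD // rintZ // L0 mulr0 addr0.
have rb : bcont r a' (a' + w') c' (c' + h').
  apply: rdiff_bcont => // s t hs ht; have [k' hk'] := din s t hs ht.
  by eexists; exact: cderD hk' (cderZ (-1) (cderL _)).
rewrite -rE.
have M s t : on_boundary a' (a' + w') c' (c' + h') s t -> N (r (mkz s t)) <= eps / 8 * (w' + h').
  move=> /andP[/andP[/andP[s1 s2] /andP[t1 t2]] _].
  have Ez : mkz s t = z0 + (mkz s t - z0) by rewrite addrC subrK.
  have Nz : N (mkz s t - z0) <= w' + h'.
    have -> : mkz s t - z0 = (s - x)%:C%C + (t - y)%:C%C * I.
      by rewrite /z0 /mkz !rmorphB /=; ring.
    apply: le_trans (ler_cabsD _ _) _; rewrite cabsM cabsi mulr1 !cabsR.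
    have /andP[x1 x2] := xP n; have /andP[y1 y2] := yP n.
    by apply: lerD; rewrite ler_norml; apply/andP; split;
       rewrite -/a' -/c' -/w' -/h' in x1 x2 y1 y2; lra.
  have := hd _ (le_lt_trans Nz wh); rewrite -Ez => H.
  have -> : r (mkz s t) = f (mkz s t) - f z0 - k * (mkz s t - z0).
    by rewrite /r /L; ring.
  by apply: le_trans H _; rewrite ler_wpM2l // divr_ge0 // ltW.
apply: le_trans (rint_norm ab cd rb M) _.
rewrite ![_ + _ - _]addrAC !subrr !add0r expr2.
have := mulr_ge0 (ltW eps0) (sqr_ge0 (w' + h')); rewrite expr2; lra.
Qed.

End Goursat.

Lemma goursat f a b c d : a <= b -> c <= d -> rdiff f a b c d -> rint f a b c d = 0.
Proof.
move=> ab cd dif; apply/eqP; rewrite -cabs_eq0 eq_le cabs_ge0 andbT.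
have w0 : 0 <= b - a by rewrite subr_ge0.
have h0 : 0 <= d - c by rewrite subr_ge0.
apply/ler_addgt0Pr => e e0; rewrite add0r.
set S := (b - a + (d - c)) ^+ 2.
have S0 : 0 < S + 1 by rewrite ltr_wpDl ?sqr_ge0.
have := @goursat_aux f (b - a) (d - c) (e / (S + 1)) w0 h0 a c (divr_gt0 e0 S0).
rewrite (addrC a) (addrC c) !subrK => /(_ dif) /le_trans; apply.
rewrite -/S mulrAC ler_pdivrMr // ler_pM2l //.
by rewrite lerDl.
Qed.

End Rectangles.

Section CauchySquare.
Variable R : realType.
Local Notation C := (Cplx R).
Local Notation N := (@cabs R).

Lemma mkzE s t : mkz s t = (s +i* t)%C :> C.
Proof. by rewrite /mkz [RHS]complexE /= mulrC. Qed.

Lemma mkz_inj s t u v : mkz s t = mkz u v :> C -> s = u /\ t = v.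
Proof. by rewrite !mkzE => -[-> ->]. Qed.

Lemma mkz_Re_Im (z : C) : mkz (complex.Re z) (complex.Im z) = z.
Proof. by rewrite mkzE; case: z. Qed.

Lemma mkzB s t u v : mkz s t - mkz u v = mkz (s - u) (t - v) :> C.
Proof. by rewrite /mkz !rmorphB /=; ring. Qed.

Lemma cabs_mkz_ge1 s t : `|s| <= N (mkz s t).
Proof. by have := Re_le_cabs (mkz s t : C); rewrite mkzE. Qed.

Lemma cabs_mkz_ge2 s t : `|t| <= N (mkz s t).
Proof. by have := Im_le_cabs (mkz s t : C); rewrite mkzE. Qed.

Lemma cabs_mkz_le s t : N (mkz s t) <= `|s| + `|t|.
Proof. by have := cabs_le_ReIm (mkz s t : C); rewrite mkzE. Qed.

(** Goursat's theorem shrinks the rectangle to any small square around the point. There the quotient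
    is bounded, because [f] is differentiable, and the perimeter tends to 0. *)
Lemma rint_quotient0 (f : C -> C) a b c d u v : a < u < b -> c < v < d ->
  rdiff f a b c d ->
  rint (fun z => (f z - f (mkz u v)) / (z - mkz u v)) a b c d = 0.
Proof.
move=> /andP[au ub] /andP[cv vd] df; set w := mkz u v.
(* By [z / 0 = 0] the value of [h] at [w] is 0, so [h] may be discontinuous there; it is
   differentiable elsewhere and bounded near [w], which suffices. *)
pose h z := (f z - f w) / (z - w).
have hd s t : a <= s <= b -> c <= t <= d -> (s != u) || (t != v) ->
    exists k, cder h (mkz s t) k.
  move=> hs ht ne; have [k hk] := df s t hs ht.
  have zw : mkz s t - w != 0.
    rewrite subr_eq0; apply/eqP => /mkz_inj[E1 E2].
    by rewrite E1 E2 !eqxx in ne.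
  have D1 := cderB hk (cder_cst (f w) (mkz s t)).
  have D2 := cderB (cder_id (mkz s t)) (cder_cst w (mkz s t)).
  by eexists; exact: (cder_div (g := fun z => z - w) zw D1 D2).
have hc s t : a <= s <= b -> c <= t <= d -> (s != u) || (t != v) -> ccont h (mkz s t).
  by move=> hs ht /(hd s t hs ht)[k /cder_ccont].
have [k hk] : exists k, cder f w k by apply: df; rewrite !ltW.
have [del del0 hdel] := hk 1 ltr01.
have hM s t : N (mkz s t - w) < del -> N (h (mkz s t)) <= N k + 1.
  rewrite /h; set z := mkz s t => zw.
  have [->|zw0] := eqVneq z w.
    by rewrite !subrr mul0r cabs0 addr_ge0 // cabs_ge0.
  have zw1 : 0 < N (z - w) by rewrite cabs_gt0 subr_eq0.
  rewrite cabsM cabsV ler_pdivrMr //.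
  have := hdel _ zw; rewrite [w + _]addrC subrK => H.
  rewrite -(subrK (k * (z - w)) (f z - f w)) (le_trans (ler_cabsD _ _)) //.
  by rewrite cabsM mulrDl addrC lerD2l.
have core e : 0 < e -> a < u - e -> u + e < b -> c < v - e -> v + e < d ->
    rint h a b c d = rint h (u - e) (u + e) (v - e) (v + e).
  move=> e0 h1 h2 h3 h4.
  have z1 : rint h a (u - e) c d = 0.
    apply: goursat; [exact: ltW|lra|] => s t /andP[s1 s2] ht; apply: hd => //.
      by rewrite s1; lra.
    by apply/orP; left; lra.
  have z2 : rint h (u + e) b c d = 0.
    apply: goursat; [exact: ltW|lra|] => s t /andP[s1 s2] ht; apply: hd => //.
      by rewrite s2 andbT; lra.
    by apply/orP; left; lra.
  have z3 : rint h (u - e) (u + e) c (v - e) = 0.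
    apply: goursat; [lra|exact: ltW|] => s t /andP[s1 s2] /andP[t1 t2]; apply: hd.
    - by apply/andP; split; lra.
    - by apply/andP; split; lra.
    - by apply/orP; right; lra.
  have z4 : rint h (u - e) (u + e) (v + e) d = 0.
    apply: goursat; [lra|exact: ltW|] => s t /andP[s1 s2] /andP[t1 t2]; apply: hd.
    - by apply/andP; split; lra.
    - by apply/andP; split; lra.
    - by apply/orP; right; lra.
  have H a' b' y : a <= a' -> b' <= b -> c <= y <= d -> y != v -> hcont h a' b' y.
    move=> ? ? ? ? s /andP[? ?]; apply: hc => //; last by apply/orP; right.
    by apply/andP; split; lra.
  have V c' d' x : c <= c' -> d' <= d -> a <= x <= b -> x != u -> vcont h c' d' x.
    move=> ? ? ? ? s /andP[? ?]; apply: hc => //; last by apply/orP; left.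
    by apply/andP; split; lra.
  rewrite (@rint_hsplit _ h a (u - e) b c d); [|lra|apply: H; lra|apply: H; lra].
  rewrite z1 add0r (@rint_hsplit _ h (u - e) (u + e) b c d); [|lra|apply: H; lra|apply: H; lra].
  rewrite z2 addr0 (@rint_vsplit _ h (u - e) (u + e) c (v - e) d); [|lra|apply: V; lra|apply: V; lra].
  rewrite z3 add0r (@rint_vsplit _ h (u - e) (u + e) (v - e) (v + e) d); [|lra|apply: V; lra|apply: V; lra].
  by rewrite z4 addr0.
apply/eqP; rewrite -cabs_eq0 eq_le cabs_ge0 andbT.
apply/ler_addgt0Pr => e e0; rewrite add0r.
have k1 : 0 < N k + 1 by rewrite ltr_wpDl ?cabs_ge0.
(* The side [m] keeps the square inside the rectangle and within distance [del] of [w]; the bound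
   [e / (16 (N k + 1))] makes the estimate [8 m (N k + 1)] at most [e / 2]. *)
pose m := Num.min (e / (16 * (N k + 1))) (Num.min (del / 2)
  (Num.min (Num.min (u - a) (b - u)) (Num.min (v - c) (d - v)))).
have m0 : 0 < m by rewrite !lt_min !subr_gt0 au ub cv vd !divr_gt0 // mulr_gt0.
have : m <= m by [].
rewrite {2}/m !le_min => /and4P[m1 m2 /andP[m3 m4] /andP[m5 m6]].
rewrite (core (m / 2)) //; [|lra|lra|lra|lra|lra].
have ab : u - m / 2 <= u + m / 2 by lra.
have cd : v - m / 2 <= v + m / 2 by lra.
have bc : bcont h (u - m / 2) (u + m / 2) (v - m / 2) (v + m / 2).
  apply: bcont_boundary => // s t /andP[/andP[/andP[s1 s2] /andP[t1 t2]] q].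
  apply: hc; [apply/andP; split; lra|apply/andP; split; lra|].
  by case/or4P: q => /eqP ->; apply/orP; [left|left|right|right]; lra.
apply: le_trans (rint_norm (M := N k + 1) ab cd bc _) _.
  move=> s t /andP[/andP[/andP[s1 s2] /andP[t1 t2]] _]; apply: hM.
  rewrite mkzB; apply: le_lt_trans (cabs_mkz_le _ _) _.
  have : `|s - u| <= m / 2 by rewrite ler_norml; apply/andP; split; lra.
  have : `|t - v| <= m / 2 by rewrite ler_norml; apply/andP; split; lra.
  lra.
rewrite ler_pdivlMr ?mulr_gt0 // in m1.
have := mulr_gt0 m0 k1.
have -> : u + m / 2 - (u - m / 2) + (v + m / 2 - (v - m / 2)) = 2 * m by lra.
by move: m1; rewrite -/m => *; lra.
Qed.

End CauchySquare.

Section Taylor.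
Variable R : realType.
Local Notation C := (Cplx R).
Local Notation N := (@cabs R).
Local Notation I := ('i%C : C).

Lemma ccont_ext f g (z : C) : f =1 g -> ccont f z -> ccont g z.
Proof. by move=> /funext ->. Qed.

Lemma ccont_cst (c z : C) : ccont (fun=> c) z.
Proof. exact: cder_ccont (cder_cst c z). Qed.

Lemma ccont_inv (z : C) : z != 0 -> ccont (fun x => x^-1) z.
Proof. by move=> z0; exact: cder_ccont (cderV z0 (cder_id z)). Qed.

Lemma ccont_invX (z : C) n : z != 0 -> ccont (fun x => x^-1 ^+ n) z.
Proof. by move=> z0; exact: cder_ccont (cderX n (cderV z0 (cder_id z))). Qed.

Lemma ccont_invB (z w : C) : z - w != 0 -> ccont (fun x => (x - w)^-1) z.
Proof.
move=> z0; have D := cderB (cder_id z) (cder_cst w z).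
exact: cder_ccont (cderV (f := fun x => x - w) z0 D).
Qed.

Section Square.
Variable r : R.
Hypothesis r0 : 0 < r.

Definition sqint (f : C -> C) := rint f (- r) r (- r) r.

Definition onsq (z : C) := exists s t, on_boundary (- r) r (- r) r s t /\ z = mkz s t.

Lemma onsq_ge z : onsq z -> r <= N z.
Proof.
move=> [s [t [/andP[_ q] ->]]].
have h1 := cabs_mkz_ge1 s t; have h2 := cabs_mkz_ge2 s t.
case/or4P: q => /eqP E; move: h1 h2; rewrite E ?normrN (gtr0_norm r0); lra.
Qed.

Lemma onsq_le z : onsq z -> N z <= 2 * r.
Proof.
move=> [s [t [/andP[/andP[hs ht] _] ->]]].
apply: le_trans (cabs_mkz_le s t) _.
have := ler_norml s r; have := ler_norml t r; rewrite hs ht; lra.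
Qed.

Lemma onsq_neq0 z : onsq z -> z != 0.
Proof. by move=> /onsq_ge h; rewrite -cabs_gt0 (lt_le_trans r0). Qed.

Definition sqcont (f : C -> C) := forall z, onsq z -> ccont f z.

Let ab : - r <= r. Proof. by rewrite (le_trans _ (ltW r0)) // oppr_le0 ltW. Qed.

Lemma sqcont_bcont f : sqcont f -> bcont f (- r) r (- r) r.
Proof. by move=> h; apply: bcont_boundary => // s t q; apply: h; exists s, t. Qed.

Lemma eq_sqint f g : (forall z, onsq z -> f z = g z) -> sqint f = sqint g.
Proof. by move=> h; apply: eq_rint => // s t q; apply: h; exists s, t. Qed.

Lemma sqintD f g : sqcont f -> sqcont g ->
  sqint (fun z => f z + g z) = sqint f + sqint g.
Proof. by move=> /sqcont_bcont h /sqcont_bcont k; exact: rintD. Qed.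

Lemma sqintZ c f : sqcont f -> sqint (fun z => c * f z) = c * sqint f.
Proof. by move=> /sqcont_bcont h; exact: rintZ. Qed.

Lemma sqint_norm f M : sqcont f -> (forall z, onsq z -> N (f z) <= M) ->
  N (sqint f) <= 16 * M * r.
Proof.
move=> /sqcont_bcont h hM; apply: le_trans (rint_norm (M := M) ab ab h _) _.
  by move=> s t q; apply: hM; exists s, t.
have -> : r - - r + (r - - r) = 4 * r by ring.
lra.
Qed.

Lemma sqcontM f g : sqcont f -> sqcont g -> sqcont (fun z => f z * g z).
Proof. by move=> h k z q; apply: ccontM; [exact: h|exact: k]. Qed.

Lemma sqcont_invX n : sqcont (fun z => z^-1 ^+ n).
Proof. by move=> z /onsq_neq0; exact: ccont_invX. Qed.

Lemma sqcont_invB w : N w < r -> sqcont (fun z => (z - w)^-1).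
Proof.
move=> wr z /onsq_ge h; apply: ccont_invB; rewrite -cabs_gt0.
by have := cabs_lerB z w; lra.
Qed.

Lemma sqcont_cst c : sqcont (fun=> c).
Proof. by move=> z _; exact: ccont_cst. Qed.

(** Cauchy's formula for the Taylor coefficient at 0, up to the factor [sqconst]. *)
Definition sqcoef n (f : C -> C) := sqint (fun z => f z * z^-1 ^+ n.+1).

Lemma sqcoef_norm n f M : sqcont f -> (forall z, onsq z -> N (f z) <= M) ->
  N (sqcoef n f) <= 16 * M / r ^+ n.
Proof.
move=> hf hM.
apply: le_trans (sqint_norm (M := M / r ^+ n.+1) (sqcontM hf (sqcont_invX _)) _) _.
  move=> z q; rewrite cabsM cabsX cabsV; apply: ler_pM => //.
  - exact: cabs_ge0.
  - by rewrite exprn_ge0 // invr_ge0 cabs_ge0.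
  - exact: hM.
  - rewrite -exprVn lerXn2r ?nnegrE ?invr_ge0 ?cabs_ge0 ?(ltW r0) //.
    have h := onsq_ge q; rewrite lef_pV2 ?posrE //.
    exact: lt_le_trans h.
have rn : r ^+ n != 0 by rewrite expf_neq0 // gt_eqF.
have rn1 : r != 0 by rewrite gt_eqF.
by rewrite le_eqVlt exprS; apply/orP; left; apply/eqP; field; rewrite rn1 rn.
Qed.

(** The finite geometric sum for [1 / (z - w)] in powers of [w / z], with its remainder; this avoids
    exchanging a series with the integral. *)
Lemma sqint_kernel f w K : sqcont f -> N w < r ->
  sqint (fun z => f z / (z - w)) =
  \sum_(n < K) w ^+ n * sqcoef n f +
  w ^+ K * sqint (fun z => f z * z^-1 ^+ K / (z - w)).
Proof.
move=> hf wr; elim: K => [|K ->].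
  rewrite big_ord0 add0r expr0 mul1r; apply: eq_sqint => z _.
  by rewrite expr0 mulr1.
rewrite big_ord_recr /= -addrA; congr (_ + _).
rewrite exprSr -mulrA -mulrDr; congr (_ * _).
have c1 : sqcont (fun z => f z * z^-1 ^+ K.+1) by apply: sqcontM => //; exact: sqcont_invX.
have c2 : sqcont (fun z => f z * z^-1 ^+ K.+1 / (z - w)).
  by apply: sqcontM => //; exact: sqcont_invB.
rewrite /sqcoef -sqintZ // -sqintD //; last first.
  by apply: sqcontM => //; exact: sqcont_cst.
apply: eq_sqint => z q.
have z0 := onsq_neq0 q.
have zw : z - w != 0.
  by rewrite -cabs_gt0; have := cabs_lerB z w; have := onsq_ge q; lra.
by rewrite exprSr; field; rewrite zw z0.
Qed.

Lemma sqint_tail_norm f w K M : sqcont f -> (forall z, onsq z -> N (f z) <= M) ->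
  N w <= r / 2 -> N (sqint (fun z => f z * z^-1 ^+ K / (z - w))) <= 32 * M / r ^+ K.
Proof.
move=> hf hM wr.
have wr' : N w < r by have := r0; lra.
have c1 : sqcont (fun z => f z * z^-1 ^+ K) by apply: sqcontM => //; exact: sqcont_invX.
have c2 : sqcont (fun z => f z * z^-1 ^+ K / (z - w)).
  by apply: sqcontM => //; exact: sqcont_invB.
have rn : r ^+ K != 0 by rewrite expf_neq0 // gt_eqF.
have rn1 : r != 0 by rewrite gt_eqF.
apply: le_trans (sqint_norm (M := M / r ^+ K * (2 / r)) c2 _) _.
  move=> z q; have h := onsq_ge q.
  rewrite !cabsM; apply: ler_pM => //; rewrite ?mulr_ge0 ?cabs_ge0 //.
    apply: ler_pM => //; rewrite ?cabs_ge0 //; first exact: hM.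
    rewrite cabsX cabsV -exprVn lerXn2r ?nnegrE ?invr_ge0 ?cabs_ge0 ?(ltW r0) //.
    by rewrite lef_pV2 ?posrE //; exact: lt_le_trans h.
  have zw : r / 2 <= N (z - w) by have := cabs_lerB z w; lra.
  have r2 : 0 < r / 2 by rewrite divr_gt0.
  rewrite cabsV -[2 / r]invf_div lef_pV2 ?posrE //; exact: lt_le_trans zw.
by rewrite le_eqVlt; apply/orP; left; apply/eqP; field; rewrite rn1 rn.
Qed.

Lemma sqcoef1 n : sqcoef n.+1 (fun=> 1) = 0.
Proof.
pose F := fun z : C => - (n.+1%:R)^-1 * z^-1 ^+ n.+1.
apply: (rint_FTC (F := F) ab ab).
  by apply: sqcont_bcont; apply: sqcontM; [exact: sqcont_cst|exact: sqcont_invX].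
move=> s t q; have z0 : mkz s t != 0 :> C by apply: onsq_neq0; exists s, t.
have := cderZ (- (n.+1%:R)^-1) (cderX n.+1 (cderV (f := id) z0 (cder_id (mkz s t)))).
congr (cder _ _ _).
have n0 : (n.+1%:R : C) != 0 by rewrite pnatr_eq0.
move: n0; rewrite /= mul1r; move: (n.+1%:R) => m m0; rewrite !exprVn !exprS.
have zn : (mkz s t : C) ^+ n != 0 by rewrite expf_neq0.
move: zn z0; move: (mkz s t) => z; move: (z ^+ n) => zn zn0 z0.
by rewrite /id; field; rewrite z0 m0 zn0.
Qed.

(** The integral of [dz / z], that is [2 pi i]. Its value is not computed; the expansions only
    divide by it. *)
Definition sqconst := sqcoef 0 (fun=> 1).

(** The four sides combine into the integral of [4 i r / (t ^ 2 + r ^ 2)] over [[- r, r]]. Divided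
    by [i], the integrand lies between [2 / r] and [4 / r], so it is within [1 / r] of [3 / r].
    Hence [sqconst] is within 4 of [6 i]. *)
Lemma sqconst_neq0 : sqconst != 0.
Proof.
have bc : bcont (fun z : C => 1 * z^-1 ^+ 1) (- r) r (- r) r.
  by apply: sqcont_bcont; apply: sqcontM; [exact: sqcont_cst|exact: sqcont_invX].
case: bc => h1 h2 h3 h4.
pose phi (t : R) : C := I * (4 * r / (t ^+ 2 + r ^+ 2))%:C%C.
pose psi (t : R) : C := I * (3 / r)%:C%C.
have pc (g : R -> C) c : pconts (- r) r g -> pconts (- r) r (fun t => c * g t).
  move=> hg t ht e e0.
  have c0 : 0 < N c + 1 by rewrite ltr_wpDl ?cabs_ge0.
  have [d d0 hd] := hg t ht (e / (N c + 1)) (divr_gt0 e0 c0); exists d => // s /hd.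
  rewrite ltr_pdivlMr // -mulrBr cabsM; apply: le_lt_trans.
  by rewrite mulrC ler_wpM2l ?cabs_ge0 // lerDl.
have pD (f g : R -> C) : pconts (- r) r f -> pconts (- r) r g ->
    pconts (- r) r (fun t => f t + g t).
  move=> hf hg t ht e e0; have e2 : 0 < e / 2 by rewrite divr_gt0.
  have [d d0 hd] := hf t ht _ e2; have [d' d'0 hd'] := hg t ht _ e2.
  exists (Num.min d d'); first by rewrite lt_min d0.
  move=> s; rewrite lt_min => /andP[/hd k1 /hd' k2].
  rewrite opprD addrACA; apply: le_lt_trans (ler_cabsD _ _) _; lra.
have H1 := hcontP h1; have H2 := hcontP h2.
have H3 := vcontP h3; have H4 := vcontP h4.
pose g t := hline (fun z : C => 1 * z^-1 ^+ 1) (- r) t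
  + (-1) * hline (fun z : C => 1 * z^-1 ^+ 1) r t
  + (I * vline (fun z : C => 1 * z^-1 ^+ 1) r t
     + (- I) * vline (fun z : C => 1 * z^-1 ^+ 1) (- r) t).
have cg : pconts (- r) r g.
  by apply: (pD _ _ _ _); apply: pD => //; exact: pc.
have E : sqconst = cint (- r) r g.
  rewrite /sqconst /sqcoef /sqint /rint.
  have -> (a b c d : C) : a - b + I * (c - d) = a + (-1) * b + (I * c + (- I) * d) by ring.
  rewrite -!cintZ // -cintD //; last exact: pc.
  rewrite -cintD //; [|exact: pc|exact: pc].
  rewrite -cintD //; first by apply: pD => //; exact: pc.
  by apply: pD; exact: pc.
have gE t : g t = phi t.
  rewrite /g /hline /vline !mkzC /phi !mul1r !expr1.
  have tr : t ^+ 2 + r ^+ 2 != 0.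
    by rewrite gt_eqF // ltr_wpDl ?sqr_ge0 // exprn_gt0.
  rewrite -/(mkz r t) -/(mkz (- r) t) !mkzE.
  by apply/eqP; rewrite eq_complex /=; apply/andP; split; apply/eqP; field.
have cpsi : pconts (- r) r psi by move=> t _ e e0; exists 1 => // s _; rewrite subrr cabs0.
have Epsi : cint (- r) r psi = I * 6%:R.
  rewrite (cint_FTC (F := fun t : R => t%:C%C * (I * (3 / r)%:C%C)) ab cpsi).
    have -> : (6%:R : C) = (r * (6 / r))%:C%C.
      by rewrite mulrCA divff ?gt_eqF // mulr1 -[LHS](rmorph_nat (real_complex R)).
    have -> : 6 / r = 3 / r + 3 / r by rewrite -mulrDl; congr (_ / _); ring.
    by rewrite rmorphM rmorphD rmorphN /=; ring.
  move=> t _ e e0; exists 1 => // s _.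
  rewrite (_ : _ - _ - _ = 0) ?cabs0; last by rewrite rmorphD /psi /=; ring.
  by rewrite mulr_ge0 // ltW.
have : N (sqconst - I * 6%:R) <= 4.
  rewrite E -Epsi -[X in N (_ + X)]mulN1r -cintZ // -cintD //; last exact: pc.
  apply: le_trans (cint_norm (M := r^-1) ab _ _) _.
  - by apply: pD => //; exact: pc.
  - move=> t /andP[t1 t2]; rewrite gE /phi /psi mulN1r -mulrBr cabsM cabsi mul1r.
    rewrite -rmorphB /= cabsR.
    have tr0 : 0 < t ^+ 2 + r ^+ 2 by rewrite ltr_wpDl ?sqr_ge0 // exprn_gt0.
    have rr : r * r^-1 = 1 by rewrite divff // gt_eqF.
    have ri : 0 < r^-1 by rewrite invr_gt0.
    have t3 : t ^+ 2 <= r ^+ 2 by rewrite -real_normK ?num_real // lerXn2r ?nnegrE ?(ltW r0) // ler_norml t1 t2.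
    have t4 := sqr_ge0 t.
    have u1 : 4 * r / (t ^+ 2 + r ^+ 2) <= 4 / r.
      rewrite ler_pdivrMr // -subr_ge0.
      have -> : 4 / r * (t ^+ 2 + r ^+ 2) - 4 * r = 4 / r * t ^+ 2.
        by field; rewrite gt_eqF.
      by apply: mulr_ge0 => //; apply: mulr_ge0 => //; exact: ltW.
    have u2 : 2 / r <= 4 * r / (t ^+ 2 + r ^+ 2).
      rewrite ler_pdivlMr // -subr_ge0.
      have -> : 4 * r - 2 / r * (t ^+ 2 + r ^+ 2) = 2 / r * (r ^+ 2 - t ^+ 2).
        by field; rewrite gt_eqF.
      apply: mulr_ge0; last by rewrite subr_ge0.
      by apply: mulr_ge0 => //; exact: ltW.
    rewrite ler_norml; apply/andP; split; lra.
  - have -> : 2 / r * (r - - r) = 4 by field; rewrite gt_eqF.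
    exact: lexx.
apply: contraTneq => ->; rewrite sub0r cabsN cabsM cabsi mul1r.
have -> : (6%:R : C) = (6%:R : R)%:C%C by rewrite [RHS](rmorph_nat (real_complex R)).
by rewrite cabsR -ltNge ger0_norm // ltr_nat.
Qed.

(** In the expansion of the kernel for [f = 1] only the term of order 0 has a nonzero integral, and
    the remainder decays geometrically. *)
Lemma sqint_kernel1 w : N w <= r / 2 -> sqint (fun z => (z - w)^-1) = sqconst.
Proof.
move=> wr; have wr' : N w < r by have := r0; lra.
have K K' : N (sqint (fun z => (z - w)^-1) - sqconst) <= 32 * (N w / r) ^+ K'.+1.
  have := sqint_kernel K'.+1 (sqcont_cst 1) wr'.
  rewrite big_ord_recl big1 => [|i _]; last by rewrite /= sqcoef1 mulr0.
  rewrite addr0 expr0 mul1r -/sqconst.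
  have -> : sqint (fun z => 1 / (z - w)) = sqint (fun z => (z - w)^-1).
    by apply: eq_sqint => z _; rewrite mul1r.
  move=> ->; rewrite addrC addKr cabsM cabsX.
  have := @sqint_tail_norm (fun=> 1) w K'.+1 1 (sqcont_cst 1) _ wr.
  rewrite cabs1 => /(_ (fun _ _ => lexx 1)) H.
  apply: le_trans (ler_wpM2l _ H) _; first by rewrite exprn_ge0 // cabs_ge0.
  by rewrite exprMn exprVn mulr1 mulrCA.
apply/eqP; rewrite -subr_eq0 -cabs_eq0 eq_le cabs_ge0 andbT.
apply/ler_addgt0Pr => e e0; rewrite add0r.
have [n hn] := pow2_large 32 e0.
apply: le_trans (K n) _.
have q : N w / r <= 2^-1 by rewrite ler_pdivrMr // mulrC.
apply: le_trans (_ : 32 * (2^-1 ^+ n.+1) <= _).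
  by rewrite ler_pM2l // lerXn2r ?nnegrE ?divr_ge0 ?cabs_ge0 ?(ltW r0).
rewrite exprVn ler_pdivrMr ?exprn_gt0 // exprS.
by apply: le_trans (ltW hn) _; rewrite ler_pM2l // ler_peMl ?exprn_ge0 // ler1n.
Qed.

(** By [rint_quotient0] and [sqint_kernel1], [sqconst * f w] is the integral of [f z / (z - w)];
    expanding the kernel up to order [K] gives the polynomial and its error. *)
Lemma taylor_square f w M K : rdiff f (- r) r (- r) r ->
  (forall z, onsq z -> N (f z) <= M) -> N w <= r / 2 ->
  N (f w - \sum_(n < K) sqcoef n f / sqconst * w ^+ n) <=
    32 * M / N sqconst * (N w / r) ^+ K.
Proof.
move=> df hM wr; have wr' : N w < r by have := r0; lra.
have hf : sqcont f.
  move=> z [s [t [/andP[/andP[hs ht] _] ->]]].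
  by have [k hk] := df s t hs ht; exact: cder_ccont hk.
have : sqint (fun z => (f z - f w) / (z - w)) = 0.
  have /andP[u1 u2] : - r < complex.Re w < r.
    by rewrite -ltr_norml; apply: le_lt_trans (Re_le_cabs w) _.
  have /andP[v1 v2] : - r < complex.Im w < r.
    by rewrite -ltr_norml; apply: le_lt_trans (Im_le_cabs w) _.
  have := @rint_quotient0 R f (- r) r (- r) r (complex.Re w) (complex.Im w).
  by rewrite u1 u2 v1 v2 mkz_Re_Im => /(_ isT isT df).
have cB := sqcont_invB wr'.
rewrite (eq_sqint (g := fun z => f z / (z - w) + (- f w) * (z - w)^-1)); last first.
  by move=> z _; ring.
rewrite sqintD; [|exact: sqcontM|by apply: sqcontM => //; exact: sqcont_cst].
rewrite sqintZ // sqint_kernel1 // (sqint_kernel K) //.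
set S := \sum_(n < K) _; set T := sqint _ => E.
have c0 := sqconst_neq0.
have -> : f w - \sum_(n < K) sqcoef n f / sqconst * w ^+ n = w ^+ K * T / sqconst.
  have -> : \sum_(n < K) sqcoef n f / sqconst * w ^+ n = S / sqconst.
    by rewrite /S mulr_suml; apply: eq_bigr => n _; ring.
  have -> : f w = (S + w ^+ K * T) / sqconst.
    apply: (mulIf c0); rewrite divfK //; apply/eqP; rewrite eq_sym -subr_eq0.
    by rewrite -[X in _ == X]E mulNr.
  by ring.
rewrite !cabsM cabsX cabsV.
have H := sqint_tail_norm K hf hM wr.
have H2 : N w ^+ K * N T <= N w ^+ K * (32 * M / r ^+ K).
  by rewrite ler_wpM2l // exprn_ge0 // cabs_ge0.
have ci : 0 <= (N sqconst)^-1 by rewrite invr_ge0 cabs_ge0.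
apply: le_trans (ler_wpM2r ci H2) _.
by rewrite exprMn exprVn le_eqVlt; apply/orP; left; apply/eqP; ring.
Qed.

End Square.
End Taylor.

(** * Taylor expansions and primitives of holomorphic germs *)

Section LocalHolomorphy.
Variable R : realType.
Local Notation C := (Cplx R).
Local Notation N := (@cabs R).
Local Notation I := ('i%C : C).

(** One estimate for all truncation orders replaces convergence of a power series. It is stable
    under linear combinations and yields leading terms and the vanishing of germs. *)
Definition taylor_at (f : C -> C) (z : C) (a : nat -> C) :=
  exists r M : R, [/\ 0 < r, 0 <= M & forall K w, N w <= r / 2 ->
    N (f (z + w) - \sum_(n < K) a n * w ^+ n) <= M * (N w / r) ^+ K].

Lemma near_diffP (f : C -> C) z : (\forall q \near z, differentiable f q) ->
  exists2 r : R, 0 < r & forall w, N w <= 2 * r -> exists k, cder f (z + w) k.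
Proof.
move=> /near_cabsP[d d0 hd]; exists (d / 3); first by rewrite divr_gt0.
move=> w hw; exists ('d f (z + w) 1); apply/diff_cder/hd; lra.
Qed.

Lemma cder_shift (f : C -> C) z w k : cder f (z + w) k -> cder (fun x => f (z + x)) w k.
Proof.
by move=> h e /h[d d0 hd]; exists d => // v /hd; rewrite /= addrA; apply.
Qed.

Lemma cder_unshift (f : C -> C) z w k : cder f (z - w) k -> cder (fun x => f (x - w)) z k.
Proof.
by move=> h e /h[d d0 hd]; exists d => // v /hd; rewrite /= [z + v - w]addrAC; apply.
Qed.

Lemma holo_taylor (f : C -> C) z : (\forall q \near z, differentiable f q) ->
  exists a, taylor_at f z a.
Proof.
move=> /near_diffP[r0 r00 hr0].
have [k0 hk0] : exists k, cder f (z + 0) k.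
  by apply: hr0; rewrite cabs0 mulr_ge0 // ltW.
have [d d0 hd] := ccont_near_bounded (cder_ccont hk0).
pose r := Num.min r0 (d / 3).
have r_gt0 : 0 < r by rewrite lt_min r00 divr_gt0.
have [rr0 rd] : r <= r0 /\ 2 * r < d.
  by have : r <= r by []; rewrite {2}/r le_min => /andP[? ?]; split=> //; lra.
pose M := N (f (z + 0)) + 1.
have M0 : 0 <= M by rewrite addr_ge0 ?cabs_ge0.
exists (fun n => sqcoef r n (fun x => f (z + x)) / sqconst r).
exists r, (32 * M / N (sqconst r)); split => //.
  by rewrite divr_ge0 ?cabs_ge0 // mulr_ge0.
move=> K w hw; apply: (@taylor_square R r r_gt0 (fun x => f (z + x)) w M K) => //.
  move=> s t hs ht.
  have [|k hk] := hr0 (mkz s t); last by exists k; exact: cder_shift.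
  apply: le_trans (cabs_mkz_le _ _) _.
  by move: hs ht; rewrite -!ler_norml => hs ht; lra.
move=> x /(onsq_le) hx; have hx' : N x < d by lra.
by have := hd x hx'; rewrite /M addr0 => /ltW.
Qed.

Lemma taylor0 z : taylor_at (fun=> 0) z (fun=> 0).
Proof.
exists 1, 0; split => // K w _; rewrite big1 => [|i _]; last by rewrite mul0r.
by rewrite subrr cabs0 mul0r.
Qed.

Lemma taylorZD f g z a b c : taylor_at f z a -> taylor_at g z b ->
  taylor_at (fun x => c * f x + g x) z (fun n => c * a n + b n).
Proof.
move=> [r1 [M1 [r10 M10 h1]]] [r2 [M2 [r20 M20 h2]]].
pose r := Num.min r1 r2.
have r_gt0 : 0 < r by rewrite lt_min r10.
have [q1 q2] : r <= r1 /\ r <= r2.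
  by have : r <= r by []; rewrite {2}/r le_min => /andP[? ?].
exists r, (N c * M1 + M2); split => //.
  by rewrite addr_ge0 // mulr_ge0 // cabs_ge0.
move=> K w hw.
have -> : c * f (z + w) + g (z + w) - \sum_(n < K) (c * a n + b n) * w ^+ n =
  c * (f (z + w) - \sum_(n < K) a n * w ^+ n) + (g (z + w) - \sum_(n < K) b n * w ^+ n).
  under eq_bigr do rewrite mulrDl -mulrA.
  by rewrite big_split /= -mulr_sumr; ring.
apply: le_trans (ler_cabsD _ _) _; rewrite cabsM mulrDl.
have mono r' : r <= r' -> (N w / r') ^+ K <= (N w / r) ^+ K.
  move=> rr; have r'0 := lt_le_trans r_gt0 rr.
  rewrite lerXn2r ?nnegrE ?divr_ge0 ?cabs_ge0 ?(ltW r_gt0) ?(ltW r'0) //.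
  by rewrite ler_wpM2l ?cabs_ge0 // lef_pV2 ?posrE.
apply: lerD.
  rewrite -mulrA ler_wpM2l ?cabs_ge0 //.
  apply: le_trans (h1 K w _) _; first by lra.
  by rewrite ler_wpM2l // mono.
apply: le_trans (h2 K w _) _; first by lra.
by rewrite ler_wpM2l // mono.
Qed.

Lemma taylor_sum n (F : 'I_n -> C -> C) z (a : 'I_n -> nat -> C) (c : 'I_n -> C) :
  (forall k, taylor_at (F k) z (a k)) ->
  taylor_at (fun x => \sum_(k < n) c k * F k x) z (fun m => \sum_(k < n) c k * a k m).
Proof.
elim: n F a c => [|n ih] F a c h.
  have := taylor0 z; congr taylor_at; apply/funext => x; by rewrite big_ord0.
have := taylorZD (c ord_max) (h ord_max)
  (ih (fun k => F (widen_ord (leqnSn n) k)) (fun k => a (widen_ord (leqnSn n) k))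
      (fun k => c (widen_ord (leqnSn n) k)) (fun k => h _)).
by congr taylor_at; apply/funext => x; rewrite big_ord_recr /= addrC.
Qed.

Lemma taylor_eq0 f z a : taylor_at f z a -> (forall n, a n = 0) ->
  \forall q \near z, f q = 0.
Proof.
move=> [r [M [r0 M0 h]]] a0; apply/near_cabsP; exists (r / 2); first by rewrite divr_gt0.
move=> w hw; apply/eqP; rewrite -cabs_eq0 eq_le cabs_ge0 andbT.
apply/ler_addgt0Pr => e e0; rewrite add0r.
have [K hK] := pow2_large M e0.
have := h K w (ltW hw); rewrite big1 => [|i _]; last by rewrite a0 mul0r.
rewrite subr0 => /le_trans; apply.
apply: le_trans (_ : M * 2^-1 ^+ K <= _).
  rewrite ler_wpM2l // lerXn2r ?nnegrE ?divr_ge0 ?cabs_ge0 ?(ltW r0) //.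
  by rewrite ler_pdivrMr // mulrC ltW.
by rewrite exprVn ler_pdivrMr ?exprn_gt0 // ltW.
Qed.

Lemma taylor_lead f z a k : taylor_at f z a -> (forall n, (n < k)%N -> a n = 0) ->
  exists r M : R, [/\ 0 < r, 0 <= M & forall w, N w <= r ->
    N (f (z + w) - a k * w ^+ k) <= M * N w ^+ k.+1].
Proof.
move=> [r [M [r0 M0 h]]] a0; exists (r / 2), (M / r ^+ k.+1); split.
- by rewrite divr_gt0.
- by rewrite divr_ge0 // exprn_ge0 // ltW.
move=> w hw; have := h k.+1 w hw.
rewrite big_ord_recr big1 /= => [|i _]; last by rewrite a0 // mul0r.
by rewrite add0r exprMn exprVn mulrA mulrAC.
Qed.

(** Controls the derivative of an integral in its upper limit. Both orders of [x] and [x'] occur,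
    since the coordinates of a complex increment have arbitrary signs. *)
Lemma cint_incr (g : R -> C) a x x' (c : C) M : a <= x -> a <= x' ->
  pconts a (Num.max x x') g ->
  (forall t, (x <= t <= x') || (x' <= t <= x) -> N (g t - c) <= M) ->
  N (cint a x' g - cint a x g - (x' - x)%:C%C * c) <= 2 * M * `|x' - x|.
Proof.
wlog xx : x x' / x <= x' => [hw|].
  have [xx|] := boolP (x <= x'); first exact: hw.
  rewrite -ltNge => xx.
  move=> h1 h2 h3 h4; have := hw x' x (ltW xx) h2 h1.
  rewrite maxC => /(_ h3); rewrite [`|x - x'|]distrC.
  have -> : cint a x g - cint a x' g - (x - x')%:C%C * c =
            - (cint a x' g - cint a x g - (x' - x)%:C%C * c).
    by rewrite !rmorphB /=; ring.
  by rewrite cabsN; apply => t; rewrite orbC; exact: h4.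
move=> ax ax'; rewrite max_r // => gc gM.
have pcst (k : C) b d : pconts b d (fun=> k).
  by move=> t _ e e0; exists 1 => // s _; rewrite subrr cabs0.
have gc' : pconts x x' g.
  by move=> t /andP[t1 t2]; apply: gc; rewrite t2 (le_trans ax).
rewrite (@cint_split _ a x x') //; last by rewrite ax.
have -> (A B D : C) : A + B - A - D = B - D by ring.
have -> : (x' - x)%:C%C * c = cint x x' (fun=> c).
  rewrite (cint_FTC (F := fun t : R => t%:C%C * c) xx (pcst c _ _)).
    by rewrite rmorphB /=; ring.
  move=> t _ e e0; exists 1 => // s _.
  rewrite (_ : _ - _ - _ = 0) ?cabs0; last by rewrite rmorphD /=; ring.
  by rewrite mulr_ge0 // ltW.
have -> : cint x x' g - cint x x' (fun=> c) = cint x x' (fun t => g t + - c).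
  rewrite cintD //; congr (_ + _).
  have -> : (fun=> - c) = (fun t : R => (-1) * c) by apply/funext => t; rewrite mulN1r.
  by rewrite cintZ // mulN1r.
rewrite (@ger0_norm _ (x' - x)) ?subr_ge0 //.
apply: cint_norm => //; last by move=> t ht; apply: gM; rewrite ht.
move=> t ht e e0; have [d d0 hd] := gc' t ht e e0; exists d => // s /hd.
by rewrite opprD addrACA subrr addr0.
Qed.

(** The primitive is an integral along two sides of a rectangle. By Goursat's theorem the other two
    sides give the same value, so an increment is an integral over a short vertical and a short
    horizontal segment, on which [f] is nearly constant. *)
Lemma local_primitive (f : C -> C) z : (\forall q \near z, differentiable f q) ->
  exists2 F : C -> C, F z = 0 & \forall q \near z, cder F q (f q).
Proof.
move=> /near_diffP[r r0 hr].
pose g w := f (z + w).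
have gd : rdiff g (- r) r (- r) r.
  move=> s t hs ht; have [|k hk] := hr (mkz s t); last by exists k; exact: cder_shift.
  apply: le_trans (cabs_mkz_le _ _) _.
  by move: hs ht; rewrite -!ler_norml => hs ht; lra.
have gH a b y : - r <= a -> b <= r -> - r <= y <= r -> pconts a b (hline g y).
  move=> ha hb hy; apply: hcontP => s /andP[s1 s2].
  have [|k hk] := gd s y _ hy; last exact: cder_ccont hk.
  by rewrite (le_trans ha) // (le_trans s2).
have gV a b x : - r <= a -> b <= r -> - r <= x <= r -> pconts a b (vline g x).
  move=> ha hb hx; apply: vcontP => t /andP[t1 t2].
  have [|k hk] := gd x t hx _; last exact: cder_ccont hk.
  by rewrite (le_trans ha) // (le_trans t2).
pose G1 x y := cint (- r) x (hline g (- r)) + I * cint (- r) y (vline g x).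
pose G2 x y := cint (- r) x (hline g y) + I * cint (- r) y (vline g (- r)).
have G12 x y : - r <= x <= r -> - r <= y <= r -> G1 x y = G2 x y.
  move=> /andP[x1 x2] /andP[y1 y2].
  have := goursat x1 y1 (rdiff_sub (lexx _) x2 (lexx _) y2 gd).
  rewrite /rint => /eqP; rewrite mulrBr => /eqP E.
  by apply/eqP; rewrite -subr_eq0 -[X in _ == X]E /G1 /G2; apply/eqP; ring.
pose G (w : C) := G1 (complex.Re w) (complex.Im w).
have Gd w : N w < r -> cder G w (g w).
  move=> wr e e0.
  have wx := le_lt_trans (Re_le_cabs w) wr.
  have wy := le_lt_trans (Im_le_cabs w) wr.
  have [k hk] : exists k, cder g w k.
    by rewrite -(mkz_Re_Im w); apply: gd; rewrite -ler_norml ltW.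
  have [|d d0 hd] := cder_ccont hk (e := e / 4); first by rewrite divr_gt0.
  exists (Num.min (d / 2) (r - N w)).
    by rewrite lt_min divr_gt0 //= subr_gt0.
  move=> v; rewrite lt_min => /andP[v1 v2].
  have wvr : N (w + v) < r by have := ler_cabsD w v; lra.
  have wvx := le_lt_trans (Re_le_cabs (w + v)) wvr.
  have wvy := le_lt_trans (Im_le_cabs (w + v)) wvr.
  rewrite /G.
  set x := complex.Re w in wx *; set y := complex.Im w in wy *.
  set x' := complex.Re (w + v) in wvx *; set y' := complex.Im (w + v) in wvy *.
  have xl : - r <= x <= r by rewrite -ler_norml ltW.
  have yl : - r <= y <= r by rewrite -ler_norml ltW.
  have xl' : - r <= x' <= r by rewrite -ler_norml ltW.
  have yl' : - r <= y' <= r by rewrite -ler_norml ltW.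
  have xv : x' - x = complex.Re v by rewrite /x' /x raddfD addrAC subrr add0r.
  have yv : y' - y = complex.Im v by rewrite /y' /y raddfD addrAC subrr add0r.
  have vx : `|x' - x| <= N v by rewrite xv; exact: Re_le_cabs.
  have vy : `|y' - y| <= N v by rewrite yv; exact: Im_le_cabs.
  have vE : v = (x' - x)%:C%C + I * (y' - y)%:C%C by rewrite xv yv -complexE.
  have near_w s t : `|s - x| <= `|x' - x| -> `|t - y| <= `|y' - y| ->
      N (g (mkz s t) - g w) <= e / 4.
    move=> hs ht.
    have hN : N (mkz s t - w) < d.
      rewrite -(mkz_Re_Im w) mkzB; apply: le_lt_trans (cabs_mkz_le _ _) _.
      by rewrite -/x -/y; lra.
    by have := hd _ hN; rewrite [w + _]addrC subrK => /ltW.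
  have E1 : N (cint (- r) x' (hline g y') - cint (- r) x (hline g y') - (x' - x)%:C%C * g w)
      <= 2 * (e / 4) * `|x' - x|.
    case/andP: xl => xl1 xl2; case/andP: xl' => xl1' xl2'.
    apply: cint_incr => //; first by apply: gH => //; rewrite ge_max xl2.
    move=> t ht; rewrite /hline mkzC; apply: near_w => //.
    by case/orP: ht => /andP[? ?]; rewrite !ler_normr !ler_norml; lra.
  have E2 : N (cint (- r) y' (vline g x) - cint (- r) y (vline g x) - (y' - y)%:C%C * g w)
      <= 2 * (e / 4) * `|y' - y|.
    case/andP: yl => yl1 yl2; case/andP: yl' => yl1' yl2'.
    apply: cint_incr => //; first by apply: gV => //; rewrite ge_max yl2.
    move=> t ht; rewrite /vline; apply: near_w; first by rewrite subrr normr0.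
    by case/orP: ht => /andP[? ?]; rewrite !ler_normr !ler_norml; lra.
  have E : G1 x' y' - G1 x y - g w * v =
    (cint (- r) x' (hline g y') - cint (- r) x (hline g y') - (x' - x)%:C%C * g w) +
    I * (cint (- r) y' (vline g x) - cint (- r) y (vline g x) - (y' - y)%:C%C * g w).
    have := G12 x' y' xl' yl'; have := G12 x y' xl yl'.
    rewrite {1}vE; rewrite /G1 /G2 => E3 E4.
    rewrite E4.
    have -> : cint (- r) x (hline g y') =
       cint (- r) x (hline g (- r)) + I * cint (- r) y' (vline g x)
       - I * cint (- r) y' (vline g (- r)) by rewrite E3; ring.
    by ring.
  rewrite E; apply: le_trans (ler_cabsD _ _) _.
  rewrite cabsM cabsi mul1r; apply: le_trans (lerD E1 E2) _.
  have := ler_wpM2l (ltW e0) vx; have := ler_wpM2l (ltW e0) vy; lra.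
exists (fun q => G (q - z) - G 0).
  by rewrite !subrr.
apply/near_cabsP; exists r => // w hw.
have H : cder G (z + w - z) (f (z + w)) by rewrite addrC addKr; exact: Gd.
by have := cderB (cder_unshift H) (cder_cst (G 0) (z + w)); rewrite subr0.
Qed.

End LocalHolomorphy.

(** * Holomorphic functions of two variables *)

Section TwoVariables.
Variable R : realType.
Local Notation C := (Cplx R).
Local Notation N := (@cabs R).

Lemma is_diff_fst (q : C * C) : is_diff q (fst : C * C -> C) fst.
Proof.
apply: DiffDef; first by apply: linear_differentiable => p; exact: cvg_fst.
by apply: diff_lin => p; exact: cvg_fst.
Qed.

Lemma is_diff_snd (q : C * C) : is_diff q (snd : C * C -> C) snd.
Proof.
apply: DiffDef; first by apply: linear_differentiable => p; exact: cvg_snd.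
by apply: diff_lin => p; exact: cvg_snd.
Qed.

Lemma differentiable_fst_comp (g : C * C -> C * C) q :
  differentiable g q -> differentiable (fun q => (g q).1) q.
Proof.
move=> dq; have := is_diff_fst (g q) => dfst.
exact: (@differentiable_comp _ _ _ _ g fst q dq (@ex_diff _ _ _ _ _ _ _ dfst)).
Qed.

Lemma differentiable_snd_comp (g : C * C -> C * C) q :
  differentiable g q -> differentiable (fun q => (g q).2) q.
Proof.
move=> dq; have := is_diff_snd (g q) => dsnd.
exact: (@differentiable_comp _ _ _ _ g snd q dq (@ex_diff _ _ _ _ _ _ _ dsnd)).
Qed.

Lemma diff_partial1 (f : C * C -> C) x y : differentiable f (x, y) ->
  exists k, cder (fun u => f (u, y)) x k.
Proof.
move=> df; exists ('d (f \o (fun u => (u, y))) x 1); apply: (@diff_cder R (f \o (fun u => (u, y)))).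
by apply: differentiable_comp => //; apply: differentiable_pair.
Qed.

Lemma diff_partial2 (f : C * C -> C) x y : differentiable f (x, y) ->
  exists k, cder (fun v => f (x, v)) y k.
Proof.
move=> df; exists ('d (f \o (fun v => (x, v))) y 1); apply: (@diff_cder R (f \o (fun v => (x, v)))).
by apply: differentiable_comp => //; apply: differentiable_pair.
Qed.

(** Separates the error of the expansion in [u], whose coefficients [a0], [a1], [a2] will depend on
    [v], from the errors of expanding these coefficients in [v]. *)
Lemma taylor2_ident (G a0 a1 a2 g00 A B P Q S u v : C) :
  G - (g00 + A * u + B * v + P * u ^+ 2 + Q * (u * v) + S * v ^+ 2) =
  (G - (a0 + a1 * u + a2 * u ^+ 2)) + (a0 - (g00 + B * v + S * v ^+ 2))
  + ((a1 - (A + v * Q)) * u + (a2 - P) * u ^+ 2).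
Proof. by ring. Qed.

Section Estimate.
Variables (g : C -> C -> C) (r M : R).
Hypotheses (r0 : 0 < r) (M0 : 0 <= M).
Hypothesis g1 : forall u v, N u <= 4 * r -> N v <= 4 * r -> exists k, cder (g^~ v) u k.
Hypothesis g2 : forall u v, N u <= 4 * r -> N v <= 4 * r -> exists k, cder (g u) v k.
Hypothesis gM : forall u v, N u <= 4 * r -> N v <= 4 * r -> N (g u v) <= M.

Local Notation k0 := (sqconst r).
Let T n (h : C -> C) := sqcoef r n h / k0.
Let c1 := 32 * M / N k0.

Let c10 : 0 <= c1.
Proof. by rewrite divr_ge0 ?cabs_ge0 // mulr_ge0. Qed.

Let square_small s t : - r <= s <= r -> - r <= t <= r -> N (mkz s t) <= 4 * r.
Proof.
rewrite -!ler_norml => hs ht; apply: le_trans (cabs_mkz_le _ _) _.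
by have := r0; lra.
Qed.

Let onsq_small z : onsq r z -> N z <= 4 * r.
Proof. by move=> /onsq_le; have := r0; lra. Qed.

Let small_half v : N v <= r / 2 -> N v <= 4 * r.
Proof. by have := r0; lra. Qed.

Let in1 K u v : N u <= r / 2 -> N v <= 4 * r ->
  N (g u v - \sum_(n < K) T n (g^~ v) * u ^+ n) <= c1 * (N u / r) ^+ K.
Proof.
move=> hu hv; apply: (@taylor_square R r r0 (g^~ v)) => //.
  by move=> s t hs ht; apply: g1 => //; exact: square_small.
by move=> z hz; apply: gM => //; exact: onsq_small.
Qed.

Let in2 K u v : N u <= 4 * r -> N v <= r / 2 ->
  N (g u v - \sum_(n < K) T n (g u) * v ^+ n) <= c1 * (N v / r) ^+ K.
Proof.
move=> hu hv; apply: (@taylor_square R r r0 (g u)) => //.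
  by move=> s t hs ht; apply: g2 => //; exact: square_small.
by move=> z hz; apply: gM => //; exact: onsq_small.
Qed.

Let N0 : N (0 : C) <= r / 2.
Proof. by rewrite cabs0 divr_ge0 // ltW. Qed.

Let T0_1 v : N v <= 4 * r -> T 0%N (g^~ v) = g 0 v.
Proof.
move=> hv; have := @in1 1 0 v N0 hv.
rewrite big_ord_recl big_ord0 cabs0 mul0r expr1 mulr0 addr0 expr0 mulr1 => h.
by apply/esym/eqP; rewrite -subr_eq0 -cabs_eq0 eq_le h cabs_ge0.
Qed.

Let T0_2 u : N u <= 4 * r -> T 0%N (g u) = g u 0.
Proof.
move=> hv; have := @in2 1 u 0 hv N0.
rewrite big_ord_recl big_ord0 cabs0 mul0r expr1 mulr0 addr0 expr0 mulr1 => h.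
by apply/esym/eqP; rewrite -subr_eq0 -cabs_eq0 eq_le h cabs_ge0.
Qed.

Let lip u v : N u <= 4 * r -> N v <= r / 2 -> N (g u v - g u 0) <= c1 * (N v / r).
Proof.
move=> hu hv; have := @in2 1 u v hu hv.
by rewrite big_ord_recl big_ord0 expr1 addr0 expr0 mulr1 T0_2.
Qed.

Let lin u v : N u <= 4 * r -> N v <= r / 2 ->
  N (g u v - g u 0 - v * T 1%N (g u)) <= c1 * (N v / r) ^+ 2.
Proof.
move=> hu hv; have := @in2 2 u v hu hv.
by rewrite !big_ord_recl big_ord0 /= expr1 addr0 expr0 mulr1 T0_2 // opprD addrA [v * _]mulrC.
Qed.

Let cont1 u v : N u <= 4 * r -> N v <= 4 * r -> ccont (g^~ v) u.
Proof. by move=> hu hv; have [k /cder_ccont] := g1 hu hv. Qed.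

(** The coefficient is a uniform limit of the continuous difference quotients [(g u v - g u 0) / v].
    Its continuity is needed to take Cauchy coefficients of it in turn. *)
Let b1_cont z : N z <= 2 * r -> ccont (fun u => T 1%N (g u)) z.
Proof.
move=> hz e e0.
pose d := Num.min (r / 2) (e / 4 * r ^+ 2 / (c1 + 1)).
have c11 : 0 < c1 + 1 by rewrite ltr_wpDl.
have r2 : 0 < r ^+ 2 by rewrite exprn_gt0.
have d0 : 0 < d by rewrite lt_min !(divr_gt0, mulr_gt0).
have [d1 d2] : d <= r / 2 /\ d <= e / 4 * r ^+ 2 / (c1 + 1).
  by have : d <= d by []; rewrite {2}/d le_min => /andP[].
rewrite ler_pdivlMr // in d2.
pose v : C := d%:C%C.
have Nv : N v = d by rewrite cabsR gtr0_norm.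
have v0 : v != 0 by rewrite -cabs_gt0 Nv.
have Q u : N u <= 4 * r -> N ((g u v - g u 0) / v - T 1%N (g u)) <= e / 4.
  move=> hu; have hv : N v <= r / 2 by rewrite Nv.
  have := lin hu hv.
  have -> : g u v - g u 0 - v * T 1%N (g u) = v * ((g u v - g u 0) / v - T 1%N (g u)).
    by field.
  rewrite cabsM Nv => h; rewrite -(ler_pM2l d0); apply: le_trans h _.
  rewrite exprMn exprVn mulrA ler_pdivrMr // expr2.
  have := ler_wpM2l (ltW d0) d2; have := mulr_ge0 (ltW d0) (ltW d0); lra.
have cq : ccont (fun u => (g u v - g u 0) / v) z.
  apply: ccontM; last exact: ccont_cst.
  by apply: ccont_sub; apply: cont1; rewrite ?Nv ?cabs0; have := r0; lra.
have e2 : 0 < e / 4 by rewrite divr_gt0.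
have [del del0 hd] := cq _ e2.
exists (Num.min del r); first by rewrite lt_min del0.
move=> w; rewrite lt_min => /andP[/hd h1 h2].
have hz1 : N z <= 4 * r by have := r0; lra.
have hz2 : N (z + w) <= 4 * r by have := ler_cabsD z w; lra.
have := Q _ hz1; have := Q _ hz2; move: h1.
set A := (_ / _); set B := _ / v; set A' := T _ _; set B' := T _ _ => h1 q1 q2.
have -> : A' - B' = - (A - A') + ((A - B) + (B - B')) by ring.
apply: le_lt_trans (ler_cabsD _ _) _.
by have := ler_cabsD (A - B) (B - B'); rewrite cabsN; lra.
Qed.

Let k0pos : 0 < N k0.
Proof. by rewrite cabs_gt0; exact: sqconst_neq0. Qed.

Let sqg v : N v <= 4 * r -> sqcont r (g^~ v).
Proof. by move=> hv z hz; apply: cont1 => //; exact: onsq_small. Qed.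

Let TD n h1 h2 c : sqcont r h1 -> sqcont r h2 ->
  T n (fun z => h1 z + c * h2 z) = T n h1 + c * T n h2.
Proof.
move=> s1 s2; rewrite /T.
have cX : sqcont r (fun z : C => z^-1 ^+ n.+1) by exact: sqcont_invX.
have -> : sqcoef r n (fun z => h1 z + c * h2 z) = sqcoef r n h1 + c * sqcoef r n h2.
  rewrite /sqcoef -sqintZ //; last exact: sqcontM.
  rewrite -sqintD //; first by apply: eq_sqint => // z _; ring.
    exact: sqcontM.
  by apply: sqcontM; [exact: sqcont_cst|exact: sqcontM].
by ring.
Qed.

Let T_norm n h m : sqcont r h -> (forall z, onsq r z -> N (h z) <= m) ->
  N (T n h) <= 16 * m / r ^+ n / N k0.
Proof.
move=> hs hm; rewrite /T cabsM cabsV ler_wpM2r ?invr_ge0 ?cabs_ge0 //.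
exact: sqcoef_norm.
Qed.

Let sum3 (F : nat -> C) : \sum_(n < 3) F n = F 0%N + F 1%N + F 2%N.
Proof. by rewrite !big_ord_recr big_ord0 /= add0r. Qed.

(** The Cauchy coefficients of [g] in [u] are integrals, so bounding the integrand expands them in
    [v]: order 0 up to [v ^ 2], order 1 up to [v], order 2 up to a constant. Together these errors
    are of total degree 3. *)
Lemma taylor2_aux : exists A B P Q S : C, exists2 K : R, 0 <= K &
  forall u v, N u <= r / 2 -> N v <= r / 2 ->
  N (g u v - (g 0 0 + A * u + B * v + P * u ^+ 2 + Q * (u * v) + S * v ^+ 2))
    <= K * (N u + N v) ^+ 3.
Proof.
have z4 : N (0 : C) <= 4 * r by exact: small_half.
pose b1 := fun u => T 1%N (g u).
exists (T 1%N (g^~ 0)), (T 1%N (g 0)), (T 2%N (g^~ 0)), (T 1%N b1), (T 2%N (g 0)).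
pose K1 := c1 / r ^+ 3.
pose K2 := 16 * (c1 / r ^+ 2) / r ^+ 1 / N k0.
pose K3 := 16 * (c1 / r) / r ^+ 2 / N k0.
have K10 : 0 <= K1 by rewrite divr_ge0 // exprn_ge0 // ltW.
have K20 : 0 <= K2.
  by rewrite /K2 !(divr_ge0, mulr_ge0, exprn_ge0) ?cabs_ge0 ?(ltW r0).
have K30 : 0 <= K3.
  by rewrite /K3 !(divr_ge0, mulr_ge0, exprn_ge0) ?cabs_ge0 ?(ltW r0).
exists (K1 + K1 + K2 + K3); first by rewrite !addr_ge0.
move=> u v hu hv.
have hv4 := small_half hv.
have sb : sqcont r b1 by move=> z hz; apply: b1_cont; exact: onsq_le.
have E1 : N (g u v - (g 0 v + T 1%N (g^~ v) * u + T 2%N (g^~ v) * u ^+ 2)) <= K1 * N u ^+ 3.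
  have := @in1 3 u v hu hv4; rewrite (sum3 (fun n => T n (g^~ v) * u ^+ n)) expr0 mulr1 expr1 T0_1 //.
  by have -> : K1 * N u ^+ 3 = c1 * (N u / r) ^+ 3 by rewrite /K1; field; rewrite gt_eqF.
have E2 : N (g 0 v - (g 0 0 + T 1%N (g 0) * v + T 2%N (g 0) * v ^+ 2)) <= K1 * N v ^+ 3.
  have := @in2 3 0 v z4 hv; rewrite (sum3 (fun n => T n (g 0) * v ^+ n)) expr0 mulr1 expr1 T0_2 //.
  by have -> : K1 * N v ^+ 3 = c1 * (N v / r) ^+ 3 by rewrite /K1; field; rewrite gt_eqF.
have E3 : N (T 1%N (g^~ v) - (T 1%N (g^~ 0) + v * T 1%N b1)) <= K2 * N v ^+ 2.
  have -> : T 1%N (g^~ v) - (T 1%N (g^~ 0) + v * T 1%N b1) =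
     T 1%N (fun z => (g z v + (-1) * g z 0) + (- v) * b1 z).
    rewrite TD //; last first.
      move=> z hz; have := ccont_sub (sqg hv4 hz) (sqg z4 hz).
      by apply: ccont_ext => x; rewrite mulN1r.
    by rewrite (TD 1 (-1) (sqg hv4) (sqg z4)); ring.
  have h : forall z, onsq r z -> N (g z v + (-1) * g z 0 + (- v) * b1 z) <= c1 * (N v / r) ^+ 2.
    by move=> z hz; rewrite mulN1r mulNr; apply: lin => //; exact: onsq_small.
  apply: le_trans (T_norm 1 _ h) _.
    move=> z hz; have := ccont_sub (ccont_sub (sqg hv4 hz) (sqg z4 hz))
      (ccontM (ccont_cst v z) (sb z hz)).
    by apply: ccont_ext => x; rewrite mulN1r mulNr.
  rewrite le_eqVlt; apply/orP; left; apply/eqP; rewrite /K2.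
  by field; rewrite !gt_eqF.
have E4 : N (T 2%N (g^~ v) - T 2%N (g^~ 0)) <= K3 * N v.
  have -> : T 2%N (g^~ v) - T 2%N (g^~ 0) = T 2%N (fun z => g z v + (-1) * g z 0).
    by rewrite (TD 2 (-1) (sqg hv4) (sqg z4)); ring.
  have h : forall z, onsq r z -> N (g z v + (-1) * g z 0) <= c1 * (N v / r).
    by move=> z hz; rewrite mulN1r; apply: lip => //; exact: onsq_small.
  apply: le_trans (T_norm 2 _ h) _.
    move=> z hz; have := ccont_sub (sqg hv4 hz) (sqg z4 hz).
    by apply: ccont_ext => x; rewrite mulN1r.
  rewrite le_eqVlt; apply/orP; left; apply/eqP; rewrite /K3.
  by field; rewrite !gt_eqF.
rewrite (taylor2_ident _ (g 0 v) (T 1%N (g^~ v)) (T 2%N (g^~ v))).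
apply: le_trans (ler_cabsD _ _) _.
apply: le_trans (lerD (ler_cabsD _ _) (ler_cabsD _ _)) _.
rewrite !cabsM.
move: E1 E2 E3 E4 (cabs_ge0 u) (cabs_ge0 v); move: (N u) (N v) => a b.
set d1 := N _; set d2 := N _; set d3 := N _; set d4 := N _.
move: d1 d2 d3 d4 K1 K2 K3 K10 K20 K30 => d1 d2 d3 d4 K1 K2 K3 K10 K20 K30.
move=> E1 E2 E3 E4 a0 b0.
have E3' := ler_wpM2r a0 E3; have E4' := ler_wpM2r (mulr_ge0 a0 a0) E4.
have -> : (a + b) ^+ 3 = a ^+ 3 + b ^+ 3 + 3 * (b ^+ 2 * a) + 3 * (b * a ^+ 2) by ring.
have p1 : 0 <= a ^+ 3 by rewrite exprn_ge0.
have p2 : 0 <= b ^+ 3 by rewrite exprn_ge0.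
have p3 : 0 <= b ^+ 2 * a by rewrite mulr_ge0 // exprn_ge0.
have p4 : 0 <= b * a ^+ 2 by rewrite mulr_ge0 // exprn_ge0.
have := (mulr_ge0 K10 p1, mulr_ge0 K10 p2, mulr_ge0 K10 p3, mulr_ge0 K10 p4).
have := (mulr_ge0 K20 p1, mulr_ge0 K20 p2, mulr_ge0 K20 p3, mulr_ge0 K20 p4).
have := (mulr_ge0 K30 p1, mulr_ge0 K30 p2, mulr_ge0 K30 p3, mulr_ge0 K30 p4).
move=> [[[q1 q2] q3] q4] [[[q5 q6] q7] q8] [[[q9 q10] q11] q12].
rewrite -expr2 in E4'; rewrite -expr2.
have R3 : K2 * b ^+ 2 * a = K2 * (b ^+ 2 * a) by ring.
have R4 : K3 * b * a ^+ 2 = K3 * (b * a ^+ 2) by ring.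
rewrite R3 in E3'; rewrite R4 in E4'.
lra.
Qed.

End Estimate.

Definition taylor2_at (f : C * C -> C) (p : C * C) (A B P Q S : C) (r K : R) :=
  forall u v, N u <= r -> N v <= r ->
  N (f (p.1 + u, p.2 + v) -
     (f p + A * u + B * v + P * u ^+ 2 + Q * (u * v) + S * v ^+ 2))
    <= K * (N u + N v) ^+ 3.

Lemma taylor2 (f : C * C -> C) p : (\forall q \near p, differentiable f q) ->
  exists A B P Q S : C, exists r K : R, [/\ 0 < r, 0 <= K & taylor2_at f p A B P Q S r K].
Proof.
case: p => x y df.
have [d0 d00 hd0] := (near_cabs_pairP _ _).1 df.
have fc : {for (x, y), continuous f}.
  by apply: differentiable_continuous; exact: nbhs_singleton df.
have /(near_cabs_pairP _ _).1[d1 d10 hd1] :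
    \forall q \near (x, y), `|f (x, y) - f q| < 1.
  by move/cvgrPdist_lt : fc; apply.
pose r := Num.min d0 d1 / 5.
have m0 : 0 < Num.min d0 d1 by rewrite lt_min d00.
have r0 : 0 < r by rewrite divr_gt0.
have [q0 q1] : 4 * r < d0 /\ 4 * r < d1.
  have : Num.min d0 d1 <= Num.min d0 d1 by [].
  by rewrite le_min => /andP[? ?]; rewrite /r; split; lra.
pose g u v := f (x + u, y + v).
have gd u v : N u <= 4 * r -> N v <= 4 * r -> differentiable f (x + u, y + v).
  by move=> hu hv; apply: (hd0 u v); lra.
have [|||u v hu hv|A [B [P [Q [S [K K0 hK]]]]]] :=
  @taylor2_aux g r (N (f (x, y)) + 1) r0.
- by rewrite addr_ge0 ?cabs_ge0.
- move=> u v hu hv; have [k hk] := diff_partial1 (gd u v hu hv).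
  by exists k; exact: (cder_shift (f := fun s => f (s, y + v)) hk).
- move=> u v hu hv; have [k hk] := diff_partial2 (gd u v hu hv).
  by exists k; exact: (cder_shift (f := fun s => f (x + u, s)) hk).
- have := hd1 u v; rewrite /= cabsE -[1]/((1 : R)%:C%C) ltcR => H.
  have : N (f (x, y) - g u v) < 1 by apply: H; lra.
  by have := cabs_lerB (g u v) (f (x, y)); rewrite cabsB; lra.
exists A, B, P, Q, S, (r / 2), K; split => //; first by rewrite divr_gt0.
by move=> u v hu hv; have := hK u v hu hv; rewrite /g !addr0.
Qed.

End TwoVariables.

(** * Gradients of functions of two variables *)

Section Gradients.
Variable R : realType.
Local Notation C := (Cplx R).

Definition has_grad (f : C * C -> C) (q : C * C) (a b : C) :=
  is_diff q f (fun v => a * v.1 + b * v.2).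

Lemma has_grad_diff f q a b : has_grad f q a b -> differentiable f q.
Proof. by move=> h; exact: (@ex_diff _ _ _ _ _ _ _ h). Qed.

Lemma has_gradE f q a b v : has_grad f q a b -> 'd f q v = a * v.1 + b * v.2.
Proof. by move=> h; rewrite (@diff_val _ _ _ _ _ _ _ h). Qed.

Lemma has_grad_eq f q a b a' b' : a = a' -> b = b' -> has_grad f q a b -> has_grad f q a' b'.
Proof. by move=> <- <-. Qed.

Lemma diff_has_grad (f : C * C -> C) q : differentiable f q ->
  has_grad f q ('d f q (1, 0)) ('d f q (0, 1)).
Proof.
move=> df; apply: DiffDef => //; apply/funext => v.
have {1}-> : v = v.1 *: (1, 0) + v.2 *: (0, 1).
  by case: v => x y; congr (_, _); rewrite /= /GRing.scale /= !mulr0 ?mulr1 ?addr0 ?add0r.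
by rewrite linearD !linearZ /= /GRing.scale /= ![_ * 'd f q _]mulrC.
Qed.

Lemma has_grad_cst c q : has_grad (fun=> c) q 0 0.
Proof.
apply: is_diff_eq (is_diff_cst _ _) _.
by apply/funext => v /=; rewrite !mul0r addr0.
Qed.

Lemma has_grad_fst q : has_grad (fun q => q.1) q 1 0.
Proof.
apply: is_diff_eq (is_diff_fst _) _.
by apply/funext => v /=; rewrite mul1r mul0r addr0.
Qed.

Lemma has_grad_snd q : has_grad (fun q => q.2) q 0 1.
Proof.
apply: is_diff_eq (is_diff_snd _) _.
by apply/funext => v /=; rewrite mul1r mul0r add0r.
Qed.

Lemma has_gradD f g q a b c d : has_grad f q a b -> has_grad g q c d ->
  has_grad (fun x => f x + g x) q (a + c) (b + d).
Proof.
move=> h k; apply: is_diff_eq (is_diffD h k) _.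
by apply/funext => v /=; rewrite !mulrDl addrACA.
Qed.

Lemma has_gradN f q a b : has_grad f q a b -> has_grad (fun x => - f x) q (- a) (- b).
Proof.
move=> h; apply: is_diff_eq (is_diffN h) _.
by apply/funext => v /=; rewrite !mulNr -opprD.
Qed.

Lemma has_gradB f g q a b c d : has_grad f q a b -> has_grad g q c d ->
  has_grad (fun x => f x - g x) q (a - c) (b - d).
Proof. by move=> h k; apply: has_gradD h (has_gradN k). Qed.

Lemma has_gradM f g q a b c d : has_grad f q a b -> has_grad g q c d ->
  has_grad (fun x => f x * g x) q (a * g q + f q * c) (b * g q + f q * d).
Proof.
move=> h k; apply: is_diff_eq (is_diffM h k) _.
by apply/funext => v; rewrite !fctE /GRing.scale /=; ring.
Qed.

Lemma has_gradV f q a b : f q != 0 -> has_grad f q a b ->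
  has_grad (fun x => (f x)^-1) q (- a / f q ^+ 2) (- b / f q ^+ 2).
Proof.
move=> f0 h; have df := has_grad_diff h; apply: DiffDef.
  exact: differentiableV.
rewrite diffV //; apply/funext => v /=; rewrite (has_gradE _ h) /GRing.scale /=.
by ring.
Qed.

Lemma has_grad_div f g q a b c d : g q != 0 -> has_grad f q a b -> has_grad g q c d ->
  has_grad (fun x => f x / g x) q ((a * g q - f q * c) / g q ^+ 2)
    ((b * g q - f q * d) / g q ^+ 2).
Proof.
move=> g0 h k; have := has_gradM h (has_gradV g0 k).
by apply: has_grad_eq; field.
Qed.

Lemma is_diff_cder (f : C -> C) z k : cder f z k -> is_diff z f (fun h => k * h).
Proof.
move=> h; have df := cder_diff h; apply: DiffDef => //.
have := cder_unique h (diff_cder df) => kE.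
apply/funext => x; rewrite kE -[x in LHS]mulr1 -[x * 1]/(x *: 1) linearZ /=.
by rewrite /GRing.scale /= mulrC.
Qed.

Lemma has_grad_comp (f : C * C -> C) (g : C -> C) q a b k :
  has_grad f q a b -> cder g (f q) k -> has_grad (fun x => g (f x)) q (k * a) (k * b).
Proof.
move=> h /is_diff_cder hk.
apply: is_diff_eq (is_diff_comp h hk) _.
by apply/funext => v /=; ring.
Qed.

Lemma has_grad_line (f : C * C -> C) (x y u v s a b : C) :
  has_grad f (x + s * u, y + s * v) a b ->
  cder (fun s => f (x + s * u, y + s * v)) s (a * u + b * v).
Proof.
move=> h.
have L (c w : C) : is_diff s (fun s => c + s * w) (fun h => w * h).
  apply: is_diff_cder; have := cderD (cder_cst c s) (cderM (cder_id s) (cder_cst w s)).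
  by rewrite mul1r mulr0 addr0 add0r.
have P := @is_diff_pair _ _ _ _ _ _ _ _ _ (L x u) (L y v).
have D := @is_diff_comp _ _ _ _ _ _ _ _ _ P h.
have dD := @ex_diff _ _ _ _ _ _ _ D.
have := diff_cder dD; rewrite (@diff_val _ _ _ _ _ _ _ D) /= !mulr1.
by [].
Qed.

Lemma has_grad0_const (f : C * C -> C) p : (\forall q \near p, has_grad f q 0 0) ->
  \forall q \near p, f q = f p.
Proof.
case: p => x y /near_cabs_pairP[d d0 hd]; apply/near_cabs_pairP; exists d => //= u v hu hv.
pose F (s : R) := f (x + s%:C%C * u, y + s%:C%C * v).
have -> : f (x + u, y + v) = F 1 by rewrite /F rmorph1 !mul1r.
have -> : f (x, y) = F 0 by rewrite /F !mul0r !addr0.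
apply: pder0_const => // s /andP[s0 s1].
have : cder (fun s => f (x + s * u, y + s * v)) (0 + s%:C%C * 1) 0.
  rewrite add0r mulr1.
  have -> : (0 : C) = 0 * u + 0 * v by rewrite !mul0r addr0.
  apply: has_grad_line; apply: hd; rewrite cabsM cabsR ger0_norm //.
    by apply: le_lt_trans hu; rewrite ler_piMl ?cabs_ge0.
  by apply: le_lt_trans hv; rewrite ler_piMl ?cabs_ge0.
move=> /cder_pder; rewrite mul0r.
by under eq_fun do rewrite add0r mulr1.
Qed.

End Gradients.

(** A quotient is a product with an inverse, so its pattern has to precede that of the product.
    Atoms are looked up among the hypotheses. *)
Ltac hgrad := lazymatch goal with
  | |- has_grad (fun z => z.1) _ _ _ => exact: has_grad_fst
  | |- has_grad (fun z => z.2) _ _ _ => exact: has_grad_snd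
  | |- has_grad (fun _ => ?c) _ _ _ => exact: has_grad_cst
  | |- has_grad (fun z => @?f z + @?g z) _ _ _ => apply: (@has_gradD _ f g); hgrad
  | |- has_grad (fun z => - @?f z) _ _ _ => apply: (@has_gradN _ f); hgrad
  | |- has_grad (fun z => @?f z * (@?g z)^-1) _ _ _ => apply: (@has_grad_div _ f g); [assumption|hgrad|hgrad]
  | |- has_grad (fun z => @?f z * @?g z) _ _ _ => apply: (@has_gradM _ f g); hgrad
  | |- _ => eassumption
  end.

(** * Linearizability *)

Section Linearization.
Variable R : realType.
Local Notation C := (Cplx R).
Local Notation N := (@cabs R).

Lemma pcont_pair (phi psi : R -> C) t : pcont phi t -> pcont psi t ->
  {for t, continuous (fun s => (phi s, psi s) : C * C)}.
Proof.
move=> h k P /= /(near_cabs_pairP _ _).1[d d0 hd].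
have [d1 d10 hd1] := h _ d0; have [d2 d20 hd2] := k _ d0.
apply/nbhs_ballP; exists (Num.min d1 d2) => /=; first by rewrite lt_min d10.
move=> s; rewrite /ball /= distrC lt_min => /andP[/hd1 s1 /hd2 s2].
have E : t + (s - t) = s by rewrite addrC subrK.
rewrite E in s1 s2; have := hd _ _ s1 s2 => /=.
by rewrite (addrC (phi t)) (addrC (psi t)) !subrK.
Qed.

(** A leaf is a connected component, so it contains the connected image of an interval that stays in
    the level set. *)
Lemma leaf_curve d (U : 'I_d -> C * C -> C) (A : set (C * C)) i (phi psi : R -> C) (del : R) :
  0 <= del ->
  (forall s, 0 <= s <= del -> pcont phi s /\ pcont psi s) ->
  (forall s, 0 <= s <= del -> A (phi s, psi s) /\
     U i (phi s, psi s) = U i (phi 0, psi 0)) ->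
  forall s, 0 <= s <= del -> leaf U A i (phi 0, psi 0) (phi s, psi s).
Proof.
move=> d0 hc hA s hs.
pose gam s := (phi s, psi s).
exists (gam @` `[0, del]); last by exists s => //=; rewrite in_itv.
split.
- by exists 0 => //=; rewrite in_itv /= lexx d0.
- by move=> z [t /=]; rewrite in_itv /= => ht <-; exact: hA.
- apply: connected_continuous_connected; first exact: segment_connected.
  apply: continuous_in_subspaceT => t /set_mem/=; rewrite in_itv /= => /hc[h1 h2].
  exact: pcont_pair.
Qed.

Lemma cubic_small (l m : C) (K del : R) : 0 < del ->
  (forall s : R, 0 < s <= del -> N (s%:C%C * l + s%:C%C ^+ 2 * m) <= K * s ^+ 3) ->
  l = 0 /\ m = 0.
Proof.
move=> d0 h.
have H (z : C) (K' : R) : (forall s : R, 0 < s <= del -> N z <= K' * s) -> z = 0.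
  move=> hz; apply/eqP; rewrite -cabs_eq0 eq_le cabs_ge0 andbT.
  apply/ler_addgt0Pr => e e0; rewrite add0r.
  pose s := Num.min del (e / (`|K'| + 1)).
  have k1 : 0 < `|K'| + 1 by rewrite ltr_wpDl.
  have s0 : 0 < s by rewrite lt_min d0 divr_gt0.
  have : s <= s by []; rewrite {2}/s le_min => /andP[s1 s2].
  have := hz s; rewrite s0 s1 => /(_ isT) /le_trans; apply.
  rewrite ler_pdivlMr // in s2.
  by have := ler_wpM2l (ltW s0) (ler_norm K'); lra.
have l0 : l = 0.
  apply: (H l (K * del + N m)) => s /andP[s0 sd].
  have := h s; rewrite s0 sd => /(_ isT) hs.
  have sl : s * N l <= K * s ^+ 3 + s ^+ 2 * N m.
    have -> : s * N l = N (s%:C%C * l) by rewrite cabsM cabsR gtr0_norm.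
    have := cabs_lerB (s%:C%C * l) (- (s%:C%C ^+ 2 * m)).
    by rewrite opprK cabsN [N (_ * m)]cabsM cabsX cabsR gtr0_norm //; lra.
  rewrite -(ler_pM2l s0); apply: le_trans sl _.
  have K0 : 0 <= K.
    have := le_trans (cabs_ge0 _) hs.
    by rewrite pmulr_lge0 // exprn_gt0.
  have := ler_wpM2l (mulr_ge0 K0 (mulr_ge0 (ltW s0) (ltW s0))) sd.
  have -> : K * s ^+ 3 = K * (s * s) * s by ring.
  have -> : s ^+ 2 = s * s by ring.
  lra.
split => //; apply: (H m K) => s /andP[s0 sd].
have := h s; rewrite s0 sd l0 mulr0 add0r => /(_ isT).
rewrite cabsM cabsX cabsR gtr0_norm //.
have -> : K * s ^+ 3 = s ^+ 2 * (K * s) by ring.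
by rewrite ler_pM2l // exprn_gt0.
Qed.

(* The image of the curve [s |-> (x, y) + s t + s^2 (0, n2) + O(s^3)] in a line has
   velocity and acceleration proportional. *)
Lemma flat_image (phi psi : R -> C) (x y t1 t2 n2 : C)
   (F1 F2 : C * C -> C) (A1 B1 P1 Q1 S1 A2 B2 P2 Q2 S2 a b c : C) (r K M del : R) :
  0 < r -> 0 <= K -> 0 < del -> 0 <= M -> (a, b) != (0, 0) ->
  taylor2_at F1 (x, y) A1 B1 P1 Q1 S1 r K ->
  taylor2_at F2 (x, y) A2 B2 P2 Q2 S2 r K ->
  (forall s, 0 <= s <= del -> phi s = x + s%:C%C * t1) ->
  (forall s, 0 <= s <= del ->
     N (psi s - (y + s%:C%C * t2 + s%:C%C ^+ 2 * n2)) <= M * s ^+ 3) ->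
  (forall s, 0 <= s <= del -> a * F1 (phi s, psi s) + b * F2 (phi s, psi s) = c) ->
  (A1 * t1 + B1 * t2) * (B2 * n2 + P2 * t1 ^+ 2 + Q2 * (t1 * t2) + S2 * t2 ^+ 2) =
  (A2 * t1 + B2 * t2) * (B1 * n2 + P1 * t1 ^+ 2 + Q1 * (t1 * t2) + S1 * t2 ^+ 2).
Proof.
move=> r0 K0 del0 M0 ab h1 h2 hphi hpsi hline.
(* Chosen so that the increments of the two coordinates add up to at most [s * T] in norm. *)
pose T := N t1 + N t2 + N n2 + M + 1.
have T1 : 1 <= T by rewrite lerDr !addr_ge0 ?cabs_ge0.
have T0 : 0 < T := lt_le_trans ltr01 T1.
pose l1 := A1 * t1 + B1 * t2; pose l2 := A2 * t1 + B2 * t2.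
pose m1 := B1 * n2 + P1 * t1 ^+ 2 + Q1 * (t1 * t2) + S1 * t2 ^+ 2.
pose m2 := B2 * n2 + P2 * t1 ^+ 2 + Q2 * (t1 * t2) + S2 * t2 ^+ 2.
(* In the expansion of [F] along the curve, the coefficient of [s ^ 2] is the quadratic part of [F]
   on the tangent vector plus the contribution [B * n2] of the bending of the curve. *)
have exp3 (F : C * C -> C) (A B P Q S : C) :
  taylor2_at F (x, y) A B P Q S r K ->
  exists L, forall s, 0 <= s <= Num.min 1 (Num.min del (r / T)) ->
   N (F (phi s, psi s) - F (x, y) - (s%:C%C * (A * t1 + B * t2) +
      s%:C%C ^+ 2 * (B * n2 + P * t1 ^+ 2 + Q * (t1 * t2) + S * t2 ^+ 2))) <= L * s ^+ 3.
  move=> hF.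
  exists (K * T ^+ 3 + (N B + N Q + 2 * N S) * T ^+ 2) => s.
  rewrite !le_min => /and4P[s0 s1 sd sr].
  have hs : 0 <= s <= del by rewrite s0.
  rewrite ler_pdivlMr // in sr.
  set v := psi s - y; set u : C := s%:C%C * t1.
  pose e := v - (s%:C%C * t2 + s%:C%C ^+ 2 * n2).
  have he : N e <= M * s ^+ 3.
    by have := hpsi s hs; congr (N _ <= _); rewrite /e /v; ring.
  have s2 : 0 <= s ^+ 2 by rewrite exprn_ge0.
  have s3 : s ^+ 3 <= s ^+ 2 by rewrite exprS ler_piMl.
  have s21 : s ^+ 2 <= s by rewrite expr2 ler_piMl.
  have Nu : N u = s * N t1 by rewrite cabsM cabsR ger0_norm.
  have Ne' : N (v - s%:C%C * t2) <= s ^+ 2 * T.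
    have -> : v - s%:C%C * t2 = s%:C%C ^+ 2 * n2 + e by rewrite /e; ring.
    apply: le_trans (ler_cabsD _ _) _; rewrite cabsM cabsX cabsR ger0_norm //.
    have p1 : M * s ^+ 3 <= s ^+ 2 * M by rewrite mulrC ler_wpM2r.
    have p2 : 0 <= s ^+ 2 * (N t1 + N t2 + 1) by rewrite mulr_ge0 // !addr_ge0 ?cabs_ge0.
    by rewrite /T; lra.
  have Nst2 : N (s%:C%C * t2) = s * N t2 by rewrite cabsM cabsR ger0_norm.
  have NvT : N u + N v <= s * T.
    have -> : v = s%:C%C * t2 + s%:C%C ^+ 2 * n2 + e by rewrite /e; ring.
    have q1 := ler_cabsD (s%:C%C * t2 + s%:C%C ^+ 2 * n2) e.
    have q2 := ler_cabsD (s%:C%C * t2) (s%:C%C ^+ 2 * n2).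
    rewrite Nst2 cabsM cabsX cabsR ger0_norm // in q2.
    have q3 : s ^+ 2 * N n2 <= s * N n2 by rewrite ler_wpM2r ?cabs_ge0.
    have q4 : M * s ^+ 3 <= s * M by rewrite mulrC ler_wpM2r // (le_trans s3).
    by rewrite Nu /T; lra.
  have hu : N u <= r by have := cabs_ge0 v; lra.
  have hv : N v <= r by have := cabs_ge0 u; lra.
  have := hF u v hu hv.
  rewrite hphi // -/u /v [y + _]addrC subrK -/v => hF'.
  have -> : F (x + u, psi s) - F (x, y) - (s%:C%C * (A * t1 + B * t2) +
      s%:C%C ^+ 2 * (B * n2 + P * t1 ^+ 2 + Q * (t1 * t2) + S * t2 ^+ 2)) =
      (F (x + u, psi s) - (F (x, y) + A * u + B * v + P * u ^+ 2 + Q * (u * v) + S * v ^+ 2))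
      + (B * e + Q * (u * (v - s%:C%C * t2))
         + S * ((v - s%:C%C * t2) * (v + s%:C%C * t2))).
    by rewrite /e /u; ring.
  apply: le_trans (ler_cabsD _ _) _.
  apply: le_trans (lerD hF' (le_trans (ler_cabsD _ _) (lerD (ler_cabsD _ _) (lexx _)))) _.
  rewrite [leRHS]mulrDl; apply: lerD.
    rewrite -mulrA -exprMn ler_wpM2l // [T * s]mulrC lerXn2r ?nnegrE //.
      by rewrite addr_ge0 ?cabs_ge0.
    by rewrite mulr_ge0 // ltW.
  have k1 : N (B * e) <= N B * T ^+ 2 * s ^+ 3.
    rewrite cabsM -mulrA ler_wpM2l ?cabs_ge0 //; apply: le_trans he _.
    rewrite ler_wpM2r ?exprn_ge0 //; apply: (@le_trans _ _ T).
      by rewrite /T; have := (cabs_ge0 t1, cabs_ge0 t2, cabs_ge0 n2) => -[[? ?] ?]; lra.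
    by rewrite expr2 ler_peMl // ltW.
  have Ts : 0 <= s * T by rewrite mulr_ge0 // ltW.
  have k2 : N (Q * (u * (v - s%:C%C * t2))) <= N Q * T ^+ 2 * s ^+ 3.
    rewrite 2!cabsM.
    have -> : N Q * T ^+ 2 * s ^+ 3 = N Q * ((s * T) * (s ^+ 2 * T)) by ring.
    rewrite ler_wpM2l ?cabs_ge0 //.
    by apply: ler_pM; rewrite ?cabs_ge0 //; have := cabs_ge0 v; lra.
  have k3 : N (S * ((v - s%:C%C * t2) * (v + s%:C%C * t2))) <= 2 * N S * T ^+ 2 * s ^+ 3.
    rewrite 2!cabsM.
    have -> : 2 * N S * T ^+ 2 * s ^+ 3 = N S * ((s ^+ 2 * T) * (2 * (s * T))) by ring.
    rewrite ler_wpM2l ?cabs_ge0 //; apply: ler_pM; rewrite ?cabs_ge0 //.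
    apply: le_trans (ler_cabsD _ _) _; rewrite Nst2.
    have q5 : s * N t2 <= s * T.
      rewrite ler_wpM2l // /T.
      by have := (cabs_ge0 t1, cabs_ge0 n2) => -[? ?]; lra.
    by have := cabs_ge0 u; lra.
  apply: le_trans (lerD (lerD k1 k2) k3) _.
  by rewrite le_eqVlt; apply/orP; left; apply/eqP; ring.
have [L1 hL1] := exp3 F1 _ _ _ _ _ h1; have [L2 hL2] := exp3 F2 _ _ _ _ _ h2.
rewrite -/l1 -/m1 in hL1; rewrite -/l2 -/m2 in hL2.
rewrite -/l1 -/m1 -/l2 -/m2.
set e0 := Num.min _ _ in hL1 hL2.
have e00 : 0 < e0 by rewrite !lt_min ltr01 del0 divr_gt0.
have e0d : e0 <= del by rewrite /e0 !ge_min lexx !orbT.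
have c0 : a * F1 (x, y) + b * F2 (x, y) = c.
  have := hline 0; rewrite lexx (ltW del0) => /(_ isT).
  rewrite hphi ?lexx ?ltW // mul0r addr0.
  suff -> : psi 0 = y by [].
  apply/eqP; rewrite -subr_eq0 -cabs_eq0 eq_le cabs_ge0 andbT.
  have := hpsi 0; rewrite lexx (ltW del0) => /(_ isT).
  by rewrite expr0n /= expr0n /= !mul0r mulr0 !addr0.
(* The equation of the line annihilates both the velocity and the coefficient of [s ^ 2] of the
   image; since [(a, b)] is not 0, these two vectors are proportional. *)
have [lam mu] : a * l1 + b * l2 = 0 /\ a * m1 + b * m2 = 0.
  apply: (cubic_small (K := N a * L1 + N b * L2) e00) => s /andP[s0 se].
  have hs : 0 <= s <= e0 by rewrite ltW.
  have hs' : 0 <= s <= del by rewrite ltW //= (le_trans se).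
  have -> : s%:C%C * (a * l1 + b * l2) + s%:C%C ^+ 2 * (a * m1 + b * m2) =
     - (a * (F1 (phi s, psi s) - F1 (x, y) - (s%:C%C * l1 + s%:C%C ^+ 2 * m1)) +
     b * (F2 (phi s, psi s) - F2 (x, y) - (s%:C%C * l2 + s%:C%C ^+ 2 * m2))).
    have := hline s hs'; rewrite -c0 => E; apply/eqP; rewrite -subr_eq0; apply/eqP.
    transitivity (a * F1 (phi s, psi s) + b * F2 (phi s, psi s) -
      (a * F1 (x, y) + b * F2 (x, y))); last by rewrite E subrr.
    by ring.
  rewrite cabsN; apply: le_trans (ler_cabsD _ _) _.
  rewrite [N (a * _)]cabsM [N (b * _)]cabsM [leRHS]mulrDl; apply: lerD.
    by rewrite -[leRHS]mulrA ler_wpM2l ?cabs_ge0 //; exact: hL1.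
  by rewrite -[leRHS]mulrA ler_wpM2l ?cabs_ge0 //; exact: hL2.
have [a0|a0] := eqVneq a 0; last first.
  apply: (mulfI a0).
  have -> : a * (l1 * m2) = (a * l1 + b * l2) * m2 - b * l2 * m2 by ring.
  have -> : a * (l2 * m1) = l2 * (a * m1 + b * m2) - b * l2 * m2 by ring.
  by rewrite lam mu mul0r mulr0.
have b0 : b != 0 by apply: contraNneq ab => ->; rewrite a0.
apply: (mulfI b0).
have -> : b * (l1 * m2) = l1 * (a * m1 + b * m2) - a * l1 * m1 by ring.
have -> : b * (l2 * m1) = (a * l1 + b * l2) * m1 - a * l1 * m1 by ring.
by rewrite lam mu mul0r mulr0.
Qed.

End Linearization.

Section NotLinearizable.
Variable R : realType.
Local Notation C := (Cplx R).
Local Notation N := (@cabs R).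

Lemma taylor2_grad (F : C * C -> C) p A B P Q S (r K : R) (v : C * C) : 0 < r -> 0 <= K ->
  taylor2_at F p A B P Q S r K -> differentiable F p -> 'd F p v = A * v.1 + B * v.2.
Proof.
move=> r0 K0 h dF; rewrite (has_gradE v (diff_has_grad dF)).
have c1 := @has_grad_line R F p.1 p.2 v.1 v.2 0 ('d F p (1, 0)) ('d F p (0, 1)).
rewrite !mul0r !addr0 -surjective_pairing in c1.
apply: cder_unique (c1 (diff_has_grad dF)) _ => e e0.
pose X := P * v.1 ^+ 2 + Q * (v.1 * v.2) + S * v.2 ^+ 2.
pose c := N v.1 + N v.2; pose T := K * c ^+ 3 + N X.
have c0 : 0 <= c by rewrite addr_ge0 ?cabs_ge0.
have T0 : 0 <= T by rewrite addr_ge0 ?cabs_ge0 // mulr_ge0 // exprn_ge0.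
have c10 : 0 < c + 1 by rewrite ltr_wpDl.
have T10 : 0 < T + 1 by rewrite ltr_wpDl.
exists (Num.min (r / (c + 1)) (Num.min 1 (e / (T + 1)))); first by rewrite !lt_min ltr01 !divr_gt0.
move=> s; rewrite !lt_min !ltr_pdivlMr // => /and3P[sr s1 se].
have s0 := cabs_ge0 s.
have [n1 n2] : N (s * v.1) <= r /\ N (s * v.2) <= r.
  have i1 := mulr_ge0 s0 (cabs_ge0 v.1); have i2 := mulr_ge0 s0 (cabs_ge0 v.2).
  by rewrite !cabsM; move: sr; rewrite /c; split; lra.
have := h _ _ n1 n2; rewrite add0r mul0r mul0r !addr0 -surjective_pairing.
set Y := F (_, _) => H.
have -> : Y - F p - (A * v.1 + B * v.2) * s =
  (Y - (F p + A * (s * v.1) + B * (s * v.2) + P * (s * v.1) ^+ 2 + Q * (s * v.1 * (s * v.2))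
     + S * (s * v.2) ^+ 2)) + s ^+ 2 * X by rewrite /X; ring.
apply: le_trans (ler_cabsD _ _) _; move: H.
rewrite [N (s * v.1)]cabsM [N (s * v.2)]cabsM [N (_ ^+ 2 * X)]cabsM cabsX -mulrDr -/c exprMn => H.
have s2 : 0 <= N s ^+ 2 by rewrite exprn_ge0.
have s3 : N s ^+ 3 <= N s ^+ 2 by rewrite exprS ler_piMl // ltW.
have := ler_wpM2l (mulr_ge0 K0 (exprn_ge0 3 c0)) s3.
have := ler_wpM2l s0 (ltW se); rewrite /T expr2 in T0 s2 s3 *; lra.
Qed.

(** A kernel vector of the differential of [f] would also be killed by that of [g \o f], which is
    the identity near [p]. *)
Lemma linear_part_nondegenerate (f g : C * C -> C * C) (p : C * C)
  (A1 B1 P1 Q1 S1 A2 B2 P2 Q2 S2 : C) (r K : R) : 0 < r -> 0 <= K ->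
  (\forall q \near p, g (f q) = q) -> differentiable f p -> differentiable g (f p) ->
  taylor2_at (fun q => (f q).1) p A1 B1 P1 Q1 S1 r K ->
  taylor2_at (fun q => (f q).2) p A2 B2 P2 Q2 S2 r K ->
  A1 * B2 - A2 * B1 != 0.
Proof.
move=> r0 K0 gf df dg h1 h2; apply/eqP => D0.
have [v [v0 e1 e2]] : exists v : C * C, [/\ v != 0, A1 * v.1 + B1 * v.2 = 0 & A2 * v.1 + B2 * v.2 = 0].
  have [/eqP z1|nz] := boolP ((B1, - A1) == 0).
    have [/eqP z2|nz2] := boolP ((B2, - A2) == 0).
      case: z1 z2 => -> /eqP; rewrite oppr_eq0 => /eqP -> [-> /eqP]; rewrite oppr_eq0 => /eqP ->.
      by exists (1, 0); rewrite !mul0r !addr0; split=> //; rewrite xpair_eqE oner_eq0.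
    case: z1 => -> /eqP; rewrite oppr_eq0 => /eqP ->.
    by exists (B2, - A2); split=> //=; ring.
  exists (B1, - A1); split=> //=; first by ring.
  by transitivity (- (A1 * B2 - A2 * B1)); [ring|rewrite D0 oppr0].
have comp1 : 'd (fun q => (f q).1) p v = ('d f p v).1.
  have dfst := is_diff_fst (f p).
  by rewrite (diff_comp df (@ex_diff _ _ _ _ _ _ _ dfst)) /= (@diff_val _ _ _ _ _ _ _ dfst).
have comp2 : 'd (fun q => (f q).2) p v = ('d f p v).2.
  have dsnd := is_diff_snd (f p).
  by rewrite (diff_comp df (@ex_diff _ _ _ _ _ _ _ dsnd)) /= (@diff_val _ _ _ _ _ _ _ dsnd).
have dfv : 'd f p v = 0.
  rewrite [LHS]surjective_pairing -comp1 -comp2.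
  have g1 := taylor2_grad v r0 K0 h1 (differentiable_fst_comp df).
  have g2 := taylor2_grad v r0 K0 h2 (differentiable_snd_comp df).
  by congr pair; [exact: etrans g1 e1|exact: etrans g2 e2].
have dgf : 'd (g \o f) p v = 0.
  have E := congr1 (fun h : C * C -> C * C => h v) (diff_comp df dg).
  refine (etrans E (etrans (congr1 ('d g (f p)) dfv) _)).
  exact: linear0.
have dE := deriveE v (differentiable_comp df dg).
have vE : v = 'D_v (g \o f) p.
  rewrite (near_eq_derive v (gf : \near p, (g \o f) p = id p)); exact: esym (derive_id _ _).
by move: v0; rewrite (etrans vE (etrans dE dgf)) eqxx.
Qed.

End NotLinearizable.

Section SpenceKummerNotLinearizable.
Variable R : realType.
Local Notation C := (Cplx R).
Local Notation N := (@cabs R).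

(** The four vectors are tangent to the leaves of [y], [x], [x / y] and [(1 - y) / (1 - x)]. They
    are pairwise independent, whereas a nonzero binary cubic form vanishes on at most three
    lines. *)
Lemma cubic_four_points (al be ga de x y : C) :
  x != 0 -> y != 0 -> x != 1 -> y != 1 -> x != y ->
  (forall t1 t2, (t1, t2) \in [:: (1, 0); (0, 1); (x, y); (1 - x, 1 - y)] ->
    al * t1 ^+ 3 + be * (t1 ^+ 2 * t2) + ga * (t1 * t2 ^+ 2) + de * t2 ^+ 3 = 0) ->
  [/\ al = 0, be = 0, ga = 0 & de = 0].
Proof.
move=> x0 y0 x1 y1 xy h.
have al0 : al = 0.
  by have := h 1 0; rewrite !inE eqxx => /(_ isT) <-; ring.
have de0 : de = 0.
  by have := h 0 1; rewrite !inE eqxx !orbT => /(_ isT) <-; ring.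
have h3 := h x y; rewrite !inE eqxx !orbT in h3; have {}h3 := h3 isT.
have h4 := h (1 - x) (1 - y); rewrite !inE eqxx !orbT in h4; have {}h4 := h4 isT.
have e3 : be * x + ga * y = 0.
  apply: (mulfI x0); apply: (mulfI y0); rewrite !mulr0 -[RHS]h3 al0 de0; ring.
have e4 : be * (1 - x) + ga * (1 - y) = 0.
  have x1' : 1 - x != 0 by rewrite subr_eq0 eq_sym.
  have y1' : 1 - y != 0 by rewrite subr_eq0 eq_sym.
  apply: (mulfI x1'); apply: (mulfI y1'); rewrite !mulr0 -[RHS]h4 al0 de0; ring.
have e5 : be * (x - y) = 0.
  transitivity ((be * x + ga * y) - y * ((be * x + ga * y) + (be * (1 - x) + ga * (1 - y)))).
    by ring.
  by rewrite e3 e4; ring.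
have be0 : be = 0.
  by move/eqP: e5; rewrite mulf_eq0 subr_eq0 (negbTE xy) orbF => /eqP.
split => //; move/eqP: e3; rewrite be0 mul0r add0r mulf_eq0 (negbTE y0) orbF.
by move/eqP.
Qed.

Lemma spence_kummer_not_linearizable (x y : C) :
  x != 0 -> y != 0 -> x != 1 -> y != 1 -> x != y ->
  ~ linearizable (@spence_kummer R) (x, y).
Proof.
move=> x0 y0 x1 y1 xy [A [B [f [Axy [oA oB [fAB _ _] df [g [gf dg]]] hline]]]].
have nA : \forall q \near (x, y), A q by exact: open_nbhs_nbhs.
have Bf : B (f (x, y)) by apply: fAB.
have df1 : \forall q \near (x, y), differentiable (fun q => (f q).1) q.
  by apply: filterS nA => q /df; exact: differentiable_fst_comp.
have df2 : \forall q \near (x, y), differentiable (fun q => (f q).2) q.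
  by apply: filterS nA => q /df; exact: differentiable_snd_comp.
have [A1 [B1 [P1 [Q1 [S1 [r1 [K1 [r10 K10 h1]]]]]]]] := taylor2 df1.
have [A2 [B2 [P2 [Q2 [S2 [r2 [K2 [r20 K20 h2]]]]]]]] := taylor2 df2.
pose r := Num.min r1 r2; pose K := K1 + K2.
have r0 : 0 < r by rewrite lt_min r10.
have K0 : 0 <= K by rewrite addr_ge0.
have {}h1 : taylor2_at (fun q => (f q).1) (x, y) A1 B1 P1 Q1 S1 r K.
  move=> u v; rewrite !le_min => /andP[u1 u2] /andP[v1 v2].
  apply: le_trans (h1 u v u1 v1) _; rewrite ler_wpM2r //; last by rewrite lerDl.
  by rewrite exprn_ge0 // addr_ge0 ?cabs_ge0.
have {}h2 : taylor2_at (fun q => (f q).2) (x, y) A2 B2 P2 Q2 S2 r K.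
  move=> u v; rewrite !le_min => /andP[u1 u2] /andP[v1 v2].
  apply: le_trans (h2 u v u2 v2) _; rewrite ler_wpM2r //; last by rewrite lerDr.
  by rewrite exprn_ge0 // addr_ge0 ?cabs_ge0.
have D0 : A1 * B2 - A2 * B1 != 0.
  apply: (@linear_part_nondegenerate R f g (x, y) A1 B1 P1 Q1 S1 A2 B2 P2 Q2 S2 r K r0 K0) => //.
  - by apply: filterS nA => q /gf.
  - exact: df.
  - exact: dg.
have [d d0 hd] := (near_cabs_pairP _ _).1 nA.
(* [del] is small enough for the curve to remain in [A]; then it lies in one leaf, whose image lies
   in a line. *)
have flat (i : 'I_9) (psi : R -> C) (t1 t2 n2 : C) (M e : R) :
    0 < e -> 0 <= M ->
    (forall s, 0 <= s <= e -> pcont psi s) ->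
    (forall s, 0 <= s <= e -> N (psi s - (y + s%:C%C * t2 + s%:C%C ^+ 2 * n2)) <= M * s ^+ 3) ->
    (forall s, 0 <= s <= e -> spence_kummer i (x + s%:C%C * t1, psi s) = spence_kummer i (x, y)) ->
    (A1 * t1 + B1 * t2) * (B2 * n2 + P2 * t1 ^+ 2 + Q2 * (t1 * t2) + S2 * t2 ^+ 2) =
    (A2 * t1 + B2 * t2) * (B1 * n2 + P1 * t1 ^+ 2 + Q1 * (t1 * t2) + S1 * t2 ^+ 2).
  move=> e0 M0 psic psiM Uc.
  pose T := N t1 + N t2 + N n2 + M + 1.
  have T0 : 0 < T by rewrite ltr_wpDl // !addr_ge0 ?cabs_ge0.
  pose del := Num.min (Num.min 1 e) (d / 2 / T).
  have del0 : 0 < del by rewrite !lt_min ltr01 e0 !divr_gt0.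
  pose phi (s : R) : C := x + s%:C%C * t1.
  have sE s : 0 <= s <= del -> [/\ 0 <= s, s <= 1, s * T <= d / 2 & 0 <= s <= e].
    rewrite !le_min ler_pdivlMr // => /andP[s0 /andP[/andP[s1 s2] s3]].
    by rewrite s0 s1 s2.
  have psi0 : psi 0 = y.
    apply/eqP; rewrite -subr_eq0 -cabs_eq0 eq_le cabs_ge0 andbT.
    have := psiM 0; rewrite lexx (ltW e0) => /(_ isT).
    by rewrite expr0n /= expr0n /= !mul0r mulr0 !addr0.
  have phi0 : phi 0 = x by rewrite /phi mul0r addr0.
  have inA s : 0 <= s <= del -> A (phi s, psi s).
    move=> /sE[s0 s1 sT se].
    have := hd (s%:C%C * t1) (psi s - y).
    rewrite /= [y + _]addrC subrK; apply.
      rewrite cabsM cabsR ger0_norm //.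
      have := ler_wpM2l s0 (_ : N t1 <= T); rewrite /T.
      by have := (cabs_ge0 t2, cabs_ge0 n2) => -[? ?] /(_ ltac:(lra)); rewrite -/T; lra.
    have -> : psi s - y = (psi s - (y + s%:C%C * t2 + s%:C%C ^+ 2 * n2))
      + (s%:C%C * t2 + s%:C%C ^+ 2 * n2) by ring.
    apply: le_lt_trans (ler_cabsD _ _) _.
    have q1 := ler_cabsD (s%:C%C * t2) (s%:C%C ^+ 2 * n2).
    rewrite cabsM [N (_ ^+ 2 * _)]cabsM cabsX cabsR ger0_norm // in q1.
    have q2 := psiM s se.
    have s2 : s ^+ 2 <= s by rewrite expr2 ler_piMl.
    have s3 : s ^+ 3 <= s by rewrite exprS ler_piMr // (le_trans s2).
    have q3 := ler_wpM2r (cabs_ge0 n2) s2.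
    have q4 := ler_wpM2l M0 s3.
    have q5 : s * T = s * N t1 + s * N t2 + s * N n2 + M * s + s by rewrite /T; ring.
    have q6 := mulr_ge0 s0 (cabs_ge0 t1).
    lra.
  have lf : forall s, 0 <= s <= del ->
      leaf (@spence_kummer R) A i (x, y) (phi s, psi s).
    rewrite -{1}phi0 -{1}psi0; apply: leaf_curve; first exact: ltW.
      move=> s /sE[_ _ _ hs]; split; last exact: psic.
      apply: (@ccont_pcont R id x t1 s); exact: cder_ccont (cder_id _).
    move=> s hs; split; first exact: inA.
    by rewrite phi0 psi0; apply: Uc; have [] := sE s hs.
  have [a [b [c [ab hL]]]] := hline i (x, y) Axy.
  apply: (@flat_image R phi psi x y t1 t2 n2 (fun q => (f q).1) (fun q => (f q).2)
    A1 B1 P1 Q1 S1 A2 B2 P2 Q2 S2 a b c r K M del) => //.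
    by move=> s /sE[_ _ _ hs]; exact: psiM.
  by move=> s hs; apply: (hL (f (phi s, psi s))); exists (phi s, psi s) => //; exact: lf.
(* The case of a straight leaf, with [n2 = 0]. Up to [2^-1] the factors [1 + s] and [1 - s], by
   which the denominators of [x / y] and [(1 - y) / (1 - x)] are multiplied, stay nonzero. *)
have line (i : 'I_9) (t1 t2 : C) :
   (forall s : R, 0 <= s <= 2^-1 -> spence_kummer i (x + s%:C%C * t1, y + s%:C%C * t2) = spence_kummer i (x, y)) ->
    (A1 * t1 + B1 * t2) * (P2 * t1 ^+ 2 + Q2 * (t1 * t2) + S2 * t2 ^+ 2) =
    (A2 * t1 + B2 * t2) * (P1 * t1 ^+ 2 + Q1 * (t1 * t2) + S1 * t2 ^+ 2).
  move=> hU; have := @flat i (fun s => y + s%:C%C * t2) t1 t2 0 0 2^-1.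
  rewrite !mulr0 !add0r; apply => //.
    move=> s _; apply: (@ccont_pcont R id y t2 s); exact: cder_ccont (cder_id _).
  by move=> s _; rewrite mulr0 addr0 subrr cabs0 mul0r.
have nz (s : R) : 0 <= s <= 2^-1 -> (1 + s%:C%C : C) != 0 /\ (1 - s%:C%C : C) != 0.
  move=> /andP[s0 s1].
  have -> : (1 + s%:C%C : C) = (1 + s)%:C%C by rewrite rmorphD rmorph1.
  have -> : (1 - s%:C%C : C) = (1 - s)%:C%C by rewrite rmorphB rmorph1.
  by rewrite -!cabs_gt0 !cabsR !normr_gt0; split; apply: lt0r_neq0; lra.
have l1 := @line (@Ordinal 9 1 isT) 1 0.
have l2 := @line (@Ordinal 9 0 isT) 0 1.
have l3 := @line (@Ordinal 9 2 isT) x y.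
have l4 := @line (@Ordinal 9 3 isT) (1 - x) (1 - y).
have {}l1 := l1 (fun s _ => ltac:(by rewrite /spence_kummer !(tnth_nth 0) /= mulr0 addr0)).
have {}l2 := l2 (fun s _ => ltac:(by rewrite /spence_kummer !(tnth_nth 0) /= mulr0 addr0)).
have {}l3 : (A1 * x + B1 * y) * (P2 * x ^+ 2 + Q2 * (x * y) + S2 * y ^+ 2) =
    (A2 * x + B2 * y) * (P1 * x ^+ 2 + Q1 * (x * y) + S1 * y ^+ 2).
  apply: l3 => s /nz[s1 s2]; rewrite /spence_kummer !(tnth_nth 0) /=.
  by field; rewrite y0 -{1}[y]mul1r -mulrDl mulf_neq0.
have {}l4 : (A1 * (1 - x) + B1 * (1 - y)) *
    (P2 * (1 - x) ^+ 2 + Q2 * ((1 - x) * (1 - y)) + S2 * (1 - y) ^+ 2) =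
    (A2 * (1 - x) + B2 * (1 - y)) *
    (P1 * (1 - x) ^+ 2 + Q1 * ((1 - x) * (1 - y)) + S1 * (1 - y) ^+ 2).
  apply: l4 => s /nz[s1 s2]; rewrite /spence_kummer !(tnth_nth 0) /=.
  have x1' : 1 - x != 0 by rewrite subr_eq0 eq_sym.
  have -> : 1 - (x + s%:C%C * (1 - x)) = (1 - s%:C%C) * (1 - x) by ring.
  have -> : 1 - (y + s%:C%C * (1 - y)) = (1 - s%:C%C) * (1 - y) by ring.
  by field; rewrite x1' s2.
(* The coefficients of the form [df(t) /\ D^2 f(t, t)], halved. *)
have [|c1 c2 c3 c4] := @cubic_four_points
  (A1 * P2 - A2 * P1) (A1 * Q2 + B1 * P2 - A2 * Q1 - B2 * P1)
  (A1 * S2 + B1 * Q2 - A2 * S1 - B2 * Q1) (B1 * S2 - B2 * S1) x y x0 y0 x1 y1 xy.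
  have E (t1 t2 : C) : (A1 * t1 + B1 * t2) * (P2 * t1 ^+ 2 + Q2 * (t1 * t2) + S2 * t2 ^+ 2) =
    (A2 * t1 + B2 * t2) * (P1 * t1 ^+ 2 + Q1 * (t1 * t2) + S1 * t2 ^+ 2) ->
    (A1 * P2 - A2 * P1) * t1 ^+ 3 + (A1 * Q2 + B1 * P2 - A2 * Q1 - B2 * P1) * (t1 ^+ 2 * t2) +
    (A1 * S2 + B1 * Q2 - A2 * S1 - B2 * Q1) * (t1 * t2 ^+ 2) + (B1 * S2 - B2 * S1) * t2 ^+ 3 = 0.
    move=> /eqP; rewrite -subr_eq0 => /eqP <-; ring.
  move=> t1 t2; rewrite !inE => /or4P[] /eqP[-> ->]; exact: E.
pose nx := N x / 2.
have nx0 : 0 < nx by rewrite divr_gt0 // cabs_gt0.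
have xs (s : R) : 0 <= s <= nx -> nx <= N (x + s%:C%C).
  move=> /andP[s0 s1]; have := cabs_lerB x (- s%:C%C).
  by rewrite opprK cabsN cabsR ger0_norm // /nx; rewrite /nx in s1; lra.
have M0 : 0 <= N y / (N x ^+ 2 * nx).
  by rewrite divr_ge0 ?cabs_ge0 // mulr_ge0 ?exprn_ge0 ?cabs_ge0 // ltW.
have xs1 (s : R) : 0 <= s <= nx -> x + s%:C%C * 1 != 0.
  by move=> /xs h; rewrite mulr1 -cabs_gt0 (lt_le_trans nx0).
(* The leaf of [x y] is [s |-> x y / (x + s)]. It expands as [y - s y / x + s ^ 2 y / x ^ 2] with
   remainder [- s ^ 3 y / (x ^ 2 (x + s))], and [x + s] has modulus at least [nx] for [s <= nx]. *)
have H : (A1 * 1 + B1 * (- y / x)) * (B2 * (y / x ^+ 2) + P2 * 1 ^+ 2 + Q2 * (1 * (- y / x)) + S2 * (- y / x) ^+ 2) =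
    (A2 * 1 + B2 * (- y / x)) * (B1 * (y / x ^+ 2) + P1 * 1 ^+ 2 + Q1 * (1 * (- y / x)) + S1 * (- y / x) ^+ 2).
  apply: (@flat (@Ordinal 9 5 isT) (fun s => x * y / (x + s%:C%C * 1)) 1 (- y / x) (y / x ^+ 2)
    (N y / (N x ^+ 2 * nx)) nx nx0 M0).
  - move=> s hs; apply: (@ccont_pcont R (fun z => x * y / z) x 1 s).
    by apply: ccontM; [exact: ccont_cst|apply: ccont_inv; exact: xs1].
  - move=> s hs; have xs0 := xs1 s hs; rewrite mulr1 in xs0 *.
    have -> : x * y / (x + s%:C%C) - (y + s%:C%C * (- y / x) + s%:C%C ^+ 2 * (y / x ^+ 2)) =
      - (s%:C%C ^+ 3 * (y / (x ^+ 2 * (x + s%:C%C)))).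
      by field; rewrite xs0 x0.
    rewrite cabsN cabsM cabsX cabsR ger0_norm; last by case/andP: hs.
    rewrite [N (y / _)]cabsM cabsV [N (x ^+ 2 * _)]cabsM cabsX mulrC ler_wpM2r //; first by rewrite exprn_ge0 //; case/andP: hs.
    have Nx0 : 0 < N x by rewrite cabs_gt0.
    have N2 : 0 < N x ^+ 2 by rewrite exprn_gt0 // cabs_gt0.
    rewrite ler_wpM2l ?cabs_ge0 // lef_pV2 ?posrE ?mulr_gt0 ?(lt_le_trans nx0 (xs s hs)) //.
    by rewrite ler_pM2l //; exact: xs.
  - move=> s hs; rewrite /spence_kummer !(tnth_nth 0) /=.
    by rewrite mulrC divfK //; exact: xs1.
(* Once the vanishing cubic in [(1, - y / x)] is subtracted from [H], only the bending term times
   the Jacobian remains. *)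
have D : (y / x ^+ 2) * (A1 * B2 - A2 * B1) = 0.
  pose t := - y / x.
  transitivity ((A1 * 1 + B1 * t) * (B2 * (y / x ^+ 2) + P2 * 1 ^+ 2 + Q2 * (1 * t) + S2 * t ^+ 2) -
    (A2 * 1 + B2 * t) * (B1 * (y / x ^+ 2) + P1 * 1 ^+ 2 + Q1 * (1 * t) + S1 * t ^+ 2) -
    ((A1 * P2 - A2 * P1) + (A1 * Q2 + B1 * P2 - A2 * Q1 - B2 * P1) * t +
    (A1 * S2 + B1 * Q2 - A2 * S1 - B2 * Q1) * t ^+ 2 + (B1 * S2 - B2 * S1) * t ^+ 3)).
    by ring.
  by rewrite H subrr c1 c2 c3 c4 !mul0r !addr0 subr0.
move/eqP: D; rewrite mulf_eq0 (negbTE D0) orbF mulf_eq0 (negbTE y0) invr_eq0 expf_eq0 /=.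
by rewrite (negbTE x0).
Qed.

End SpenceKummerNotLinearizable.

(** * Polylogarithmic relations *)

Section GermIndependence.
Variable R : realType.
Local Notation C := (Cplx R).
Local Notation N := (@cabs R).

Lemma cder_val (f : C -> C) z a b : cder f z a -> a = b -> cder f z b.
Proof. by move=> h <-. Qed.

Lemma near_near (T : topologicalType) (p : T) (P : T -> Prop) :
  (\forall q \near p, P q) -> \forall q \near p, \forall q' \near q, P q'.
Proof. by move=> /nbhs_interior. Qed.

Lemma near0_der (f g : C -> C) (z0 : C) : (\forall z \near z0, f z = 0) ->
  (\forall z \near z0, cder f z (g z)) -> \forall z \near z0, g z = 0.
Proof.
move=> /near_near f0 fg; apply: filterS2 f0 fg => z /near_cabsP[d d0 hd] h.
apply: cder_unique h _; apply: cder_eq_near d0 _ (cder_cst 0 z) => w /hd.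
by [].
Qed.

Lemma poly_near0 (p : {poly C}) (z0 : C) : (\forall z \near z0, p.[z] = 0) -> p = 0.
Proof.
move=> /near_cabsP[d d0 hd]; apply/eqP; apply: contraT => p0.
pose s := [seq z0 + (d / k.+2%:R)%:C%C | k <- iota 0 (size p)].
have : (size s < size p)%N.
  apply: max_poly_roots => //.
    apply/allP => _ /mapP[k _ ->]; apply/rootP; apply: hd.
    rewrite cabsR gtr0_norm ?divr_gt0 // ltr_pdivrMr // ltr_pMr //.
    by rewrite ltr1n.
  rewrite map_inj_uniq ?iota_uniq // => k l /addrI /complexI.
  move/(mulfI (lt0r_neq0 d0)) /invr_inj /eqP; rewrite eqr_nat => /eqP.
  by move=> [].
by rewrite size_map size_iota ltnn.
Qed.

(** An explicit list lets the coefficients of a concrete polynomial be read off by index. *)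
Lemma coefs_near0 (s : seq C) (z0 : C) :
  (\forall z \near z0, horner_rec s z = 0) -> forall i, s`_i = 0.
Proof.
move=> h i; rewrite -coef_Poly (@poly_near0 (Poly s) z0) ?coef0 //.
by apply: filterS h => z; rewrite horner_Poly.
Qed.

Ltac cderiv := lazymatch goal with
  | |- cder (fun z => z) _ _ => exact: cder_id
  | |- cder (fun _ => ?c) _ _ => exact: cder_cst
  | |- cder (fun z => @?f z + @?g z) _ _ => apply: (@cderD _ f g); cderiv
  | |- cder (fun z => - @?f z) _ _ => apply: (@cderN _ f); cderiv
  | |- cder (fun z => @?f z * @?g z) _ _ => apply: (@cderM _ f g); cderiv
  | |- _ => eassumption
  end.

(** Clearing denominators and differentiating removes first [D] and the products of logarithms, then
    the logarithms. The remaining rational function determines some of the constants, and going back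
    through the intermediate functions gives the others. *)
Lemma germ_independence (l0 l1 D : C -> C) (z0 k0 k1 k2 k3 k4 k5 k6 kA kB : C) :
  z0 != 0 -> z0 != 1 ->
  (\forall z \near z0, cder l0 z z^-1) ->
  (\forall z \near z0, cder l1 z (z - 1)^-1) ->
  (\forall z \near z0, cder D z (l1 z / z)) ->
  (\forall z \near z0, k0 + k1 / z ^+ 2 + k2 / z + k3 / (z - 1) +
     k4 * (l0 z / z) + k5 * (l1 z / z) + k6 * (l0 z / (z - 1)) +
     kA * (2 * D z / z - l0 z ^+ 2 / (z - 1)) +
     kB * ((2 * D z - l0 z * l1 z) / z) = 0) ->
  [/\ [/\ k0 = 0, k1 = 0, k2 = 0 & k3 = 0], [/\ k4 = 0, k5 = 0 & k6 = 0] & kA = 0 /\ kB = 0].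
Proof.
move=> z00 z01 d0 d1 dD h.
have nz : \forall z \near z0, z != 0 /\ z - 1 != 0.
  have m0 : 0 < Num.min (N z0) (N (z0 - 1)) by rewrite lt_min !cabs_gt0 z00 subr_eq0.
  apply/near_cabsP; exists (Num.min (N z0) (N (z0 - 1))) => // w; rewrite lt_min => /andP[w0 w1].
  split; rewrite -cabs_gt0.
    by have := cabs_lerB z0 (- w); rewrite opprK cabsN; lra.
  by have := cabs_lerB (z0 - 1) (- w); rewrite opprK cabsN addrAC; lra.
pose a := 2 * (kA + kB).
(* The factor [z (z - 1)] turns the coefficients of [D], of the logarithms and of their products
   into polynomials of degree at most 1, so that [E2] is linear in the logarithms. *)
pose E z := k0 * (z * (z - 1)) + k1 * (1 - z^-1) + k2 * (z - 1) + k3 * z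
  + (k4 * (z - 1) + k6 * z) * l0 z + k5 * (z - 1) * l1 z
  + a * (z - 1) * D z - kA * z * (l0 z * l0 z) - kB * (z - 1) * (l0 z * l1 z).
have E0 : \forall z \near z0, E z = 0.
  apply: filterS2 nz h => z [z1 z2] hz.
  rewrite -[RHS](mulr0 (z * (z - 1))) -[in RHS]hz /E /a.
  by field; rewrite z1 z2.
pose E1 z := k0 * (2 * z - 1) + k1 * (z^-1 * z^-1) + k2 + k3
  + (k4 + k6) * l0 z + (k4 + k6) - k4 * z^-1 + k5 * l1 z + k5
  + a * D z + a * (l1 z - l1 z * z^-1) - kA * (l0 z * l0 z) - 2 * kA * l0 z
  - kB * (l0 z * l1 z) - kB * (l1 z - l1 z * z^-1) - kB * l0 z.
have dinv z : z != 0 -> cder (fun z : C => z^-1) z (- 1 / z ^+ 2).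
  by move=> z1; exact: (cderV (f := id) z1 (cder_id z)).
have dE : \forall z \near z0, cder E z (E1 z).
  near=> z.
  have [z1 z2] : z != 0 /\ z - 1 != 0 by near: z.
  have c0 : cder l0 z z^-1 by near: z.
  have c1 : cder l1 z (z - 1)^-1 by near: z.
  have cD : cder D z (l1 z / z) by near: z.
  have ci := dinv z z1.
  rewrite /E; apply: cder_val; first by cderiv.
  by rewrite /E1 /id; field; rewrite z1 z2.
have E10 := near0_der E0 dE.
pose E2 z := (a - kB) * (z^-1 + z^-1 * z^-1) * l1 z - (2 * kA * z^-1 + kB * (z - 1)^-1) * l0 z
  + 2 * k0 - 2 * k1 * (z^-1 * z^-1 * z^-1) + (k4 + k6) * z^-1 + k4 * (z^-1 * z^-1) + k5 * (z - 1)^-1.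
have dE1 : \forall z \near z0, cder E1 z (E2 z).
  near=> z.
  have [z1 z2] : z != 0 /\ z - 1 != 0 by near: z.
  have c0 : cder l0 z z^-1 by near: z.
  have c1 : cder l1 z (z - 1)^-1 by near: z.
  have cD : cder D z (l1 z / z) by near: z.
  have ci := dinv z z1.
  rewrite /E1; apply: cder_val; first by cderiv.
  by rewrite /E2 /id /a; field; rewrite z1 z2.
have E20 := near0_der E10 dE1.
pose c := 2 * kA + kB.
(* The factor [z ^ 2 (z - 1)] makes the coefficients of both logarithms polynomials of degree at
   most 2, so three derivatives leave a rational function. *)
pose W z := c * (z * z - 1) * l1 z - (c * (z * z) - 2 * kA * z) * l0 z
  + 2 * k0 * (z * z * (z - 1)) - 2 * k1 * (1 - z^-1) + (k4 + k6) * (z * (z - 1))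
  + k4 * (z - 1) + k5 * (z * z).
have W0 : \forall z \near z0, W z = 0.
  apply: filterS2 nz E20 => z [z1 z2] hz.
  rewrite -[RHS](mulr0 (z * z * (z - 1))) -[in RHS]hz /W /E2 /a /c.
  by field; rewrite z1 z2.
pose W1 z := c * (2 * z) * l1 z + c * (z + 1) - (2 * c * z - 2 * kA) * l0 z - c * z + 2 * kA
  + 2 * k0 * (3 * (z * z) - 2 * z) - 2 * k1 * (z^-1 * z^-1) + (k4 + k6) * (2 * z - 1)
  + k4 + k5 * (2 * z).
have dW : \forall z \near z0, cder W z (W1 z).
  near=> z.
  have [z1 z2] : z != 0 /\ z - 1 != 0 by near: z.
  have c0 : cder l0 z z^-1 by near: z.
  have c1 : cder l1 z (z - 1)^-1 by near: z.
  have ci := dinv z z1.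
  rewrite /W; apply: cder_val; first by cderiv.
  by rewrite /W1 /id; field; rewrite z1 z2.
have W10 := near0_der W0 dW.
pose W2 z := 2 * c * l1 z + 2 * c * (1 + (z - 1)^-1) - 2 * c * l0 z - 2 * c + 2 * kA * z^-1
  + 2 * k0 * (6 * z - 2) + 4 * k1 * (z^-1 * z^-1 * z^-1) + 2 * (k4 + k6) + 2 * k5.
have dW1 : \forall z \near z0, cder W1 z (W2 z).
  near=> z.
  have [z1 z2] : z != 0 /\ z - 1 != 0 by near: z.
  have c0 : cder l0 z z^-1 by near: z.
  have c1 : cder l1 z (z - 1)^-1 by near: z.
  have ci := dinv z z1.
  rewrite /W1; apply: cder_val; first by cderiv.
  by rewrite /W2 /id; field; rewrite z1 z2.
have W20 := near0_der W10 dW1.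
pose W3 z := 2 * c * (z - 1)^-1 - 2 * c * ((z - 1)^-1 * (z - 1)^-1) - 2 * c * z^-1 - 2 * kA * (z^-1 * z^-1)
  + 12 * k0 - 12 * k1 * (z^-1 * z^-1 * (z^-1 * z^-1)).
have dW2 : \forall z \near z0, cder W2 z (W3 z).
  near=> z.
  have [z1 z2] : z != 0 /\ z - 1 != 0 by near: z.
  have c0 : cder l0 z z^-1 by near: z.
  have c1 : cder l1 z (z - 1)^-1 by near: z.
  have ci := dinv z z1.
  have ci1 : cder (fun z : C => (z - 1)^-1) z (- (1 - 0) / (z - 1) ^+ 2).
    exact: (cderV (f := fun z => z - 1) z2 (cderB (cder_id z) (cder_cst 1 z))).
  rewrite /W2; apply: cder_val; first by cderiv.
  by rewrite /W3 /id; field; rewrite z1 z2.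
have W30 := near0_der W20 dW2.
(* The coefficients of [z ^ 4 (z - 1) ^ 2 * W3]. *)
have p0 := @coefs_near0 [:: - (12 * k1); 24 * k1; - (12 * k1) - 2 * kA; 4 * kA - 2 * c;
  12 * k0 - 2 * kA; - (24 * k0); 12 * k0] z0.
have {}p0 i := p0 ltac:(apply: filterS2 nz W30 => z [z1 z2] hz;
  rewrite -[RHS](mulr0 (z ^+ 4 * (z - 1) ^+ 2)) -[in RHS]hz /W3 /=; field; by rewrite z1 z2) i.
have n12 : (12 : C) != 0 by rewrite pnatr_eq0.
have n2 : (2 : C) != 0 by rewrite pnatr_eq0.
have k10 : k1 = 0.
  by apply/eqP; have /eqP := p0 0%N; rewrite /= oppr_eq0 mulf_eq0 (negbTE n12).
have k00 : k0 = 0.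
  by apply/eqP; have /eqP := p0 6%N; rewrite /= mulf_eq0 (negbTE n12).
have kA0 : kA = 0.
  by apply/eqP; have /eqP := p0 4%N; rewrite /= k00 mulr0 sub0r oppr_eq0 mulf_eq0 (negbTE n2).
have c0 : c = 0.
  by apply/eqP; have /eqP := p0 3%N; rewrite /= kA0 mulr0 sub0r oppr_eq0 mulf_eq0 (negbTE n2).
have kB0 : kB = 0 by move: c0; rewrite /c kA0 mulr0 add0r.
(* With [k0], [k1], [kA] and [kB] equal to 0, [W] is already a polynomial; it gives [k4], [k5],
   [k6], after which [E] is one too. *)
have s0 := @coefs_near0 [:: - k4; - k6; k4 + k6 + k5] z0.
have {}s0 i := s0 ltac:(apply: filterS W0 => z hz;
  rewrite -hz /W c0 k00 kA0 k10 /=; ring) i.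
have k40 : k4 = 0 by have := s0 0%N => /= /eqP; rewrite oppr_eq0 => /eqP.
have k60 : k6 = 0 by have := s0 1%N => /= /eqP; rewrite oppr_eq0 => /eqP.
have k50 : k5 = 0 by have := s0 2%N; rewrite /= k40 k60 !add0r.
have t0 := @coefs_near0 [:: - k2; k2 + k3] z0.
have {}t0 i := t0 ltac:(apply: filterS E0 => z hz;
  rewrite -hz /E /a k00 kA0 kB0 k10 k40 k50 k60 /=; ring) i.
have k20 : k2 = 0 by have := t0 0%N => /= /eqP; rewrite oppr_eq0 => /eqP.
have k30 : k3 = 0 by have := t0 1%N; rewrite /= k20 add0r.
by [].
Unshelve. all: by end_near.
Qed.

End GermIndependence.

(** * The functions [U_i] and the letters *)

Section Letters.
Variable R : realType.
Local Notation C := (Cplx R).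
Local Notation N := (@cabs R).

Definition letter (l : nat) (q : C * C) : C :=
  match l with
  | 0 => q.1 | 1 => q.2 | 2 => 1 - q.1 | 3 => 1 - q.2
  | 4 => q.1 - q.2 | _ => 1 - q.1 * q.2
  end.

Definition dletter (l : nat) (q v : C * C) : C :=
  match l with
  | 0 => v.1 | 1 => v.2 | 2 => - v.1 | 3 => - v.2
  | 4 => v.1 - v.2 | _ => - (q.2 * v.1 + q.1 * v.2)
  end.

Definition dlog_letter q v l := dletter l q v / letter l q.

(* [d log U_i] and [d log (1 - U_i)] in terms of the [d log] of the letters. *)
Definition m0 (i : nat) (L : nat -> C) : C :=
  match i with
  | 0 => L 0%N | 1 => L 1%N | 2 => L 0%N - L 1%N | 3 => L 3%N - L 2%N
  | 4 => L 1%N + L 2%N - L 0%N - L 3%N | 5 => L 0%N + L 1%N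
  | 6 => L 0%N + L 3%N - L 2%N | 7 => L 3%N - L 1%N - L 2%N
  | _ => L 0%N + 2 * L 3%N - L 1%N - 2 * L 2%N
  end.

Definition m1 (i : nat) (L : nat -> C) : C :=
  match i with
  | 0 => L 2%N | 1 => L 3%N | 2 => L 4%N - L 1%N | 3 => L 4%N - L 2%N
  | 4 => L 4%N - L 0%N - L 3%N | 5 => L 5%N | 6 => L 5%N - L 2%N
  | 7 => L 5%N - L 1%N - L 2%N | _ => L 4%N + L 5%N - L 1%N - 2 * L 2%N
  end.

Definition good (q : C * C) := forall l, (l < 6)%N -> letter l q != 0.

(** Natural indices allow case analysis; beyond 8 the value is arbitrary. *)
Definition sk (i : nat) (q : C * C) : C := spence_kummer (@inord 8 i) q.

(** Squares are written as products, since [hgrad] has a rule for products and none for powers. *)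
Definition sk_formula (i : nat) (q : C * C) : C :=
  match i with
  | 0 => q.1 | 1 => q.2 | 2 => q.1 / q.2 | 3 => (1 - q.2) / (1 - q.1)
  | 4 => (q.2 * (1 - q.1)) / (q.1 * (1 - q.2)) | 5 => q.1 * q.2
  | 6 => (q.1 * (1 - q.2)) / (q.1 - 1) | 7 => (1 - q.2) / (q.2 * (q.1 - 1))
  | _ => (q.1 * ((1 - q.2) * (1 - q.2))) / (q.2 * ((1 - q.1) * (1 - q.1)))
  end.

Lemma skE i : (i < 9)%N -> sk i = sk_formula i.
Proof.
move=> i9; apply/funext => -[x y]; rewrite /sk /spence_kummer (tnth_nth 0) inordK //.
by case: i i9 => [|[|[|[|[|[|[|[|[|i]]]]]]]]].
Qed.

Lemma spence_kummerE (i : 'I_9) : @spence_kummer R i = sk i.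
Proof. by apply/funext => q; rewrite /sk inord_val. Qed.

Lemma letter_grad l q : has_grad (letter l) q (dletter l q (1, 0)) (dletter l q (0, 1)).
Proof.
case: l => [|[|[|[|[|l]]]]]; rewrite /letter /dletter /=;
  (apply: has_grad_eq; last by hgrad); ring.
Qed.

Lemma goodP q : good q -> [/\ [/\ q.1 != 0, q.2 != 0, 1 - q.1 != 0, 1 - q.2 != 0
  & q.1 - q.2 != 0], 1 - q.1 * q.2 != 0, q.1 - 1 != 0 & q.2 - 1 != 0].
Proof.
move=> g; split; last 3 first.
- exact: (g 5%N).
- by rewrite -opprB oppr_eq0; exact: (g 2%N).
- by rewrite -opprB oppr_eq0; exact: (g 3%N).
by split; [exact: (g 0%N)|exact: (g 1%N)|exact: (g 2%N)|exact: (g 3%N)|exact: (g 4%N)].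
Qed.

Lemma sk_grad i q : (i < 9)%N -> good q ->
  has_grad (sk i) q (sk i q * m0 i (dlog_letter q (1, 0))) (sk i q * m0 i (dlog_letter q (0, 1))).
Proof.
move=> i9 g; have [[g0 g1 g2 g3 g4] g5 g6 g7] := goodP g.
rewrite skE //.
have q4 : q.1 * (1 - q.2) != 0 by rewrite mulf_neq0.
have q7 : q.2 * (q.1 - 1) != 0 by rewrite mulf_neq0.
have q8 : q.2 * ((1 - q.1) * (1 - q.1)) != 0 by rewrite !mulf_neq0.
case: i i9 => [|[|[|[|[|[|[|[|[|i]]]]]]]]] i9; last by [].
all: rewrite /sk_formula /m0 /dlog_letter /dletter /letter.
all: (apply: has_grad_eq; last by hgrad) => /=.
all: by field; rewrite ?g0 ?g1 ?g2 ?g3 ?g4 ?g5 ?g6 ?g7.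
Qed.

End Letters.

Section LocalFunctions.
Variable R : realType.
Local Notation C := (Cplx R).
Local Notation N := (@cabs R).

Lemma dlog_letter_lin q v l : dlog_letter q v l =
  dlog_letter q (1, 0) l * v.1 + dlog_letter q (0, 1) l * v.2 :> C.
Proof. by case: l => [|[|[|[|[|l]]]]]; rewrite /dlog_letter /dletter /=; ring. Qed.

Lemma m0_lin i (L L1 L2 : nat -> C) a b : (forall l, L l = L1 l * a + L2 l * b) ->
  m0 i L = m0 i L1 * a + m0 i L2 * b.
Proof.
by move=> h; case: i => [|[|[|[|[|[|[|[|i]]]]]]]]; rewrite /m0 !h; ring.
Qed.

Lemma sk_diff i (q : C * C) v : (i < 9)%N -> good q ->
  'd (sk i) q v = sk i q * m0 i (dlog_letter q v).
Proof.
move=> i9 g; rewrite (has_gradE _ (sk_grad i9 g)).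
by rewrite (m0_lin i (dlog_letter_lin q v)); ring.
Qed.

Lemma sk_neq0 i (q : C * C) : (i < 9)%N -> good q -> sk i q != 0.
Proof.
move=> i9 g; have [[g0 g1 g2 g3 g4] g5 g6 g7] := goodP g.
rewrite skE //; case: i i9 => [|[|[|[|[|[|[|[|[|i]]]]]]]]] i9; last by [].
all: by rewrite /sk_formula ?mulf_eq0 ?invr_eq0 ?mulf_eq0 ?(negbTE g0) ?(negbTE g1) ?(negbTE g2) ?(negbTE g3) ?(negbTE g6).
Qed.

(** Both sides are [d U_i], expressed through [d log U_i] and through [d log (1 - U_i)]. *)
Lemma sk_m1 i (q v : C * C) : (i < 9)%N -> good q ->
  sk i q * m0 i (dlog_letter q v) = (sk i q - 1) * m1 i (dlog_letter q v).
Proof.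
move=> i9 g; have [[g0 g1 g2 g3 g4] g5 g6 g7] := goodP g.
rewrite skE //; case: i i9 => [|[|[|[|[|[|[|[|[|i]]]]]]]]] i9; last by [].
all: rewrite /sk_formula /m0 /m1 /dlog_letter /dletter /letter.
all: by field; rewrite ?g0 ?g1 ?g2 ?g3 ?g4 ?g5 ?g6 ?g7.
Qed.

Lemma sk_neq1 i (q : C * C) : (i < 9)%N -> good q -> sk i q - 1 != 0.
Proof.
move=> i9 g; have [[g0 g1 g2 g3 g4] g5 g6 g7] := goodP g.
have gr : q.1 * q.2 - 1 != 0 by rewrite -opprB oppr_eq0.
rewrite skE //; case: i i9 => [|[|[|[|[|[|[|[|[|i]]]]]]]]] i9; last by [].
all: rewrite /sk_formula.
- done.
- done.
- have -> : q.1 / q.2 - 1 = (q.1 - q.2) / q.2 by field.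
  by rewrite mulf_neq0 ?invr_neq0.
- have -> : (1 - q.2) / (1 - q.1) - 1 = (q.1 - q.2) / (1 - q.1) by field.
  by rewrite mulf_neq0 ?invr_neq0.
- have -> : q.2 * (1 - q.1) / (q.1 * (1 - q.2)) - 1 = - (q.1 - q.2) / (q.1 * (1 - q.2)).
    by field; rewrite g0 g3.
  by rewrite !(mulf_neq0, invr_neq0, oppr_eq0).
- done.
- have -> : q.1 * (1 - q.2) / (q.1 - 1) - 1 = (1 - q.1 * q.2) / (q.1 - 1) by field.
  by rewrite mulf_neq0 ?invr_neq0.
- have -> : (1 - q.2) / (q.2 * (q.1 - 1)) - 1 = (1 - q.1 * q.2) / (q.2 * (q.1 - 1)).
    by field; rewrite g1 g6.
  by rewrite !(mulf_neq0, invr_neq0).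
have -> : q.1 * ((1 - q.2) * (1 - q.2)) / (q.2 * ((1 - q.1) * (1 - q.1))) - 1 =
  (q.1 - q.2) * (1 - q.1 * q.2) / (q.2 * ((1 - q.1) * (1 - q.1))).
  by field; rewrite g1 g2.
by rewrite !(mulf_neq0, invr_neq0).
Qed.

Lemma near_neqC (z c : C) : z != c -> \forall w \near z, w != c.
Proof.
move=> zc; apply/near_cabsP; exists (N (z - c)); first by rewrite cabs_gt0 subr_eq0.
move=> w; apply: contraTneq => <-.
by rewrite opprD addrA subrr sub0r cabsN ltxx.
Qed.

Lemma near_neq (f : C * C -> C) p a b c : has_grad f p a b -> f p != c ->
  \forall q \near p, f q != c.
Proof.
move=> /has_grad_diff /differentiable_continuous fc fp.
exact: (fc _ (near_neqC fp)).
Qed.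

Lemma near_good (p : C * C) : good p -> \forall q \near p, good q.
Proof.
move=> g; have H l : (l < 6)%N -> \forall q \near p, letter l q != 0.
  by move=> /g; apply: near_neq; exact: letter_grad.
near=> q => -[|[|[|[|[|[|l]]]]]] //= _.
- by near: q; exact: (H 0%N).
- by near: q; exact: (H 1%N).
- by near: q; exact: (H 2%N).
- by near: q; exact: (H 3%N).
- by near: q; exact: (H 4%N).
- by near: q; exact: (H 5%N).
Unshelve. all: by end_near.
Qed.

(* Branches at [z0] of [log z], [log (1 - z)] and of the iterated integral
   of [dz / z] and [dz / (z - 1)], all normalized to vanish at [z0]. *)
Definition polylog_germs (z0 : C) (l0 l1 D : C -> C) :=
  [/\ l0 z0 = 0, l1 z0 = 0 & D z0 = 0] /\
  [/\ \forall z \near z0, cder l0 z z^-1,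
      \forall z \near z0, cder l1 z (z - 1)^-1
    & \forall z \near z0, cder D z (l1 z / z)].

Lemma polylog_germs_exist (z0 : C) : z0 != 0 -> z0 != 1 ->
  exists l, polylog_germs z0 l.1.1 l.1.2 l.2.
Proof.
move=> z00 z01.
have n0 := near_neqC z00; have n1 := near_neqC z01.
have h0 : \forall z \near z0, differentiable (fun z : C => z^-1) z.
  by apply: filterS n0 => z zn; exact: cder_diff (cderV (f := id) zn (cder_id z)).
have h1 : \forall z \near z0, differentiable (fun z : C => (z - 1)^-1) z.
  apply: filterS n1 => z zn; have zn' : z - 1 != 0 by rewrite subr_eq0.
  exact: cder_diff (cderV (f := fun z => z - 1) zn' (cderB (cder_id z) (cder_cst 1 z))).
have [l0 l00 d0] := local_primitive h0; have [l1 l10 d1] := local_primitive h1.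
have h2 : \forall z \near z0, differentiable (fun z : C => l1 z / z) z.
  apply: filterS2 n0 d1 => z zn dz; exact: cder_diff (cder_div (g := id) zn dz (cder_id z)).
have [D D0 dD] := local_primitive h2.
by exists (l0, l1, D).
Qed.

End LocalFunctions.

(** * Holomorphic branches of the square root *)

Section LocalSquareRoot.
Variable R : realType.
Local Notation C := (Cplx R).
Local Notation N := (@cabs R).

Lemma right_sqrt (w : C) : exists r : C, r ^+ 2 = w /\ 0 <= complex.Re r.
Proof.
pose r := sqrtC w.
have [h|h] := leP 0 (complex.Re r); first by exists r; rewrite sqrtCK.
by exists (- r); rewrite sqrrN sqrtCK raddfN /= oppr_ge0 ltW.
Qed.

(** The root with nonnegative real part is holomorphic on the disc of radius 1 around 1, where its
    real part is positive; scaling by [s0] and [z0] moves this branch to [z0]. *)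
Lemma local_sqrt (z0 s0 : C) : s0 != 0 -> s0 ^+ 2 = z0 ->
  exists S : C -> C, S z0 = s0 /\
    \forall z \near z0, S z ^+ 2 = z /\ cder S z (S z / (2 * z)).
Proof.
move=> s00 sz0; have z00 : z0 != 0 by rewrite -sz0 expf_neq0.
have [r rP] := choice right_sqrt.
have r2 w : r w * r w = w by have [E _] := rP w; rewrite -[RHS]E expr2.
have rRe w : 0 <= complex.Re (r w) by have [] := rP w.
have pos w : N (w - 1) < 1 -> 0 < complex.Re (r w).
  move=> w1; rewrite lt_def rRe andbT; apply: contraTneq w1 => r0.
  have : complex.Re w <= 0.
    rewrite -(r2 w); move: r0; case: (r w) => a b /= ->.
    by rewrite mul0r sub0r oppr_le0 -expr2 sqr_ge0.
  rewrite -leNgt => w0.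
  have := Re_le_cabs (w - 1); rewrite raddfB /=; apply: le_trans.
  by rewrite -normrN opprB ler_normr; apply/orP; left; lra.
have r1 : r 1 = 1.
  have : (r 1 - 1) * (r 1 + 1) == 0.
    by have := r2 1; move: (r 1) => t E; apply/eqP; transitivity (t * t - 1); [ring|rewrite E subrr].
  rewrite mulf_eq0 subr_eq0 => /orP[/eqP //|]; rewrite addr_eq0 => /eqP E.
  by exfalso; have := rRe 1; rewrite E raddfN /= oppr_ge0 ler10.
have dr w : N (w - 1) < 1 -> cder r w (1 / (2 * r w)).
  move=> /pos a0; set a := complex.Re (r w) in a0.
  have ra : a <= N (r w) by apply: le_trans (Re_le_cabs _); exact: ler_norm.
  have rw0 : r w != 0 by rewrite -cabs_gt0 (lt_le_trans a0).
  (* With [t = r (w + h) + r w] the error is [h ^ 2 / (t ^ 2 * 2 r w)], and both [t] and [r w] have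
     modulus at least [a]. *)
  move=> e e0; exists (a ^+ 3 * e); first by rewrite mulr_gt0 // exprn_gt0.
  move=> h hh.
  have sa : a <= N (r (w + h) + r w).
    apply: le_trans (Re_le_cabs _); apply: le_trans (ler_norm _).
    by rewrite raddfD /= -/a lerDr.
  have sn0 : r (w + h) + r w != 0 by rewrite -cabs_gt0 (lt_le_trans a0).
  have E1 : (r (w + h) - r w) * (r (w + h) + r w) = h.
    have -> : (r (w + h) - r w) * (r (w + h) + r w) = r (w + h) * r (w + h) - r w * r w by ring.
    by rewrite !r2 addrC addKr.
  have E2 : r (w + h) - r w - 1 / (2 * r w) * h =
     - (h * (h / ((r (w + h) + r w) * (r (w + h) + r w) * (2 * r w)))).
    have Eq : r (w + h) - r w = h / (r (w + h) + r w).
      by apply: (mulIf sn0); rewrite E1 divfK.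
    have E3 : r (w + h) = h / (r (w + h) + r w) + r w by rewrite -Eq subrK.
    rewrite Eq.
    move: sn0 E3; set t := r (w + h) + r w => sn0 E3.
    have E4 : t = h / t + 2 * r w by rewrite {1}/t E3; ring.
    have E5 : 2 * r w = t - h / t by rewrite {1}E4; ring.
    have t0 : t * t - h != 0.
      have -> : t * t - h = t * (2 * r w) by rewrite E5; field.
      by rewrite !mulf_neq0 // pnatr_eq0.
    rewrite E5; field; rewrite sn0 t0 //.
  rewrite E2 cabsN cabsM mulrC ler_wpM2r ?cabs_ge0 //.
  rewrite cabsM cabsV !cabsM -[2]/((2%:R : C)) -(rmorph_nat (real_complex R)) cabsR normr_nat.
  have D0 : a * a * a <= N (r (w + h) + r w) * N (r (w + h) + r w) * (2 * N (r w)).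
    have a00 := ltW a0; apply: ler_pM; [by rewrite mulr_ge0|by []|by apply: ler_pM|].
    by apply: le_trans ra _; have := cabs_ge0 (r w); lra.
  have a3 : 0 < a * a * a by rewrite !mulr_gt0.
  rewrite ler_pdivrMr ?(lt_le_trans a3) //; apply: le_trans (ltW hh) _.
  rewrite mulrC; apply: ler_wpM2l; first exact: ltW.
  by apply: le_trans D0; rewrite le_eqVlt; apply/orP; left; apply/eqP; ring.
exists (fun z => s0 * r (z / z0)); split; first by rewrite divff // r1 mulr1.
apply/near_cabsP; exists (N z0); first by rewrite cabs_gt0.
move=> h hh; set z := z0 + h.
have z1 : N (z / z0 - 1) < 1.
  have -> : z / z0 - 1 = h / z0 by rewrite /z; field.
  by rewrite cabsM cabsV ltr_pdivrMr ?cabs_gt0 // mul1r.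
have rz := r2 (z / z0).
split; first by rewrite exprMn sz0 expr2 rz mulrC divfK.
have zz0 : z != 0.
  rewrite -cabs_gt0; have := cabs_lerB z0 (- h); rewrite opprK cabsN -/z; lra.
have dz := cderM (cder_id z) (cder_cst z0^-1 z).
have := cderZ s0 (cder_comp dz (dr _ z1)).
move=> /cder_val; apply; rewrite /id.
have rn0 : r (z / z0) != 0.
  by apply: contraNneq (mulf_neq0 zz0 (invr_neq0 z00)) => E; rewrite -rz E mul0r.
move: rz rn0; move: (r _) => t rz rn0.
have -> : z = t * t * z0 by rewrite rz divfK.
by field; rewrite z00 rn0.
Qed.

End LocalSquareRoot.

(* An entry [(i, t, c)] of a relation stands for [c] times [germ_fun t] of [U_i].
   The coefficients solve the linear equations that the symbols of the functions
   [germ_fun t] of the [U_i] impose on such a relation. *)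
Definition relations : seq (seq (nat * nat * int)) := [::
  [:: (2, 2, 1%Z); (2, 3, (-1)%Z); (4, 3, 2%Z); (5, 3, 1%Z); (8, 2, 1%Z); (8, 3, (-1)%Z)];
  [:: (2, 2, (-1)%Z); (2, 3, 1%Z); (5, 2, 1%Z); (5, 3, (-1)%Z); (7, 3, 2%Z); (8, 3, (-1)%Z)];
  [:: (0, 2, 2%Z); (2, 2, (-1)%Z); (5, 2, (-1)%Z)];
  [:: (5, 2, (-1)%Z); (6, 2, 2%Z); (8, 2, (-1)%Z)];
  [:: (2, 2, 1%Z); (2, 3, (-1)%Z); (3, 3, 2%Z); (5, 2, (-1)%Z); (5, 3, 1%Z); (8, 3, (-1)%Z)];
  [:: (2, 2, 1%Z); (4, 2, 2%Z); (8, 2, 1%Z)];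
  [:: (1, 3, 2%Z); (2, 2, 1%Z); (2, 3, (-1)%Z); (5, 3, (-1)%Z); (8, 2, (-1)%Z); (8, 3, 1%Z)];
  [:: (5, 2, 1%Z); (7, 2, 2%Z); (8, 2, (-1)%Z)];
  [:: (2, 2, 1%Z); (3, 2, 2%Z); (8, 2, (-1)%Z)];
  [:: (0, 3, 2%Z); (2, 3, (-1)%Z); (5, 3, (-1)%Z); (8, 3, 1%Z)];
  [:: (2, 3, 1%Z); (5, 3, (-1)%Z); (6, 3, 2%Z); (8, 3, (-1)%Z)];
  [:: (1, 2, 2%Z); (2, 2, 1%Z); (5, 2, (-1)%Z)];
  [:: (1, 0, 1%Z); (3, 0, 1%Z); (6, 0, 1%Z)];
  [:: (0, 0, 1%Z); (3, 1, (-1)%Z); (7, 1, (-1)%Z)];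
  [:: (1, 1, (-1)%Z); (4, 1, (-1)%Z); (7, 0, 1%Z)];
  [:: (0, 1, (-1)%Z); (4, 0, 1%Z); (6, 1, (-1)%Z)];
  [:: (0, 5, (-2)%Z); (2, 5, 1%Z); (4, 4, (-2)%Z); (4, 5, 2%Z); (5, 5, 1%Z); (6, 5, (-2)%Z); (8, 5, 1%Z)];
  [:: (5, 4, (-1)%Z); (6, 4, 2%Z); (7, 4, 2%Z); (8, 4, (-1)%Z)];
  [:: (0, 4, 2%Z); (1, 4, 2%Z); (2, 4, (-1)%Z); (5, 4, (-1)%Z)];
  [:: (0, 5, 2%Z); (1, 5, 2%Z); (2, 4, (-1)%Z); (4, 4, 2%Z); (5, 4, 1%Z); (5, 5, (-2)%Z); (6, 4, (-2)%Z); (6, 5, 2%Z); (7, 5, (-2)%Z)];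
  [:: (0, 6, 2%Z); (2, 6, (-1)%Z); (4, 4, 2%Z); (4, 6, (-2)%Z); (5, 6, (-1)%Z); (6, 6, 2%Z); (8, 6, (-1)%Z)];
  [:: (0, 5, (-2)%Z); (1, 4, (-2)%Z); (2, 5, 1%Z); (3, 5, 2%Z); (5, 5, 1%Z); (7, 5, 2%Z); (8, 5, (-1)%Z)];
  [:: (2, 4, (-1)%Z); (3, 4, 2%Z); (4, 4, 2%Z); (8, 4, (-1)%Z)];
  [:: (1, 4, (-1)%Z); (3, 6, 1%Z); (4, 4, 1%Z); (4, 6, (-1)%Z); (6, 6, 1%Z); (7, 6, 1%Z); (8, 6, (-1)%Z)];
  [:: (1, 6, 2%Z); (2, 4, (-1)%Z); (2, 6, 1%Z); (4, 6, 2%Z); (5, 4, 1%Z); (5, 6, (-1)%Z); (6, 4, (-2)%Z); (7, 6, (-2)%Z); (8, 6, 1%Z)];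
  [:: (0, 8, 2%Z); (1, 8, 2%Z); (2, 8, (-1)%Z); (3, 8, 2%Z); (4, 8, 2%Z); (5, 8, (-1)%Z); (6, 8, 2%Z); (7, 8, 2%Z); (8, 8, (-1)%Z)];
  [:: (0, 9, 2%Z); (1, 9, 2%Z); (2, 9, (-1)%Z); (3, 9, 2%Z); (4, 9, 2%Z); (5, 9, (-1)%Z); (6, 9, 2%Z); (7, 9, 2%Z); (8, 9, (-1)%Z)];
  [:: (2, 7, (-1)%Z); (5, 7, 1%Z); (8, 7, 1%Z)]]%N.
(* The function [germ_fun t] of [U_i] occurs only in the [k]-th relation if [(i, t)] is
   the [k]-th pivot. *)
Definition pivots : seq (nat * nat) := [:: (4, 3); (7, 3); (0, 2); (6, 2); (3, 3); (4, 2); (1, 3); (7, 2); (3, 2); (0, 3); (6, 3); (1, 2); (1, 0); (0, 0); (1, 1); (0, 1); (4, 5); (7, 4); (0, 4); (1, 5); (0, 6); (3, 5); (3, 4); (3, 6); (1, 6); (0, 8); (0, 9); (2, 7)]%N.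

Section Relations.
Variable R : realType.
Local Notation C := (Cplx R).
Local Notation N := (@cabs R).

(** Components of abelian relations, that is derivatives: types 0 and 1 of [z] and [- 1 / z], 2 and
    3 of logarithms, 4 to 6 of dilogarithms, 7 of twice the [arctanh] of a square root, 8 and 9 of
    trilogarithms. *)
Definition germ_fun (l0 l1 D S : C -> C) (t : nat) (z : C) : C :=
  match t with
  | 0 => 1
  | 1 => (z ^+ 2)^-1
  | 2 => z^-1
  | 3 => (z - 1)^-1
  | 4 => l0 z / z
  | 5 => l1 z / z
  | 6 => l0 z / (z - 1)
  | 7 => (S z * (1 - z))^-1
  | 8 => 2 * D z / z - l0 z ^+ 2 / (z - 1)
  | _ => (2 * D z - l0 z * l1 z) / z
  end.

(* The coefficient 1-form of [germ_fun t] of [U_i] when [lam], [Lam] are the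
   values of the [d log] and [log] of the letters and [Dv i] is that of [D] at [U_i]. *)
Definition symbol (lam Lam Dv : nat -> C) (i t : nat) : C :=
  match t with
  | 0 | 1 | 7 => 0
  | 2 => m0 i lam
  | 3 => m1 i lam
  | 4 => m0 i lam * m0 i Lam
  | 5 => m0 i lam * m1 i Lam
  | 6 => m1 i lam * m0 i Lam
  | 8 => 2 * Dv i * m0 i lam - m1 i lam * (m0 i Lam * m0 i Lam)
  | _ => m0 i lam * (2 * Dv i - m0 i Lam * m1 i Lam)
  end.

Definition unit_letter (l k : nat) : C := (k == l)%:R.

(** The symbol is linear in [lam]; this is the coefficient of [lam l] in relation [t]. In weight
    three it contains the dilogarithms [Dv], so its vanishing is not a polynomial identity in
    [Lam]. *)
Definition weight3_letter (Lam Dv : nat -> C) (t l : nat) : C :=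
  \sum_(e <- nth [::] relations t) e.2%:~R * symbol (unit_letter l) Lam Dv e.1.1 e.1.2.

(** Rows 25 and 26 are the trilogarithmic ones and follow by linearity in [lam]. The other rows
    concerned are polynomial identities in [lam] and [Lam]; the excluded ones contain rational
    functions or square roots. *)
Lemma symbol_relation (lam Lam Dv : nat -> C) k : (k < 28)%N ->
  k \notin [:: 12; 13; 14; 15; 27]%N ->
  (forall t l, t \in [:: 25; 26]%N -> (l < 6)%N -> weight3_letter Lam Dv t l = 0) ->
  \sum_(e <- nth [::] relations k) e.2%:~R * symbol lam Lam Dv e.1.1 e.1.2 = 0.
Proof.
move=> k28 kn w3.
have [/w3 {}w3|] := boolP (k \in [:: 25; 26]%N).
  transitivity (\sum_(l < 6) lam l * weight3_letter Lam Dv k l); last first.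
    by apply: big1 => l _; rewrite w3 ?mulr0.
  rewrite /weight3_letter; under [RHS]eq_bigr do rewrite mulr_sumr.
  rewrite [RHS]exchange_big /=; apply: eq_bigr => e _.
  rewrite !big_ord_recl big_ord0 /bump /= /symbol.
  case: e => -[i t] c /=.
  by case: t => [|[|[|[|[|[|[|[|[|t]]]]]]]]]; case: i => [|[|[|[|[|[|[|[|i]]]]]]]];
    rewrite /m0 /m1 /unit_letter /bump /=; ring.
move=> kn'; have [k0|] := boolP (k \in iota 0 12 ++ iota 16 9); last first.
  move: k28 kn kn'; do 28?[case: k => [|k] //].
move: k0; rewrite !inE.
by do 21?[case/orP]; move/eqP ->; rewrite /relations /= !big_cons big_nil /symbol /m0 /m1 /=; ring.
Qed.

End Relations.

Section RelationsHold.
Variable R : realType.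
Local Notation C := (Cplx R).
Local Notation N := (@cabs R).

(** The differential of a dilogarithm involves only logarithms and their differentials. So one
    differentiation eliminates [Dv], and what is left is a polynomial identity. *)
Lemma weight3_grad (Lam Dv : C * C -> nat -> C) (a b : nat -> C) q t l :
  (forall k, (k < 6)%N -> has_grad (fun q => Lam q k) q (a k) (b k)) ->
  (forall i, (i < 9)%N -> has_grad (fun q => Dv q i) q
     (m0 i a * m1 i (Lam q)) (m0 i b * m1 i (Lam q))) ->
  t \in [:: 25; 26]%N -> (l < 6)%N ->
  has_grad (fun q => weight3_letter (Lam q) (Dv q) t l) q 0 0.
Proof.
move=> hL hD.
have L0 := hL 0%N isT; have L1 := hL 1%N isT; have L2 := hL 2%N isT.
have L3 := hL 3%N isT; have L4 := hL 4%N isT; have L5 := hL 5%N isT.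
have D0 := hD 0%N isT; have D1 := hD 1%N isT; have D2 := hD 2%N isT.
have D3 := hD 3%N isT; have D4 := hD 4%N isT; have D5 := hD 5%N isT.
have D6 := hD 6%N isT; have D7 := hD 7%N isT; have D8 := hD 8%N isT.
rewrite !inE => /orP[] /eqP -> l6.
all: case: l l6 => [|[|[|[|[|[|l]]]]]] l6; last by [].
all: under eq_fun do rewrite /weight3_letter.
all: under eq_fun do rewrite /relations /=.
all: under eq_fun do rewrite !big_cons big_nil /=.
all: under eq_fun do rewrite /symbol /m0 /m1 /unit_letter /=.
all: apply: has_grad_eq; last by hgrad.
all: rewrite /m0 /m1; ring.
Qed.

Lemma m0_grad (Lam : C * C -> nat -> C) (a b : nat -> C) q i :
  (forall k, (k < 6)%N -> has_grad (fun q => Lam q k) q (a k) (b k)) ->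
  has_grad (fun q => m0 i (Lam q)) q (m0 i a) (m0 i b).
Proof.
move=> hL.
have L0 := hL 0%N isT; have L1 := hL 1%N isT; have L2 := hL 2%N isT.
have L3 := hL 3%N isT; have L4 := hL 4%N isT; have L5 := hL 5%N isT.
case: i => [|[|[|[|[|[|[|[|i]]]]]]]]; rewrite /m0.
all: apply: has_grad_eq; last by hgrad.
all: by ring.
Qed.

Lemma m1_grad (Lam : C * C -> nat -> C) (a b : nat -> C) q i :
  (forall k, (k < 6)%N -> has_grad (fun q => Lam q k) q (a k) (b k)) ->
  has_grad (fun q => m1 i (Lam q)) q (m1 i a) (m1 i b).
Proof.
move=> hL.
have L0 := hL 0%N isT; have L1 := hL 1%N isT; have L2 := hL 2%N isT.
have L3 := hL 3%N isT; have L4 := hL 4%N isT; have L5 := hL 5%N isT.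
case: i => [|[|[|[|[|[|[|[|i]]]]]]]]; rewrite /m1.
all: apply: has_grad_eq; last by hgrad.
all: by ring.
Qed.

End RelationsHold.

Lemma relations_entries k : (k < 28)%N -> {in nth [::] relations k, forall e,
  (e.1.1 < 9)%N /\
  (k \notin [:: 12; 13; 14; 15; 27]%N -> e.1.2 \in [:: 2; 3; 4; 5; 6; 8; 9]%N)}.
Proof.
move=> k28 e ek.
have H : all (fun k => all (fun e => (e.1.1 < 9)%N &&
   ((k \notin [:: 12; 13; 14; 15; 27]%N) ==> (e.1.2 \in [:: 2; 3; 4; 5; 6; 8; 9]%N)))
   (nth [::] relations k)) (iota 0 28) by [].
have kI : k \in iota 0 28 by rewrite mem_iota.
by have /andP[h /implyP h'] := allP (allP H k kI) e ek.
Qed.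

Section LocalRelations.
Variable R : realType.
Local Notation C := (Cplx R).
Local Notation N := (@cabs R).

Lemma near_comp (f : C * C -> C) p a b (P : C -> Prop) : has_grad f p a b ->
  (\forall z \near f p, P z) -> \forall q \near p, P (f q).
Proof. by move=> /has_grad_diff /differentiable_continuous fc; exact: fc. Qed.

Lemma grad_diff0 (f g : C * C -> C) p : f p = g p ->
  (\forall q \near p, exists a b, has_grad f q a b /\ has_grad g q a b) ->
  \forall q \near p, f q = g q.
Proof.
move=> fg h.
have : \forall q \near p, (fun q => f q - g q) q = (fun q => f q - g q) p.
  apply: has_grad0_const; apply: filterS h => q [a [b [hf hg]]].
  by have := has_gradB hf hg; rewrite !subrr.
apply: filterS => q /=; rewrite fg subrr => /eqP.
by rewrite subr_eq0 => /eqP.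
Qed.

Variables (p : C * C) (l0 l1 D : nat -> C -> C).
Hypothesis gp : good p.
Hypothesis germs : forall i, (i < 9)%N -> polylog_germs (sk i p) (l0 i) (l1 i) (D i).

Lemma germs_grad i : (i < 9)%N -> \forall q \near p,
  [/\ has_grad (fun q => l0 i (sk i q)) q (m0 i (dlog_letter q (1, 0))) (m0 i (dlog_letter q (0, 1))),
      has_grad (fun q => l1 i (sk i q)) q (m1 i (dlog_letter q (1, 0))) (m1 i (dlog_letter q (0, 1)))
    & has_grad (fun q => D i (sk i q)) q (m0 i (dlog_letter q (1, 0)) * l1 i (sk i q))
        (m0 i (dlog_letter q (0, 1)) * l1 i (sk i q))].
Proof.
move=> i9; have [_ [d0 d1 dD]] := germs i9.
have nc (P : C -> Prop) : (\forall z \near sk i p, P z) -> \forall q \near p, P (sk i q).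
  exact: (near_comp (sk_grad i9 gp)).
near=> q.
have gq : good q by near: q; exact: near_good.
have c0 : cder (l0 i) (sk i q) (sk i q)^-1 by near: q; exact: (nc _ d0).
have c1 : cder (l1 i) (sk i q) (sk i q - 1)^-1 by near: q; exact: (nc _ d1).
have cD : cder (D i) (sk i q) (l1 i (sk i q) / sk i q) by near: q; exact: (nc _ dD).
have n0 := sk_neq0 i9 gq; have n1 := sk_neq1 i9 gq.
have gr := sk_grad i9 gq.
split.
- apply: has_grad_eq (has_grad_comp gr c0); by rewrite mulKf.
- apply: has_grad_eq (has_grad_comp gr c1); by rewrite sk_m1 // mulKf.
- apply: has_grad_eq (has_grad_comp gr cD); by field.
Unshelve. all: by end_near.
Qed.

Lemma letter_logs : exists Lam : C * C -> nat -> C,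
  (forall l, (l < 6)%N -> Lam p l = 0) /\
  \forall q \near p, forall l, (l < 6)%N ->
    has_grad (fun q => Lam q l) q (dlog_letter q (1, 0) l) (dlog_letter q (0, 1) l).
Proof.
have [LL LP] : {LL : nat -> C -> C & forall l, (l < 6)%N -> LL l (letter l p) = 0 /\
    \forall z \near letter l p, cder (LL l) z z^-1}.
  apply: (@choice _ _ (fun l (f : C -> C) => (l < 6)%N -> f (letter l p) = 0 /\
    \forall z \near letter l p, cder f z z^-1)) => l.
  have [l6|l6] := boolP (l < 6)%N; last by exists (fun=> 0).
  have h : \forall z \near letter l p, differentiable (fun z : C => z^-1) z.
    apply: filterS (near_neqC (gp l6)) => z zn.
    exact: cder_diff (cderV (f := id) zn (cder_id z)).
  by have [f f0 df] := local_primitive h; exists f.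
exists (fun q l => LL l (letter l q)); split; first by move=> l /LP[].
have H l : (l < 6)%N -> \forall q \near p, has_grad (fun q => LL l (letter l q)) q
   (dlog_letter q (1, 0) l) (dlog_letter q (0, 1) l).
  move=> l6; have [_ d] := LP l l6.
  have := near_comp (letter_grad l p) d; apply: filterS => q c.
  apply: has_grad_eq (has_grad_comp (letter_grad l q) c); by rewrite mulrC.
near=> q => -[|[|[|[|[|[|l]]]]]] //= _.
- by near: q; exact: (H 0%N).
- by near: q; exact: (H 1%N).
- by near: q; exact: (H 2%N).
- by near: q; exact: (H 3%N).
- by near: q; exact: (H 4%N).
- by near: q; exact: (H 5%N).
Unshelve. all: by end_near.
Qed.

Lemma near_all9 (P : nat -> C * C -> Prop) : (forall i, (i < 9)%N -> \forall q \near p, P i q) ->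
  \forall q \near p, forall i, (i < 9)%N -> P i q.
Proof.
move=> H; near=> q => -[|[|[|[|[|[|[|[|[|l]]]]]]]]] //= _.
- by near: q; exact: (H 0%N).
- by near: q; exact: (H 1%N).
- by near: q; exact: (H 2%N).
- by near: q; exact: (H 3%N).
- by near: q; exact: (H 4%N).
- by near: q; exact: (H 5%N).
- by near: q; exact: (H 6%N).
- by near: q; exact: (H 7%N).
- by near: q; exact: (H 8%N).
Unshelve. all: by end_near.
Qed.

Lemma polylog_relations k (S : nat -> C -> C) : (k < 28)%N -> k \notin [:: 12; 13; 14; 15; 27]%N ->
  \forall q \near p, forall v, \sum_(e <- nth [::] relations k) e.2%:~R *
    (germ_fun (l0 e.1.1) (l1 e.1.1) (D e.1.1) (S e.1.1) e.1.2 (sk e.1.1 q) * 'd (sk e.1.1) q v) = 0.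
Proof.
move=> k28 kn.
have [Lam [Lam0 dLam]] := letter_logs.
have G := near_all9 germs_grad.
(* Both sides vanish at [p] and have the same gradient, so no multiple of [2 pi i] intervenes. *)
have F0 i : (i < 9)%N -> \forall q \near p, l0 i (sk i q) = m0 i (Lam q).
  move=> i9; apply: grad_diff0.
    have [[-> _ _] _] := germs i9.
    by case: (i) => [|[|[|[|[|[|[|[|?]]]]]]]]; rewrite /m0 !Lam0 //; ring.
  apply: filterS2 G dLam => q Gq dq; have [h _ _] := Gq i i9.
  by do 2 eexists; split; [exact: h|exact: m0_grad].
have F1 i : (i < 9)%N -> \forall q \near p, l1 i (sk i q) = m1 i (Lam q).
  move=> i9; apply: grad_diff0.
    have [[_ -> _] _] := germs i9.
    by case: (i) => [|[|[|[|[|[|[|[|?]]]]]]]]; rewrite /m1 !Lam0 //; ring.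
  apply: filterS2 G dLam => q Gq dq; have [_ h _] := Gq i i9.
  by do 2 eexists; split; [exact: h|exact: m1_grad].
have F0a := near_all9 F0; have F1a := near_all9 F1.
pose Dv (q : C * C) i := D i (sk i q).
(* At [p] all logarithms and dilogarithms are 0, hence so is this coefficient; it is constant near
   [p] by [weight3_grad]. *)
have W t l : t \in [:: 25; 26]%N -> (l < 6)%N ->
    \forall q \near p, weight3_letter (Lam q) (Dv q) t l = 0.
  move=> ht l6.
  have Z : weight3_letter (Lam p) (Dv p) t l = 0.
    have Dv0 i : (i < 9)%N -> Dv p i = 0 by move=> /germs[[_ _ h] _].
    have m0L i : m0 i (Lam p) = 0.
      by case: i => [|[|[|[|[|[|[|[|?]]]]]]]]; rewrite /m0 !Lam0 //; ring.
    have m1L i : m1 i (Lam p) = 0.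
      by case: i => [|[|[|[|[|[|[|[|?]]]]]]]]; rewrite /m1 !Lam0 //; ring.
    rewrite /weight3_letter big1_seq // => e /= et.
    have t28 : (t < 28)%N by move: ht; rewrite !inE => /orP[] /eqP ->.
    have tn : t \notin [:: 12; 13; 14; 15; 27]%N by move: ht; rewrite !inE => /orP[] /eqP ->.
    have [e9 /(_ tn) e2] := relations_entries t28 et.
    have e89 : e.1.2 \in [:: 8; 9]%N.
      move: et; move: ht; rewrite !inE => /orP[] /eqP ->;
        by rewrite /relations /= !inE; do 8?[case/orP => [/eqP -> //|]]; move/eqP ->.
    move: e89; rewrite !inE => /orP[] /eqP ->; rewrite /symbol Dv0 // m0L ?m1L; ring.
  rewrite -Z; apply: (@has_grad0_const R (fun q => weight3_letter (Lam q) (Dv q) t l)).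
  apply: filterS3 G dLam F1a => q Gq dq f1.
  apply: weight3_grad ht l6; first exact: dq.
  by move=> i i9; have [_ _ h] := Gq i i9; rewrite -(f1 i i9); exact: h.
have Wt t : t \in [:: 25; 26]%N -> \forall q \near p, forall l, (l < 9)%N ->
    (l < 6)%N -> weight3_letter (Lam q) (Dv q) t l = 0.
  move=> ht; apply: near_all9 => l _; have [l6|l6] := boolP (l < 6)%N; last first.
    by apply: filterS dLam => q _.
  by apply: filterS (W t l ht l6) => q h _.
near=> q => v.
have gq : good q by near: q; exact: near_good.
have f0 : forall i, (i < 9)%N -> l0 i (sk i q) = m0 i (Lam q) by near: q.
have f1 : forall i, (i < 9)%N -> l1 i (sk i q) = m1 i (Lam q) by near: q.
have w3 t l : t \in [:: 25; 26]%N -> (l < 6)%N -> weight3_letter (Lam q) (Dv q) t l = 0.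
  have w25 : forall l, (l < 9)%N -> (l < 6)%N -> weight3_letter (Lam q) (Dv q) 25 l = 0.
    by near: q; exact: Wt.
  have w26 : forall l, (l < 9)%N -> (l < 6)%N -> weight3_letter (Lam q) (Dv q) 26 l = 0.
    by near: q; exact: Wt.
  rewrite !inE => /orP[] /eqP -> l6; [apply: w25|apply: w26] => //; exact: (ltn_trans l6).
rewrite -[RHS](symbol_relation (dlog_letter q v) k28 kn w3).
apply: eq_big_seq => e ek; congr (_ * _).
have [i9 /(_ kn)] := relations_entries k28 ek.
case: e {ek} i9 => -[i t] c /= i9 ht.
have n0 := sk_neq0 i9 gq; have n1 := sk_neq1 i9 gq.
rewrite sk_diff //.
have E1 := sk_m1 v i9 gq.
have Es : sk i q * m0 i (dlog_letter q v) / (sk i q - 1) = m1 i (dlog_letter q v).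
  by rewrite E1 mulrAC divff // mul1r.
move: ht; rewrite !inE; do 6?[case/orP]; move/eqP ->; rewrite /germ_fun /symbol -?(f0 i i9) -?(f1 i i9) -?Es.
all: rewrite /Dv; move: n0 n1; move: (sk i q) (m0 i (dlog_letter q v)) => u m n0 n1.
all: try move: (l0 i u) => a0; try move: (l1 i u) => a1; try move: (D i u) => a2.
all: by field; rewrite ?n0 ?n1.
Unshelve. all: by end_near.
Qed.

End LocalRelations.

(** * The rational relations and the [arctanh] relation *)

Section OtherRelations.
Variable R : realType.
Local Notation C := (Cplx R).
Local Notation N := (@cabs R).

Lemma relation_terms (q v : C * C) k (l0 l1 D S : nat -> C -> C) : good q -> (k < 28)%N ->
  \sum_(e <- nth [::] relations k) e.2%:~R *
    (germ_fun (l0 e.1.1) (l1 e.1.1) (D e.1.1) (S e.1.1) e.1.2 (sk e.1.1 q) * 'd (sk e.1.1) q v) =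
  \sum_(e <- nth [::] relations k) e.2%:~R *
    (germ_fun (l0 e.1.1) (l1 e.1.1) (D e.1.1) (S e.1.1) e.1.2 (sk_formula e.1.1 q) *
     (sk_formula e.1.1 q * m0 e.1.1 (dlog_letter q v))).
Proof.
move=> gq k28; apply: eq_big_seq => e ek; have [i9 _] := relations_entries k28 ek.
by rewrite sk_diff // skE.
Qed.

Lemma rational_relations (p : C * C) k (l0 l1 D S : nat -> C -> C) : good p ->
  k \in [:: 12; 13; 14; 15]%N ->
  \forall q \near p, forall v, \sum_(e <- nth [::] relations k) e.2%:~R *
    (germ_fun (l0 e.1.1) (l1 e.1.1) (D e.1.1) (S e.1.1) e.1.2 (sk e.1.1 q) * 'd (sk e.1.1) q v) = 0.
Proof.
move=> gp hk; apply: filterS (near_good gp) => q gq v.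
have [[g0 g1 g2 g3 g4] g5 g6 g7] := goodP gq.
rewrite relation_terms //; last by move: hk; rewrite !inE; do 3?[case/orP]; move/eqP ->.
move: hk; rewrite !inE; do 3?[case/orP]; move/eqP ->.
all: rewrite /relations [nth _ _ _]/= !big_cons big_nil; cbn [fst snd]; rewrite /germ_fun.
all: rewrite /sk_formula /m0 /dlog_letter /dletter /letter; cbn beta match.
all: by field; rewrite ?g0 ?g1 ?g2 ?g3 ?g6.
Qed.

(** The signs of the three square roots must match. As [U_3 U_6 = x ^ 2] and [U_9 / U_3] is the
    square of [(1 - y) / (1 - x)], the root of [U_3] at [p] determines those chosen for [U_6] and
    [U_9]. *)
Lemma arctanh_relation (p : C * C) : good p ->
  exists S : nat -> C -> C,
  (forall i, (i < 9)%N -> \forall z \near sk i p, S i z != 0 /\ differentiable (S i) z) /\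
  forall l0 l1 D : nat -> C -> C,
  \forall q \near p, forall v, \sum_(e <- nth [::] relations 27) e.2%:~R *
    (germ_fun (l0 e.1.1) (l1 e.1.1) (D e.1.1) (S e.1.1) e.1.2 (sk e.1.1 q) * 'd (sk e.1.1) q v) = 0.
Proof.
move=> gp.
have [[g0 g1 g2 g3 g4] g5 g6 g7] := goodP gp.
have u0 i : (i < 9)%N -> sk i p != 0 by move=> i9; exact: sk_neq0.
pose s2 := sqrtC (sk 2 p).
have s2E : s2 ^+ 2 = sk 2 p by exact: sqrtCK.
have s20 : s2 != 0 by rewrite sqrtC_eq0 u0.
have [S2 [S2p dS2]] := local_sqrt s20 s2E.
pose s5 := p.1 / s2.
have s5E : s5 ^+ 2 = sk 5 p.
  rewrite /s5 expr_div_n s2E !skE // /sk_formula; field; by rewrite g0 g1.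
have s50 : s5 != 0 by rewrite mulf_neq0 ?invr_neq0.
have [S5 [S5p dS5]] := local_sqrt s50 s5E.
pose s8 := s2 * (1 - p.2) / (1 - p.1).
have s8E : s8 ^+ 2 = sk 8 p.
  rewrite /s8 expr_div_n exprMn s2E !skE // /sk_formula; field; by rewrite g1 g2.
have s80 : s8 != 0 by rewrite !mulf_neq0 ?invr_neq0.
have [S8 [S8p dS8]] := local_sqrt s80 s8E.
(* The value 1 at the other indices is nonzero and differentiable, as the conclusion asks for all
   [i]. *)
pose Sf (i : nat) : C -> C := match i with 2 => S2 | 5 => S5 | 8 => S8 | _ => fun=> 1 end.
exists Sf.
have nzd i (S : C -> C) : (i < 9)%N ->
   (\forall z \near sk i p, S z ^+ 2 = z /\ cder S z (S z / (2 * z))) ->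
   \forall z \near sk i p, S z != 0 /\ differentiable S z.
  move=> i9 h; apply: filterS2 h (near_neqC (u0 i i9)) => z [Sz dz] zn; split.
    by apply: contraNneq zn => E; rewrite -Sz E expr0n.
  exact: cder_diff dz.
split.
  have one z0 : \forall z \near (z0 : C), (1 : C) != 0 /\ differentiable (fun=> 1 : C) z.
    by apply: filterE => z; split; [exact: oner_neq0|exact: cder_diff (cder_cst 1 z)].
  case=> [|[|[|[|[|[|[|[|[|i]]]]]]]]] i9; last by exfalso.
  all: rewrite /Sf; cbn beta match.
  - exact: (one (sk 0 p)).
  - exact: (one (sk 1 p)).
  - exact: (nzd 2%N _ isT dS2).
  - exact: (one (sk 3 p)).
  - exact: (one (sk 4 p)).
  - exact: (nzd 5%N _ isT dS5).
  - exact: (one (sk 6 p)).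
  - exact: (one (sk 7 p)).
  - exact: (nzd 8%N _ isT dS8).
move=> l0 l1 D.
have pull i (S : C -> C) : (i < 9)%N ->
   (\forall z \near sk i p, S z ^+ 2 = z /\ cder S z (S z / (2 * z))) ->
   \forall q \near p, S (sk i q) ^+ 2 = sk i q /\
     has_grad (fun q => S (sk i q)) q
       (S (sk i q) / 2 * m0 i (dlog_letter q (1, 0))) (S (sk i q) / 2 * m0 i (dlog_letter q (0, 1))).
  move=> i9 h; have gr := sk_grad i9 gp.
  apply: filterS2 (near_good gp) (near_comp gr h) => q gq [Sq dq]; split => //.
  have n0 := sk_neq0 i9 gq.
  by apply: has_grad_eq (has_grad_comp (sk_grad i9 gq) dq); field.
have h2 := pull 2%N S2 isT dS2; have h5 := pull 5%N S5 isT dS5; have h8 := pull 8%N S8 isT dS8.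
(* The compatibility of the roots holds at [p] by the choice of [s5], and the gradient of the left
   side is 0. *)
have E5 : \forall q \near p, S2 (sk 2 q) * S5 (sk 5 q) / q.1 = 1.
  have -> : (1 : C) = S2 (sk 2 p) * S5 (sk 5 p) / p.1.
    by rewrite S2p S5p /s5; field; rewrite g0 s20.
  apply: (@has_grad0_const R (fun q => S2 (sk 2 q) * S5 (sk 5 q) / q.1)).
  apply: filterS3 (near_good gp) h2 h5 => q gq [_ k2] [_ k5].
  have [[q0 q1 q2 q3 q4] q5 q6 q7] := goodP gq.
  apply: has_grad_eq (has_grad_div q0 (has_gradM k2 k5) (has_grad_fst q)).
    by rewrite /m0 /dlog_letter /dletter /letter /=; field; rewrite q0 q1.
  by rewrite /m0 /dlog_letter /dletter /letter /=; field; rewrite q0 q1.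
have E8 : \forall q \near p, S2 (sk 2 q) * (1 - q.2) / (S8 (sk 8 q) * (1 - q.1)) = 1.
  have F8p : S2 (sk 2 p) * (1 - p.2) / (S8 (sk 8 p) * (1 - p.1)) = 1.
    by rewrite S2p S8p /s8; field; rewrite g2 g3 s20.
  suff H : \forall q \near p, S2 (sk 2 q) * (1 - q.2) / (S8 (sk 8 q) * (1 - q.1)) =
      S2 (sk 2 p) * (1 - p.2) / (S8 (sk 8 p) * (1 - p.1)).
    by apply: filterS H => q ->.
  apply: (@has_grad0_const R (fun q => S2 (sk 2 q) * (1 - q.2) / (S8 (sk 8 q) * (1 - q.1)))).
  apply: filterS3 (near_good gp) h2 h8 => q gq [_ k2] [e8 k8].
  have [[q0 q1 q2 q3 q4] q5 q6 q7] := goodP gq.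
  have S80 : S8 (sk 8 q) != 0.
    by apply: contraNneq (sk_neq0 (isT : (8 < 9)%N) gq) => E; rewrite -e8 E expr0n.
  have S8n : S8 (sk 8 q) * (1 - q.1) != 0 by rewrite mulf_neq0.
  have c1 := has_gradB (has_grad_cst 1 q) (has_grad_fst q).
  have c2 := has_gradB (has_grad_cst 1 q) (has_grad_snd q).
  apply: has_grad_eq (has_grad_div S8n (has_gradM k2 c2) (has_gradM k8 c1)).
    by rewrite /m0 /dlog_letter /dletter /letter /=; field; rewrite q0 q2 q3 q1 S80.
  by rewrite /m0 /dlog_letter /dletter /letter /=; field; rewrite q1 q2 q3 q0 S80.
near=> q => v.
have gq : good q by near: q; exact: near_good.
have [[q0 q1 q2 q3 q4] q5 q6 q7] := goodP gq.
have e5 : S2 (sk 2 q) * S5 (sk 5 q) / q.1 = 1 by near: q.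
have e8 : S2 (sk 2 q) * (1 - q.2) / (S8 (sk 8 q) * (1 - q.1)) = 1 by near: q.
have e2 : S2 (sk 2 q) ^+ 2 = sk 2 q by have [] : S2 (sk 2 q) ^+ 2 = sk 2 q /\ has_grad (fun q => S2 (sk 2 q)) q (S2 (sk 2 q) / 2 * m0 2 (dlog_letter q (1, 0))) (S2 (sk 2 q) / 2 * m0 2 (dlog_letter q (0, 1))) by near: q.
rewrite (@relation_terms q v 27 l0 l1 D Sf gq isT) /relations [nth _ _ _]/= !big_cons big_nil; cbn [fst snd].
rewrite /Sf /germ_fun /sk_formula; cbn beta match.
have T0 : S2 (sk 2 q) != 0.
  by apply: contraNneq (sk_neq0 (isT : (2 < 9)%N) gq) => E; rewrite -e2 E expr0n.
have S8n : S8 (sk 8 q) != 0.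
  by apply: contra_eq_neq e8 => ->; rewrite mul0r invr0 mulr0 eq_sym oner_neq0.
have n2 := sk_neq1 (isT : (2 < 9)%N) gq.
have n5 := sk_neq1 (isT : (5 < 9)%N) gq.
have n8 := sk_neq1 (isT : (8 < 9)%N) gq.
move: e2 e5 e8 T0 S8n n2 n5 n8; rewrite !skE // /sk_formula.
move: (S2 _) (S5 _) (S8 _) => T2 T5 T8 e2 e5 e8 T0 S8n n2 n5 n8.
have {e5}T5E : T5 = q.1 / T2.
  by apply: (mulfI T0); rewrite mulrCA divff // mulr1 -[RHS]mul1r -e5 divfK.
have {e8}T8E : T8 = T2 * (1 - q.2) / (1 - q.1).
  apply: (mulIf q2); rewrite divfK //; move/(congr1 (fun z => z * (T8 * (1 - q.1)))): e8.
  by rewrite divfK ?mulf_neq0 // mul1r.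
(* With [x] and the other two roots expressed by [T2] and [y], the relation becomes an identity of
   rational functions. *)
have XE : q.1 = T2 ^+ 2 * q.2 by rewrite e2 divfK.
have n58 : 1 - q.1 * q.2 != 0 by [].
rewrite T5E T8E /m0 /dlog_letter /dletter /letter; cbn beta match.
clear T5E T8E e2 S8n n2 n5 n8 gq n58.
move: (q.1) (q.2) (v.1) (v.2) XE q0 q1 q2 q3 q4 q5 q6 q7 => X Y V1 V2 XE q0 q1 q2 q3 q4 q5 q6 q7.
subst X.
field.
have a1 : 1 - T2 ^+ 2 != 0.
  by apply: contraNneq q4 => E; rewrite -[X in _ - X]mul1r -mulrBl -opprB E oppr0 mul0r.
(* The numerator of [1 - U_9]: it factors into those of [1 - U_3] and [1 - U_6]. *)
have big : (1 - T2 ^+ 2 * Y) * (1 - T2 ^+ 2 * Y) - T2 ^+ 2 * ((1 - Y) * (1 - Y)) != 0.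
  rewrite (_ : _ - _ = (1 - T2 ^+ 2) * (1 - T2 ^+ 2 * Y * Y)); last by ring.
  by rewrite mulf_neq0.
by rewrite a1 q5 big T0 q1 q2 q3.
Unshelve. all: by end_near.
Qed.

End OtherRelations.

(** * Linear independence of the 28 relations *)

Definition coef (k i t : nat) : int :=
  foldr (fun e s => e.2 + s) 0 [seq e <- nth [::] relations k | e.1 == (i, t)].
Lemma relations_types k : (k < 28)%N -> {in nth [::] relations k, forall e, (e.1.2 < 10)%N}.
Proof.
move=> k28 e ek.
have H : all (fun k => all (fun e => (e.1.2 < 10)%N) (nth [::] relations k)) (iota 0 28) by [].
have kI : k \in iota 0 28 by rewrite mem_iota.
exact: (allP (allP H k kI) e ek).
Qed.
(** Row 27 is left out as its pivot is the square root function, which [germ_independence] does not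
    cover. The other pivots lie on indices [i] where no square root occurs. *)
Lemma pivotsP k : (k < 27)%N -> let: (i, t) := nth (0, 0)%N pivots k in
  [/\ i \in [:: 0; 1; 3; 4; 6; 7]%N, t \in [:: 0; 1; 2; 3; 4; 5; 6; 8; 9]%N, coef k i t != 0
    & forall k', (k' < 28)%N -> k' != k -> coef k' i t = 0].
Proof.
move=> k27.
have H : all (fun k => let: (i, t) := nth (0, 0)%N pivots k in
  [&& i \in [:: 0; 1; 3; 4; 6; 7]%N, t \in [:: 0; 1; 2; 3; 4; 5; 6; 8; 9]%N, coef k i t != 0
    & all (fun k' => (k' == k) || (coef k' i t == 0)) (iota 0 28)]) (iota 0 27) by vm_compute.
have kI : k \in iota 0 27 by rewrite mem_iota.
have := allP H k kI; case: (nth _ _ k) => i t /and4P[h1 h2 h3 h4]; split => // k' k'28 /negbTE kk.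
have kI' : k' \in iota 0 28 by rewrite mem_iota.
by have := allP h4 k' kI'; rewrite kk => /eqP.
Qed.
Lemma coef7 k i : i \in [:: 0; 1; 3; 4; 6; 7]%N -> (k < 28)%N -> coef k i 7 = 0.
Proof.
move=> hi k28.
have H : all (fun k => all (fun i => coef k i 7 == 0) [:: 0; 1; 3; 4; 6; 7]%N) (iota 0 28) by vm_compute.
have kI : k \in iota 0 28 by rewrite mem_iota.
by have /eqP := allP (allP H k kI) i hi.
Qed.

Section Basis.
Variable R : realType.
Local Notation C := (Cplx R).
Local Notation N := (@cabs R).

Lemma germ_fun_differentiable (z0 : C) (l0 l1 D S : C -> C) : z0 != 0 -> z0 != 1 ->
  polylog_germs z0 l0 l1 D -> (\forall z \near z0, S z != 0 /\ differentiable (S : C -> C) z) ->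
  \forall z \near z0, forall t, differentiable (germ_fun l0 l1 D S t : C -> C) z.
Proof.
move=> z00 z01 [_ [d0 d1 dD]] dS.
near=> z.
have n0 : z != 0 by near: z; exact: near_neqC.
have n1 : z != 1 by near: z; exact: near_neqC.
have m1 : z - 1 != 0 by rewrite subr_eq0.
have m2 : 1 - z != 0 by rewrite subr_eq0 eq_sym.
have c0 : cder l0 z z^-1 by near: z.
have c1 : cder l1 z (z - 1)^-1 by near: z.
have cD : cder D z (l1 z / z) by near: z.
have [Sz dSz] : S z != 0 /\ differentiable (S : C -> C) z by near: z.
have cS := diff_cder dSz.
have ci : cder (fun z : C => z) z 1 := cder_id z.
have cm : cder (fun z : C => z - 1) z (1 - 0) := cderB ci (cder_cst 1 z).
have cm' : cder (fun z : C => 1 - z) z (0 - 1) := cderB (cder_cst 1 z) ci.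
have zX : z ^+ 2 != 0 by rewrite expf_neq0.
have sn : S z * (1 - z) != 0 by rewrite mulf_neq0.
case=> [|[|[|[|[|[|[|[|[|t]]]]]]]]].
all: rewrite /germ_fun; cbn beta match.
- exact: cder_diff (cder_cst 1 z).
- exact: cder_diff (cderV (f := fun z : C => z ^+ 2) zX (cderX (f := fun z : C => z) 2 ci)).
- exact: cder_diff (cderV (f := fun z : C => z) n0 ci).
- exact: cder_diff (cderV (f := fun z : C => z - 1) m1 cm).
- exact: cder_diff (cder_div n0 c0 ci).
- exact: cder_diff (cder_div n0 c1 ci).
- exact: cder_diff (cder_div (g := fun z : C => z - 1) m1 c0 cm).
- exact: cder_diff (cderV (f := fun z : C => S z * (1 - z)) sn (cderM cS cm')).
- exact: cder_diff (cderB (cder_div n0 (cderZ 2 cD) ci) (cder_div (g := fun z : C => z - 1) m1 (cderX (f := l0) 2 c0) cm)).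
- exact: cder_diff (cder_div n0 (cderB (cderZ 2 cD) (cderM c0 c1)) ci).
Unshelve. all: by end_near.
Qed.

Definition row_fun (l0 l1 D S : C -> C) (k i : nat) (z : C) : C :=
  \sum_(e <- nth [::] relations k | e.1.1 == i) e.2%:~R * germ_fun l0 l1 D S e.1.2 z.

Lemma row_funE (l0 l1 D S : C -> C) k i z : (k < 28)%N ->
  row_fun l0 l1 D S k i z = \sum_(t < 10) (coef k i t)%:~R * germ_fun l0 l1 D S t z.
Proof.
move=> /relations_types; rewrite /row_fun /coef.
elim: (nth _ _ _) => [|[[j t] c] s IH] H.
  by rewrite big_nil big1 // => t _; rewrite mul0r.
have {}IH := IH (fun e es => H e (@mem_behead _ (_ :: _) e es)).
have /= t10 := H _ (mem_head _ _).
rewrite big_cons IH /=; have [->|ji] := eqVneq j i; last first.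
  by apply: eq_bigr => t' _; rewrite xpair_eqE (negbTE ji).
rewrite (bigD1 (Ordinal t10)) //= [RHS](bigD1 (Ordinal t10)) //= eqxx /= rmorphD /= mulrDl addrA.
congr (_ + _); apply: eq_bigr => t' tt'.
rewrite xpair_eqE eqxx /= (_ : (t == t') = false) //.
by apply: contraNF tt' => /eqP h; apply/eqP/val_inj.
Qed.

(** At the pivot of row [k], the coefficient of [germ_fun t] of [U_i] is a nonzero multiple of
    [c k], and [germ_independence] makes it 0. *)
Lemma relations_independent (z0 : nat -> C) (l0 l1 D S : nat -> C -> C) (c : 'I_28 -> C) :
  (forall i, (i < 9)%N -> z0 i != 0 /\ z0 i != 1) ->
  (forall i, (i < 9)%N -> polylog_germs (z0 i) (l0 i) (l1 i) (D i)) ->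
  (forall i, (i < 9)%N -> \forall z \near z0 i, S i z != 0 /\ differentiable (S i) z) ->
  (forall i, (i < 9)%N ->
     \forall z \near z0 i, \sum_(k < 28) c k * row_fun (l0 i) (l1 i) (D i) (S i) k i z = 0) ->
  forall k, c k = 0.
Proof.
move=> z01 lP SP H.
have c27 (k : 'I_28) : (k < 27)%N -> c k = 0.
  move=> k27; have := pivotsP k27; case E : (nth _ _ _) => [i t] [hi ht h0 hk].
  have i9 : (i < 9)%N by move: hi; rewrite !inE; do 5?[case/orP]; move/eqP ->.
  pose d t' := \sum_(k < 28) c k * (coef k i t')%:~R.
  have HH : \forall z \near z0 i, \sum_(t' < 10) d t' * germ_fun (l0 i) (l1 i) (D i) (S i) t' z = 0.
    apply: filterS (H i i9) => z hz; rewrite -[RHS]hz.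
    rewrite /d; under eq_bigr do rewrite mulr_suml.
    rewrite exchange_big /=; apply: eq_bigr => k' _.
    by rewrite row_funE ?ltn_ord // mulr_sumr; apply: eq_bigr => t' _; rewrite mulrA.
  have d7 : d 7%N = 0 by apply: big1 => k' _; rewrite coef7 ?mulr0.
  have [n0 n1] := z01 i i9; have [_ [g0 g1 gD]] := lP i i9.
  have [|[d0 d1 d2 d3] [d4 d5 d6] [d8 d9]] :=
    @germ_independence R (l0 i) (l1 i) (D i) (z0 i) (d 0%N) (d 1%N) (d 2%N) (d 3%N) (d 4%N) (d 5%N)
      (d 6%N) (d 8%N) (d 9%N) n0 n1 g0 g1 gD.
    apply: filterS HH => z hz; rewrite -[RHS]hz.
    by rewrite !big_ord_recl big_ord0 /bump /= /germ_fun /bump /= d7; ring.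
  have dt : d t = 0.
    by move: ht; rewrite !inE; do 8?[case/orP]; move/eqP ->.
  move: dt; rewrite /d (bigD1 k) //= big1 ?addr0.
    by move/eqP; rewrite mulf_eq0 intr_eq0 (negbTE h0) orbF => /eqP.
  by move=> k' kk; rewrite hk ?mulr0.
move=> k; have [/c27 //|k27] := ltnP k 27.
have {k27}kE : k = ord_max by apply/val_inj/eqP; rewrite eqn_leq k27 -ltnS ltn_ord.
have [n0 n1] := z01 2%N isT.
(* Only the last row is left. Its component at [i = 2] is a multiple of a function that is nonzero
   at the base point. *)
have [m1 [+ [s0 _]]] := nbhs_singleton (filterI (near_neqC n1) (filterI (H 2%N isT) (SP 2%N isT))).
rewrite (bigD1 ord_max) //= big1 ?addr0; last first.
  move=> k' kk; rewrite c27 ?mul0r //.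
  by rewrite ltn_neqAle -[X in _ && X]ltnS ltn_ord andbT; move: kk.
rewrite /row_fun !big_cons big_nil /= addr0 /germ_fun -kE => /eqP.
rewrite !mulf_eq0 invr_eq0 !mulf_eq0 (negbTE s0) subr_eq0 [1 == _]eq_sym (negbTE m1) orbF intr_eq0 /= orbF.
by move/eqP.
Qed.

End Basis.

Section Family.
Variable R : realType.
Local Notation C := (Cplx R).

Lemma row_fun_sum (l0 l1 D S : nat -> C -> C) k (z w : nat -> C) : (k < 28)%N ->
  \sum_(i < 9) row_fun (l0 i) (l1 i) (D i) (S i) k i (z i) * w i =
  \sum_(e <- nth [::] relations k) e.2%:~R *
    (germ_fun (l0 e.1.1) (l1 e.1.1) (D e.1.1) (S e.1.1) e.1.2 (z e.1.1) * w e.1.1).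
Proof.
move=> k28; rewrite /row_fun; under eq_bigr do rewrite mulr_suml.
rewrite (exchange_big_dep xpredT) //=; apply: eq_big_seq => e ek.
have [e9 _] := relations_entries k28 ek.
rewrite (big_pred1 (Ordinal e9)) => [|i]; first by rewrite mulrA.
by rewrite inE -val_eqE eq_sym.
Qed.

Lemma independent_relations (p : C * C) : good p ->
  exists B : 'I_28 -> 'I_9 -> C -> C,
  (forall k, abelian_relation (@spence_kummer R) p (B k)) /\
  forall c : 'I_28 -> C,
    (forall i, \forall z \near spence_kummer i p, \sum_(k < 28) c k * B k i z = 0) ->
    forall k, c k = 0.
Proof.
move=> gp.
have z01 i : (i < 9)%N -> sk i p != 0 /\ sk i p != 1.
  by move=> i9; split; [exact: sk_neq0|rewrite -subr_eq0; exact: sk_neq1].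
have [L LP] : {L : nat -> (C -> C) * (C -> C) * (C -> C) & forall i, (i < 9)%N ->
    polylog_germs (sk i p) (L i).1.1 (L i).1.2 (L i).2}.
  apply: (@choice _ _ (fun i (l : (C -> C) * (C -> C) * (C -> C)) => (i < 9)%N ->
     polylog_germs (sk i p) l.1.1 l.1.2 l.2)) => i.
  have [i9|i9] := boolP (i < 9)%N; last by exists (id, id, id).
  by have [n0 n1] := z01 i i9; have [l lP] := polylog_germs_exist n0 n1; exists l.
have [S [SP S27]] := arctanh_relation gp.
pose l0 i := (L i).1.1; pose l1 i := (L i).1.2; pose D i := (L i).2.
exists (fun k i => row_fun (l0 i) (l1 i) (D i) (S i) k i); split; last first.
  move=> c H; apply: (relations_independent (z0 := fun i => sk i p) (l0 := l0) (l1 := l1) (D := D) z01 LP SP).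
  by move=> i i9; have := H (Ordinal i9); rewrite spence_kummerE.
move=> k; split => [i|].
  have i9 := ltn_ord i; have [n0 n1] := z01 i i9.
  have h := germ_fun_differentiable n0 n1 (LP i i9) (SP i i9).
  rewrite /holomorphic_at spence_kummerE; apply: filterS h => z h.
  rewrite (_ : row_fun _ _ _ _ _ _ =
    \sum_(t < 10) (coef k i t)%:~R *: germ_fun (l0 i) (l1 i) (D i) (S i) t).
    by apply: differentiable_sum => t; apply: differentiableZ; exact: h.
  by apply/funext => w; rewrite row_funE // fct_sumE.
have main : \forall q \near p, forall v, \sum_(e <- nth [::] relations k) e.2%:~R *
    (germ_fun (l0 e.1.1) (l1 e.1.1) (D e.1.1) (S e.1.1) e.1.2 (sk e.1.1 q) * 'd (sk e.1.1) q v) = 0.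
  have [hk|hk] := boolP ((k : nat) \in [:: 12; 13; 14; 15]%N); first exact: rational_relations.
  have [->|k27] := eqVneq (k : nat) 27%N; first exact: S27.
  apply: (polylog_relations gp LP S) => //.
  by move: hk; rewrite !inE !negb_or k27 => /and4P[-> -> -> ->].
apply: filterS main => q hq v.
refine (etrans _ (hq v)).
refine (etrans _ (@row_fun_sum l0 l1 D S k (fun i => sk i q) (fun i => 'd (sk i) q v) (ltn_ord k))).
apply: eq_bigr => i _; rewrite spence_kummerE; reflexivity.
Qed.

End Family.

(** * The bound on the rank *)

Section UpperBound.
Variable R : realType.
Local Notation C := (Cplx R).
Local Notation N := (@cabs R).

(* Differentiating in the direction of the kernel of the last form lowers the
   power by one and removes that form from the relation. *)
Lemma form_powers_independent n m (al be c : nat -> C) : (n <= m.+1)%N ->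
  (forall i, (i < n)%N -> al i != 0 \/ be i != 0) ->
  (forall i j, (i < n)%N -> (j < n)%N -> i != j -> al i * be j - al j * be i != 0) ->
  (forall x y, \sum_(i < n) c i * (al i * x + be i * y) ^+ m = 0) ->
  forall i, (i < n)%N -> c i = 0.
Proof.
elim: n m c => [//|n ih] m c nm nz det H.
have {}ih i : (i < n)%N -> c i = 0.
  move=> i_n; case: m nm H => [|m] nm H; first by move: i_n; move: nm; case: n {ih nz det H}.
  (* The value of the [j]-th form on [(- be n, al n)], which spans the kernel of the [n]-th. *)
  pose w j : C := al n * be j - al j * be n.
  have wn : w n = 0 by rewrite /w subrr.
  have w0 j : (j < n)%N -> w j != 0.
    by move=> jn; apply: det; rewrite ?ltnS ?leqnn ?(ltnW jn) // gtn_eqF.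
  suff : c i * w i = 0 by move/eqP; rewrite mulf_eq0 (negbTE (w0 i i_n)) orbF => /eqP.
  apply: (ih m (fun j => c j * w j) nm) i_n.
  - by move=> j jn; apply: nz; exact: ltnW.
  - by move=> j k jn kn; apply: det; exact: ltnW.
  move=> x y.
  (* The relation along the line through [(x, y)] in that direction; its derivative at 0 is the
     relation between [m]-th powers. *)
  pose P : {poly C} := \sum_(j < n.+1) c j *: ((al j * x + be j * y)%:P + w j *: 'X) ^+ m.+1.
  have P0 : P = 0.
    apply: (@poly_near0 R P 0); apply: filterE => t.
    rewrite /P horner_sum -[RHS](H (x - be n * t) (y + al n * t)).
    by apply: eq_bigr => j _; rewrite !hornerE /w; congr (_ * _ ^+ _); ring.
  have : P^`().[0] = 0 by rewrite P0 deriv0 horner0.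
  have -> : P^`().[0] = (\sum_(j < n) c j * w j * (al j * x + be j * y) ^+ m) *+ m.+1.
    rewrite /P raddf_sum horner_sum big_ord_recr /= wn scale0r addr0 -rmorphXn /=.
    rewrite derivZ derivC scaler0 horner0 addr0 -sumrMnl; apply: eq_bigr => j _.
    rewrite derivZ deriv_exp derivD derivC add0r derivZ derivX alg_polyC hornerZ hornerMn hornerM hornerC.
    by rewrite horner_exp hornerD hornerC hornerZ hornerX mulr0 addr0 mulrnAr mulrA.
  by move/eqP; rewrite -mulr_natr mulf_eq0 pnatr_eq0 orbF => /eqP.
move=> i; rewrite ltnS leq_eqVlt => /predU1P[->|/ih //].
have cn x y : c n * (al n * x + be n * y) ^+ m = 0.
  by have := H x y; rewrite big_ord_recr /= big1 ?add0r // => j _; rewrite ih ?mul0r.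
have [a0|b0] := nz n (ltnSn n).
  have /eqP := cn 1 0; rewrite mulr0 addr0 mulr1 mulf_eq0 expf_eq0 (negbTE a0) andbF orbF.
  by move/eqP.
have /eqP := cn 0 1; rewrite mulr0 add0r mulr1 mulf_eq0 expf_eq0 (negbTE b0) andbF orbF.
by move/eqP.
Qed.

(** [f (U p + w) / w ^ m] tends to [a m], and [(U (p + s h) - U p) / s] to the differential of [U]
    on [h]. *)
Lemma taylor_lead_cvg (f : C -> C) (U : C * C -> C) (p h : C * C) a m : taylor_at f (U p) a -> (0 < m)%N ->
  (forall n, (n < m)%N -> a n = 0) -> differentiable U p ->
  (fun s : C => f (U (p + s *: h)) / s ^+ m) @ (0 : C)^' --> a m * ('d U p h) ^+ m.
Proof.
move=> fa m0 a0 dU.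
have fz : f (U p) = 0.
  have [r [M [r0 M0 H]]] := taylor_lead fa a0.
  have := H 0; rewrite cabs0 (ltW r0) addr0 !expr0n !eqn0Ngt m0 /= mulr0 subr0 mulr0 => /(_ isT) h0.
  by apply/eqP; rewrite -cabs_eq0 eq_le h0 cabs_ge0.
(* The limit value is assigned at 0, because [U (p + s *: h)] may equal [U p] for nonzero [s]. *)
pose g w := if w == 0 then a m else f (U p + w) / w ^+ m.
have gc : g @ nbhs (0 : C) --> a m.
  have [r [M [r0 M0 H]]] := taylor_lead fa a0.
  apply/(@cvgrPdist_le _ _ _ (nbhs (0 : C)) (nbhs_filter (0 : C)) g) => e e0.
  have eE : (complex.Re e)%:C%C = e by rewrite RRe_real // gtr0_real.
  have e0' : 0 < complex.Re e by rewrite -ltcR eE.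
  apply/near_cabsP; exists (Num.min r (complex.Re e / (M + 1))).
    by rewrite lt_min r0 divr_gt0 // ltr_wpDl.
  move=> w; rewrite lt_min add0r => /andP[wr we].
  rewrite -eE cabsE lecR /g.
  have [_|w0] := eqVneq w 0; first by rewrite subrr cabs0 ltW.
  have wm : w ^+ m != 0 by rewrite expf_neq0.
  rewrite (_ : a m - _ = - (f (U p + w) - a m * w ^+ m) / w ^+ m); last by field.
  have wm' : 0 < N (w ^+ m) by rewrite cabs_gt0.
  rewrite cabsM cabsV cabsN ler_pdivrMr //; apply: le_trans (H w (ltW wr)) _.
  rewrite cabsX exprS mulrA ler_wpM2r ?exprn_ge0 ?cabs_ge0 //.
  move: we; rewrite ltr_pdivlMr ?ltr_wpDl // => /ltW we.
  by apply: le_trans we; rewrite mulrC ler_wpM2l ?cabs_ge0 // lerDl.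
have FF : Filter (0 : C)^' := @dnbhs_filter C 0.
have dc : (fun s : C => s^-1 * (U (p + s *: h) - U p)) @ (0 : C)^' --> 'd U p h.
  have /cvg_ex[l hl] := diff_derivable (v := h) dU.
  have lE : l = 'd U p h by rewrite -deriveE //; apply/esym/cvg_lim.
  rewrite -lE; apply: cvg_trans hl; apply: near_eq_cvg; apply: filterE => s /=.
  by rewrite [s *: h + p]addrC.
have wc : (fun s : C => U (p + s *: h) - U p) @ (0 : C)^' --> (0 : C).
  have s0 : (fun s : C => s) @ (0 : C)^' --> (0 : C) by apply: cvg_within.
  have := @cvgM _ _ _ FF _ _ _ _ s0 dc; rewrite mul0r => hh; apply: cvg_trans hh; apply: near_eq_cvg.
  by apply/near_cabsP; exists 1 => // w _; rewrite add0r => w0 /=; rewrite mulVKf.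
have dcm : (fun s : C => (s^-1 * (U (p + s *: h) - U p)) ^+ m) @ (0 : C)^' --> ('d U p h : C) ^+ m.
  elim: (m) => [|k ih]; first exact: cvg_cst.
  have hh := @cvgM _ _ _ FF _ _ _ _ dc ih; rewrite -exprS in hh.
  apply: cvg_trans hh; apply: near_eq_cvg; apply: filterE => s; by rewrite /= exprS.
have hh := @cvgM _ _ _ FF _ _ _ _ (cvg_comp _ _ wc gc) dcm.
apply: cvg_trans hh; apply: near_eq_cvg; apply/near_cabsP; exists 1; first exact: ltr01.
move=> s _; rewrite add0r => s0 /=.
rewrite /g /= [U p + _]addrC subrK exprMn exprVn.
have [/eqP|wn] := eqVneq (U (p + s *: h) - U p) 0.
  by rewrite subr_eq0 => /eqP E; rewrite E subrr fz expr0n eqn0Ngt m0 /= !mulr0 mul0r.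
by rewrite [_^-1 * _]mulrC mulrA divfK // expf_neq0.
Qed.

Lemma cvg_sum_ord (T : Type) (F : set_system T) (FF : Filter F) n (f : 'I_n -> T -> C) (l : 'I_n -> C) :
  (forall i, f i @ F --> l i) -> (fun x => \sum_(i < n) f i x) @ F --> \sum_(i < n) l i.
Proof.
elim: n f l => [|n ih] f l fl.
  rewrite big_ord0 (_ : (fun x => _) = fun=> 0); first exact: cvg_cst.
  by apply/funext => x; rewrite big_ord0.
rewrite big_ord_recl (_ : (fun x => _) = f ord0 \+ (fun x => \sum_(i < n) f (lift ord0 i) x)).
  exact: (@cvgD _ _ _ _ FF _ _ _ _ (fl ord0) (ih (fun i => f (lift ord0 i)) _ (fun i => fl _))).
by apply/funext => x; rewrite big_ord_recl.
Qed.

(** The sum of the primitives is divided by [s ^ m] along the line [p + s h], and [s] tends to 0. *)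
Lemma leading_relation d (U : 'I_d -> C * C -> C) p (F : 'I_d -> C -> C) (a : 'I_d -> nat -> C) m :
  (forall i, differentiable (U i) p) -> (0 < m)%N ->
  (forall i, taylor_at (F i) (U i p) (a i)) -> (forall i n, (n < m)%N -> a i n = 0) ->
  (\forall q \near p, \sum_(i < d) F i (U i q) = 0) ->
  forall h, \sum_(i < d) a i m * ('d (U i) p h) ^+ m = 0.
Proof.
move=> dU m0 Fa a0 H h.
have c1 : (fun s : C => \sum_(i < d) F i (U i (p + s *: h)) / s ^+ m) @ (0 : C)^' -->
    \sum_(i < d) a i m * ('d (U i) p h) ^+ m.
  apply: (@cvg_sum_ord C _ (@dnbhs_filter C 0)) => i; apply: taylor_lead_cvg => //; exact: a0.
have c2 : (fun s : C => \sum_(i < d) F i (U i (p + s *: h)) / s ^+ m) @ (0 : C)^' --> (0 : C).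
  apply: (@cvg_trans _ ((fun=> 0 : C) @ (0 : C)^')); last exact: cvg_cst.
  apply: near_eq_cvg.
  have [e e0 He] := (near_cabs_pairP p _).1 H.
  apply/near_cabsP; exists (e / (N h.1 + N h.2 + 1)).
    by rewrite divr_gt0 // ltr_wpDl // addr_ge0 ?cabs_ge0.
  move=> s; rewrite add0r ltr_pdivlMr ?ltr_wpDl ?addr_ge0 ?cabs_ge0 // => hs _.
  have sh x : N x <= N h.1 + N h.2 -> N (s * x) < e.
    move=> xh; rewrite cabsM; apply: le_lt_trans hs; rewrite ler_wpM2l ?cabs_ge0 //.
    by apply: le_trans xh _; rewrite lerDl.
  rewrite /= -mulr_suml.
  have := He (s * h.1) (s * h.2).
  rewrite !sh ?lerDl ?lerDr ?cabs_ge0 // => /(_ isT isT).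
  rewrite (_ : (_, _) = p + s *: h); last by case: (p) (h) => [? ?] [? ?].
  by move=> ->; rewrite mul0r.
exact: cvg_unique c1 c2.
Qed.

End UpperBound.

Section Rank.
Variable R : realType.
Local Notation C := (Cplx R).
Local Notation N := (@cabs R).

Lemma has_grad_sum n (f : 'I_n -> C * C -> C) q (a b : 'I_n -> C) :
  (forall i, has_grad (f i) q (a i) (b i)) ->
  has_grad (fun q => \sum_(i < n) f i q) q (\sum_(i < n) a i) (\sum_(i < n) b i).
Proof.
elim: n f a b => [|n ih] f a b h.
  rewrite !big_ord0 (_ : (fun q => _) = fun=> 0); first exact: has_grad_cst.
  by apply/funext => x; rewrite big_ord0.
rewrite !big_ord_recl (_ : (fun q => _) = fun q => f ord0 q + \sum_(i < n) f (lift ord0 i) q).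
  exact: (has_gradD (h ord0) (ih _ _ _ (fun i => h (lift ord0 i)))).
by apply/funext => x; rewrite big_ord_recl.
Qed.

Lemma cder_sum n (f : 'I_n -> C -> C) z (a c : 'I_n -> C) : (forall i, cder (f i) z (a i)) ->
  cder (fun z => \sum_(i < n) c i * f i z) z (\sum_(i < n) c i * a i).
Proof.
elim: n f a c => [|n ih] f a c h.
  rewrite !big_ord0 (_ : (fun z => _) = fun=> 0); first exact: cder_cst.
  by apply/funext => x; rewrite big_ord0.
rewrite !big_ord_recl (_ : (fun z => _) =
  fun z => c ord0 * f ord0 z + \sum_(i < n) c (lift ord0 i) * f (lift ord0 i) z).
  exact: (cderD (cderZ (c ord0) (h ord0)) (ih _ _ (fun i => c (lift ord0 i)) (fun i => h (lift ord0 i)))).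
by apply/funext => x; rewrite big_ord_recl.
Qed.

Variables (d : nat) (U : 'I_d -> C * C -> C) (p : C * C).

Definition primitive_jets (G F : 'I_d -> C -> C) (a : 'I_d -> nat -> C) :=
  forall i, [/\ F i (U i p) = 0, \forall z \near U i p, cder (F i) z (G i z)
              & taylor_at (F i) (U i p) (a i)].

Lemma primitive_jets_exist (G : 'I_d -> C -> C) : (forall i, holomorphic_at (G i) (U i p)) ->
  exists Fa : ('I_d -> C -> C) * ('I_d -> nat -> C), primitive_jets G Fa.1 Fa.2.
Proof.
move=> Gh.
have [Fa FaP] : {Fa : 'I_d -> (C -> C) * (nat -> C) & forall i,
    [/\ (Fa i).1 (U i p) = 0, \forall z \near U i p, cder (Fa i).1 z (G i z)
      & taylor_at (Fa i).1 (U i p) (Fa i).2]}.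
  apply: (@choice _ _ (fun i (Fa : (C -> C) * (nat -> C)) => [/\ Fa.1 (U i p) = 0,
    \forall z \near U i p, cder Fa.1 z (G i z) & taylor_at Fa.1 (U i p) Fa.2])) => i.
  have [F F0 dF] := local_primitive (Gh i).
  have [a aP] : exists a, taylor_at F (U i p) a.
    by apply: holo_taylor; apply: filterS dF => z; exact: cder_diff.
  by exists (F, a).
by exists (fun i => (Fa i).1, fun i => (Fa i).2).
Qed.

Hypothesis Ureg : web_regular_at U p.

(** The differential of the sum is the abelian relation, hence 0, and every primitive vanishes at
    the base point. *)
Lemma primitives_sum0 G F a : abelian_relation U p G -> primitive_jets G F a ->
  \forall q \near p, \sum_(i < d) F i (U i q) = 0.
Proof.
move=> [_ GU] FP; have [Uh _ _] := Ureg.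
have S0 : \sum_(i < d) F i (U i p) = 0 by rewrite big1 // => i _; have [] := FP i.
have H : \forall q \near p, forall i, differentiable (U i) q /\ cder (F i) (U i q) (G i (U i q)).
  apply: (@filter_forall _ _ _ (nbhs p) (nbhs_filter p)) => i; have [_ dF _] := FP i.
  have dU := Uh i.
  have Uc : {for p, continuous (U i)}.
    by apply: differentiable_continuous; exact: nbhs_singleton dU.
  by apply: filterI dU _; exact: Uc dF.
suff : \forall q \near p, \sum_(i < d) F i (U i q) = \sum_(i < d) F i (U i p).
  by apply: filterS => q ->.
apply: (@has_grad0_const R (fun q => \sum_(i < d) F i (U i q))).
apply: filterS2 H GU => q Hq GUq.
have := has_grad_sum (fun i => has_grad_comp (diff_has_grad (Hq i).1) (Hq i).2).
by apply: has_grad_eq; exact: GUq.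
Qed.

(** Induction on the degree [m]. With [i] counted from 0, the hypothesis leaves at most the [m + 1]
    coefficients with [i <= m], and the [m]-th powers of their forms are independent. In degree 0
    the normalization of the primitives applies. *)
Lemma jets_vanish G F a : abelian_relation U p G -> primitive_jets G F a ->
  (forall m (i : 'I_d), (0 < m < i)%N -> a i m = 0) ->
  forall i, \forall z \near U i p, G i z = 0.
Proof.
move=> GP FP ha; have [Uh Us Ut] := Ureg.
have dU i : differentiable (U i) p by exact: nbhs_singleton (Uh i).
have F0 := primitives_sum0 GP FP.
(* Extension by 0 from ['I_d] to natural numbers, as [form_powers_independent] requires. *)
pose al j : C := if insub j is Some i then 'd (U i) p (1, 0) else 0.
pose be j : C := if insub j is Some i then 'd (U i) p (0, 1) else 0.
have dUE i v : 'd (U i) p v = al i * v.1 + be i * v.2.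
  by rewrite /al /be valK (has_gradE _ (diff_has_grad (dU i))).
have nz (i : 'I_d) : al i != 0 \/ be i != 0.
  have [v] := Us i; rewrite dUE; have [->|] := eqVneq (al i) 0; last by left.
  have [->|] := eqVneq (be i) 0; last by right.
  by rewrite !mul0r addr0 eqxx.
have det (i j : 'I_d) : i != j -> al i * be j - al j * be i != 0.
  move=> ij; apply/eqP => E.
  have [] : (- be i, al i) = 0 :> C * C.
    by apply: (Ut i j ij); rewrite dUE /=; [|rewrite -[RHS]E]; ring.
  by move/eqP; rewrite oppr_eq0 => /eqP b0 a0; have := nz i; rewrite a0 b0 eqxx; case.
have a0 m : forall i, a i m = 0.
  elim/ltn_ind: m => m ih.
  have [->|m0] := posnP m.
    move=> i; have [Fz _ Fa] := FP i.
    have [r [M [r0 M0 H]]] := taylor_lead Fa (k := 0) (fun n h => False_ind _ (notF h)).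
    have := H 0; rewrite cabs0 (ltW r0) addr0 Fz expr0 expr1 mulr1 sub0r mulr0 cabsN => /(_ isT) h.
    by apply/eqP; rewrite -cabs_eq0 eq_le h cabs_ge0.
  have rel := leading_relation dU m0 (fun i => let: And3 _ _ h := FP i in h)
    (fun i n nm => ih n nm i) F0.
  pose c j : C := if insub j is Some i then a i m else 0.
  have cE (i : 'I_d) : c i = a i m by rewrite /c valK.
  have c0 (i : 'I_d) : (m.+1 <= i)%N -> a i m = 0 by move=> mi; apply: ha; rewrite m0.
  have nd := geq_minl d m.+1; have nm := geq_minr d m.+1.
  have ex j : (j < minn d m.+1)%N -> exists i : 'I_d, j = i.
    by move=> jn; exists (Ordinal (leq_trans jn nd)).
  have cn j : (j < minn d m.+1)%N -> c j = 0.
    apply: (form_powers_independent (m := m) (al := al) (be := be) nm).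
    - by move=> k /ex[i ->]; exact: nz.
    - by move=> k l /ex[i ->] /ex[i' ->] kl; apply: det.
    move=> x y.
    rewrite (big_ord_widen d (fun j => c j * (al j * x + be j * y) ^+ m) nd) -[RHS](rel (x, y)) big_mkcond.
    apply: eq_bigr => i _; rewrite dUE cE leq_min ltn_ord /=.
    by case: ltnP => // mi; rewrite c0 ?mul0r.
  move=> i; have [im|] := ltnP i m.+1; last exact: c0.
  by rewrite -cE; apply: cn; rewrite leq_min ltn_ord.
move=> i; have [_ dF Fa] := FP i.
exact: near0_der (taylor_eq0 Fa (fun n => a0 n i)) dF.
Qed.

Section Combination.
Variables (r : nat) (G : 'I_d -> C -> C) (B : 'I_r -> 'I_d -> C -> C) (c : 'I_r -> C).

Lemma abelian_relation_sub : abelian_relation U p G -> (forall k, abelian_relation U p (B k)) ->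
  abelian_relation U p (fun i z => G i z - \sum_(k < r) c k * B k i z).
Proof.
move=> [Gh GU] BP; split=> [i|].
  have H : \forall z \near U i p, forall k, differentiable (B k i : C -> C) z.
    by apply: (@filter_forall _ _ _ (nbhs (U i p)) (nbhs_filter _)) => k; have [h _] := BP k; exact: h.
  apply: filterS2 (Gh i) H => z dG dB.
  exact: cder_diff (cderB (diff_cder dG) (cder_sum c (fun k => diff_cder (dB k)))).
have H : \forall q \near p, forall k v, \sum_(i < d) B k i (U i q) * 'd (U i) q v = 0.
  by apply: (@filter_forall _ _ _ (nbhs p) (nbhs_filter _)) => k; have [_ h] := BP k; exact: h.
apply: filterS2 GU H => q GUq Hq v.
under eq_bigr do rewrite mulrBl mulr_suml.
rewrite sumrB GUq exchange_big /= big1 ?subr0 // => k _.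
by under eq_bigr do rewrite -mulrA; rewrite -mulr_sumr Hq mulr0.
Qed.

Lemma primitive_jets_sub F a (FB : 'I_r -> 'I_d -> C -> C) (aB : 'I_r -> 'I_d -> nat -> C) :
  primitive_jets G F a -> (forall k, primitive_jets (B k) (FB k) (aB k)) ->
  primitive_jets (fun i z => G i z - \sum_(k < r) c k * B k i z)
    (fun i z => F i z - \sum_(k < r) c k * FB k i z) (fun i m => a i m - \sum_(k < r) c k * aB k i m).
Proof.
move=> GP BP i; have [F0 dF Fa] := GP i; split.
- by rewrite F0 big1 ?subr0 // => k _; have [-> _ _] := BP k i; rewrite mulr0.
- have H : \forall z \near U i p, forall k, cder (FB k i) z (B k i z).
    by apply: (@filter_forall _ _ _ (nbhs (U i p)) (nbhs_filter _)) => k; have [_ h _] := BP k i; exact: h.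
  by apply: filterS2 dF H => z dz hz; apply: cderB dz (cder_sum c hz).
have FB' k : taylor_at (FB k i) (U i p) (aB k i) by have [_ _ h] := BP k i.
have := taylorZD (-1) (taylor_sum c FB') Fa.
by under eq_fun do rewrite mulN1r addrC; under [X in taylor_at _ _ X]eq_fun do rewrite mulN1r addrC.
Qed.

End Combination.

(** By [jets_vanish] the [r] coefficients listed in [js] determine an abelian relation. For [r]
    independent relations they form an invertible matrix, so a linear system gives the coordinates
    of any relation. *)
Lemma has_rank_of_independent r (js : seq (nat * nat)) : size js = r ->
  (forall m i, (0 < m < i)%N -> (i < d)%N -> (m, i) \in js) ->
  (exists B : 'I_r -> 'I_d -> C -> C, (forall k, abelian_relation U p (B k)) /\
     forall c : 'I_r -> C,
       (forall i, \forall z \near U i p, \sum_(k < r) c k * B k i z = 0) -> forall k, c k = 0) ->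
  has_rank U p r.
Proof.
move=> js_size js_in [B [BP Bfree]]; exists B; split => // G GP.
have [FB FBP] : {FB : 'I_r -> ('I_d -> C -> C) * ('I_d -> nat -> C) & forall k,
    primitive_jets (B k) (FB k).1 (FB k).2}.
  apply: (@choice _ _ (fun k (Fa : ('I_d -> C -> C) * ('I_d -> nat -> C)) =>
    primitive_jets (B k) Fa.1 Fa.2)) => k.
  by have [h _] := BP k; exact: primitive_jets_exist h.
have [[F a] /= FP] := primitive_jets_exist GP.1.
pose jet (a : 'I_d -> nat -> C) (j : 'I_r) : C :=
  let e := nth (0, 0)%N js j in if insub e.2 is Some i then a i e.1 else 0.
pose M : 'M[C]_r := \matrix_(k, j) jet (FB k).2 j.
(* Equal jets imply equal germs: [jets_vanish] is applied to the difference. *)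
have key (G' : 'I_d -> C -> C) F' a' (c : 'rV[C]_r) : abelian_relation U p G' -> primitive_jets G' F' a' ->
    \row_j jet a' j = c *m M ->
    forall i, \forall z \near U i p, G' i z = \sum_(k < r) c 0 k * B k i z.
  move=> G'P F'P cM i.
  have := jets_vanish (abelian_relation_sub (c 0) G'P BP) (primitive_jets_sub (c 0) F'P FBP).
  suff h : forall m (i : 'I_d), (0 < m < i)%N -> a' i m - \sum_(k < r) c 0 k * (FB k).2 i m = 0.
    by move=> /(_ h i); apply: filterS => z /eqP; rewrite subr_eq0 => /eqP.
  move=> m i' mi; have hin := js_in m i' mi (ltn_ord i').
  have jr : (index (m, nat_of_ord i') js < r)%N by rewrite -js_size index_mem.
  have := congr1 (fun v : 'rV[C]_r => v 0 (Ordinal jr)) cM.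
  rewrite !mxE /jet /= nth_index //= valK => ->; apply/eqP; rewrite subr_eq0; apply/eqP.
  by apply: eq_bigr => k _; rewrite !mxE /jet /= nth_index //= valK.
(* For a vector in the left kernel of [M], [key] with the zero relation makes the combination of the
   [B k] vanish. *)
have Munit : M \in unitmx.
  rewrite -row_free_unit; apply: inj_row_free => c cM; apply/rowP => k; rewrite [RHS]mxE.
  apply: (Bfree (fun k => c 0 k)) => i.
  have zAR : abelian_relation U p (fun _ _ => 0).
    split=> [j|]; first by apply: filterE => z; exact: cder_diff (cder_cst 0 z).
    by apply: filterE => q v; rewrite big1 // => j _; rewrite mul0r.
  have zJ : primitive_jets (fun _ _ => 0) (fun _ _ => 0) (fun _ _ => 0).
    move=> j; split=> //; last exact: taylor0.
    by apply: filterE => z; exact: cder_cst.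
  have cM' : \row_j jet (fun _ _ => 0) j = c *m M.
    by rewrite cM; apply/rowP => j; rewrite !mxE /jet; case: insub.
  by apply: filterS (key _ _ _ c zAR zJ cM' i) => z /esym.
exists (fun k => (\row_j jet a j *m invmx M) 0 k); apply: (key G F a) => //.
by rewrite mulmxKV.
Qed.

End Rank.

(** * Regular points *)

(* The coefficients of [d U_i], up to a factor without zeros where the letters are not 0. *)
Definition conormal (T : comPzRingType) (i : nat) (x y : T) : T * T :=
  match i with
  | 0 => (1, 0) | 1 => (0, 1) | 2 => (y, - x) | 3 => (1 - y, x - 1)
  | 4 => (y * (1 - y), x * (x - 1)) | 5 => (y, x)
  | 6 => (1 - y, x * (x - 1)) | 7 => (y * (1 - y), x - 1)
  | _ => (y * (1 - y) * (1 + x), x * (x - 1) * (1 + y))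
  end.

Definition conormal_det (T : comPzRingType) (i j : nat) (x y : T) : T :=
  (conormal i x y).1 * (conormal j x y).2 - (conormal j x y).1 * (conormal i x y).2.

(** Defined over any commutative ring: over [int] it is evaluated by computation, over polynomials
    it is restricted to a line, and ring morphisms transport the values to [C]. *)
Definition singular_curve (T : comPzRingType) (x y : T) : T :=
  x * y * (1 - x) * (1 - y) * (x - y) * (1 - x * y) *
  \prod_(i < 9) \prod_(j < 9 | (i < j)%N) conormal_det i j x y.

Lemma singular_curve_morph (T T' : comPzRingType) (f : {rmorphism T -> T'}) x y :
  f (singular_curve x y) = singular_curve (f x) (f y).
Proof.
have conormalE i : conormal i (f x) (f y) = (f (conormal i x y).1, f (conormal i x y).2).
  case: i => [|[|[|[|[|[|[|[|i]]]]]]]]; rewrite /conormal;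
    by rewrite ?(rmorphM, rmorphB, rmorphN, rmorphD, rmorph1, rmorph0).
rewrite /singular_curve !(rmorphM, rmorphB, rmorph1) rmorph_prod; congr (_ * _).
apply: eq_bigr => i _; rewrite rmorph_prod; apply: eq_bigr => j _.
by rewrite /conormal_det !conormalE rmorphB !rmorphM.
Qed.

Section Regular.
Variable R : realType.
Local Notation C := (Cplx R).
Local Notation N := (@cabs R).

Lemma singular_curve_nontrivial : singular_curve (2 : C) 5 != 0.
Proof.
have := singular_curve_morph (intr : {rmorphism int -> C}) 2 5.
rewrite !rmorph_nat => <-; rewrite intr_eq0 /singular_curve !mulf_neq0 //.
apply/prodf_neq0 => i _; apply/prodf_neq0 => j ij.
have H : all (fun i => all (fun j => (i < j)%N ==> (conormal_det i j (2 : int) 5 != 0)) (iota 0 9)) (iota 0 9).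
  by vm_compute.
have iI : (i : nat) \in iota 0 9 by rewrite mem_iota ltn_ord.
have jI : (j : nat) \in iota 0 9 by rewrite mem_iota ltn_ord.
exact: (implyP (allP (allP H i iI) j jI)).
Qed.

Lemma sk_conormal i (q : C * C) : (i < 9)%N -> good q -> exists2 mu, mu != 0 &
  forall v, 'd (sk i) q v = mu * ((conormal i q.1 q.2).1 * v.1 + (conormal i q.1 q.2).2 * v.2).
Proof.
move=> i9 gq; have [[g0 g1 g2 g3 g4] g5 g6 g7] := goodP gq.
(* The common denominator of the coefficients of [d log U_i], once the factors shared by their
   numerators are cancelled. *)
pose den : C := match i with
  | 0 => q.1 | 1 => q.2 | 2 => q.1 * q.2 | 3 => (1 - q.1) * (1 - q.2)
  | 4 => - (q.1 * (1 - q.1) * (q.2 * (1 - q.2))) | 5 => q.1 * q.2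
  | 6 => q.1 * (1 - q.1) * (1 - q.2) | 7 => (1 - q.1) * (q.2 * (1 - q.2))
  | _ => q.1 * (1 - q.1) * (q.2 * (1 - q.2)) end.
have s0 := sk_neq0 i9 gq.
exists (sk i q / den).
  rewrite mulf_neq0 // invr_eq0 /den.
  by case: i {i9 s0 den} => [|[|[|[|[|[|[|[|i]]]]]]]]; rewrite ?oppr_eq0 ?mulf_neq0.
move=> v; rewrite sk_diff // -mulrA; congr (_ * _); rewrite /den {den}.
case: i {i9 s0} => [|[|[|[|[|[|[|[|i]]]]]]]]; rewrite /m0 /dlog_letter /dletter /letter /conormal;
  cbn [fst snd]; field; by rewrite ?g0 ?g1 ?g2 ?g3.
Qed.

Lemma web_regular_off_curve (q : C * C) : singular_curve q.1 q.2 != 0 ->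
  web_regular_at (@spence_kummer R) q.
Proof.
rewrite /singular_curve !mulf_eq0 !negb_or -!andbA => /and4P[g0 g1 g2 /and4P[g3 g4 g5 hp]].
have gq : good q by case=> [|[|[|[|[|[|l]]]]]].
have det (i j : 'I_9) : i != j -> conormal_det i j q.1 q.2 != 0.
  have lt (i' j' : 'I_9) : (i' < j')%N -> conormal_det i' j' q.1 q.2 != 0.
    by move=> ij; have /prodf_neq0 /(_ i' isT)/prodf_neq0 /(_ j' ij) := hp.
  rewrite neq_lt => /orP[/lt //|/lt]; rewrite /conormal_det.
  by rewrite -opprB oppr_eq0.
split=> [i|i|i j ij v].
- rewrite /holomorphic_at spence_kummerE; apply: filterS (near_good gq) => q' gq'.
  exact: has_grad_diff (sk_grad (ltn_ord i) gq').
- rewrite spence_kummerE; have [mu mu0 dE] := sk_conormal (ltn_ord i) gq.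
  have [A0|A0] := eqVneq (conormal i q.1 q.2).1 0; last first.
    by exists (1, 0); rewrite dE /= mulr1 mulr0 addr0 mulf_neq0.
  exists (0, 1); rewrite dE /= mulr1 mulr0 add0r mulf_neq0 //; apply/eqP => B0.
  (* If both entries of a conormal were 0, so would be its determinant with any other one. *)
  have [j ij] : exists j : 'I_9, i != j.
    by have [->|] := eqVneq i ord0; [exists ord_max|exists ord0].
  by have := det i j ij; rewrite /conormal_det A0 B0 mul0r mulr0 subrr eqxx.
have [mu mu0 dE] := sk_conormal (ltn_ord i) gq.
have [nu nu0 dE'] := sk_conormal (ltn_ord j) gq.
move=> hi hj.
have := dE v; rewrite -(spence_kummerE R i) hi => /esym/eqP.
rewrite mulf_eq0 (negbTE mu0) => /eqP h {dE hi}.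
have := dE' v; rewrite -(spence_kummerE R j) hj => /esym/eqP.
rewrite mulf_eq0 (negbTE nu0) => /eqP h' {dE' hj}.
have d0 := det i j ij.
move: d0 h h'; rewrite /conormal_det.
move: (conormal i _ _) (conormal j _ _) => [a b] [a' b'] /= d0 h h'.
have v1 : v.1 = 0.
  apply: (mulfI d0); rewrite mulr0.
  transitivity (b' * (a * v.1 + b * v.2) - b * (a' * v.1 + b' * v.2)); first by ring.
  by rewrite h h' !mulr0 subrr.
have v2 : v.2 = 0.
  apply: (mulfI d0); rewrite mulr0.
  transitivity (a * (a' * v.1 + b' * v.2) - a' * (a * v.1 + b * v.2)); first by ring.
  by rewrite h h' !mulr0 subrr.
by move: v1 v2; case: (v) => ? ? /= -> ->.
Qed.

(** On the line from [p0] to [(2, 5)] the singular curve is the zero set of a polynomial, which is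
    not 0 at the parameter 1. So it cannot vanish identically near the parameter 0. *)
Lemma web_regular_dense : dense [set p | web_regular_at (@spence_kummer R) p].
Proof.
move=> O [p0 Op0] Oo.
pose X : {poly C} := p0.1%:P + (2 - p0.1) *: 'X.
pose Y : {poly C} := p0.2%:P + (5 - p0.2) *: 'X.
have ev s : (singular_curve X Y).[s] = singular_curve X.[s] Y.[s].
  exact: (singular_curve_morph (horner_eval s) X Y).
have Q0 : singular_curve X Y != 0.
  apply: contraNneq singular_curve_nontrivial => Q.
  have := ev 1; rewrite Q horner0 /X /Y !hornerD !hornerZ !hornerC !hornerX !mulr1.
  by rewrite ![_ + (_ - _)]addrC !subrK => <-.
apply: contrapT => noreg; move/eqP: Q0; apply.
apply: (@poly_near0 R _ 0).
have Onb : nbhs p0 O by exact: open_nbhs_nbhs.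
have [e e0 He] := (near_cabs_pairP p0 _).1 Onb.
apply/near_cabsP; exists (e / (N (2 - p0.1) + N (5 - p0.2) + 1)).
  by rewrite divr_gt0 // ltr_wpDl // addr_ge0 ?cabs_ge0.
move=> s; rewrite add0r ltr_pdivlMr ?ltr_wpDl ?addr_ge0 ?cabs_ge0 // => hs.
have sh x : N x <= N (2 - p0.1) + N (5 - p0.2) -> N (x * s) < e.
  move=> xh; rewrite mulrC cabsM; apply: le_lt_trans hs; rewrite ler_wpM2l ?cabs_ge0 //.
  by apply: le_trans xh _; rewrite lerDl.
apply: contrapT => /eqP Qs; apply: noreg; exists (X.[s], Y.[s]); split; last first.
  by apply: web_regular_off_curve; rewrite -ev.
rewrite /X /Y !hornerD !hornerZ !hornerC !hornerX.
by apply: He; apply: sh; rewrite ?lerDl ?lerDr cabs_ge0.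
Qed.

(** Each curve on which a letter vanishes is a common leaf of two of the foliations, also where the
    convention [z / 0 = 0] defines the function. Two differentials then share a kernel vector,
    against transversality. *)
Lemma regular_good (p : C * C) : web_regular_at (@spence_kummer R) p -> good p.
Proof.
case: p => x y [hol sub tr].
have skO i (i9 : (i < 9)%N) : spence_kummer (Ordinal i9) = sk_formula i :> (C * C -> C).
  exact: etrans (spence_kummerE R (Ordinal i9)) (skE R i9).
have key i j (v : C * C) : (i < 9)%N -> (j < 9)%N -> i != j -> v != 0 ->
  'd (sk_formula i) (x, y) v = 0 -> 'd (sk_formula j) (x, y) v = 0 -> False.
  move=> i9 j9 ij v0 hi hj; move/eqP: v0; apply.
  apply: (tr (Ordinal i9) (Ordinal j9)); first exact: ij.
    by rewrite skO hi.
  by rewrite skO hj.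
(* Differentiability comes from regularity, so this applies even on lines where the formula divides
   by 0. *)
have cst i (v : C * C) : (i < 9)%N ->
    (forall s, sk_formula i (x + s * v.1, y + s * v.2) = sk_formula i (x, y)) ->
    'd (sk_formula i) (x, y) v = 0.
  move=> i9 h; have := nbhs_singleton (hol (Ordinal i9)); rewrite skO => df.
  rewrite -deriveE //; apply: cvg_lim => //.
  rewrite (_ : (fun _ => _) = fun=> 0); first exact: cvg_cst.
  apply/funext => s /=; rewrite [s *: v + _]addrC (_ : (x, y) + s *: v = (x + s * v.1, y + s * v.2)).
    by rewrite h subrr scaler0.
  by case: (v).
have n10 : (1, 0) != 0 :> C * C by rewrite xpair_eqE oner_eq0.
have n01 : (0, 1) != 0 :> C * C by rewrite xpair_eqE oner_eq0 andbF.
have x0 : x != 0.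
  apply/eqP => E; subst x; apply: (key 0%N 5%N (0, 1)) => //; apply: cst => // s /=.
    by rewrite mulr0 addr0.
  by rewrite mulr0 addr0 !mul0r.
have y0 : y != 0.
  apply/eqP => E; subst y; apply: (key 1%N 5%N (1, 0)) => //; apply: cst => // s /=.
    by rewrite mulr0 addr0.
  by rewrite mulr0 addr0 !mulr0.
have x1 : 1 - x != 0.
  apply/eqP => /eqP; rewrite subr_eq0 => /eqP E; subst x.
  apply: (key 0%N 3%N (0, 1)) => //; apply: cst => // s /=.
    by rewrite mulr0 addr0.
  by rewrite mulr0 addr0 subrr invr0 !mulr0.
have y1 : 1 - y != 0.
  apply/eqP => /eqP; rewrite subr_eq0 => /eqP E; subst y.
  apply: (key 1%N 3%N (1, 0)) => //; apply: cst => // s /=.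
    by rewrite mulr0 addr0.
  by rewrite mulr0 addr0 subrr !mul0r.
have gx := has_grad_fst (x, y); have gy := has_grad_snd (x, y).
have gx1 := has_gradB (has_grad_cst 1 (x, y)) gx.
have gy1 := has_gradB (has_grad_cst 1 (x, y)) gy.
have gxm := has_gradB gx (has_grad_cst 1 (x, y)).
have x1' : x - 1 != 0 by rewrite -opprB oppr_eq0.
have xy : x - y != 0.
  apply/eqP => /eqP; rewrite subr_eq0 => /eqP E; subst y.
  apply: (key 2%N 3%N (1, 1)) => //; first by rewrite xpair_eqE oner_eq0.
    by rewrite (has_gradE _ (has_grad_div y0 gx gy)) /=; ring.
  by rewrite (has_gradE _ (has_grad_div x1 gy1 gx1)) /=; ring.
have xy1 : 1 - x * y != 0.
  apply/eqP => /eqP; rewrite subr_eq0 => /eqP E.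
  (* On [x y = 1] both [U_6] and [U_7] are identically 1, and [(x, - y)] is tangent to this
     curve. *)
  apply: (key 5%N 6%N (x, - y)) => //; first by rewrite xpair_eqE (negbTE x0).
    by rewrite (has_gradE _ (has_gradM gx gy)) /=; ring.
  rewrite (has_gradE _ (has_grad_div x1' (has_gradM gx gy1) gxm)) /=.
  rewrite (_ : _ + _ = - x * (1 - x * y) / (x - 1) ^+ 2); last by field.
  by rewrite -E subrr mulr0 mul0r.
by case=> [|[|[|[|[|[|l]]]]]].
Qed.

End Regular.

Theorem theoremB (R : realType) : exceptional_web (@spence_kummer R).
Proof.
split; first exact: web_regular_dense.
move=> p preg; have gp := regular_good preg; split.
  (* The positions are the [(m, i)] with [1 <= m < i <= 8]; there are [1 + 2 + ... + 7 = 28] of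
     them. *)
  apply: (@has_rank_of_independent R 9 (@spence_kummer R) p preg _
    [seq (m, i) | i <- iota 0 9, m <- iota 1 i.-1]%N) => //.
  - move=> m i /andP[m0 mi] i9; apply/allpairsPdep; exists i, m.
    by rewrite !mem_iota i9 m0; split=> //=; rewrite add1n prednK // (ltn_trans m0).
  - exact: independent_relations.
have [[g0 g1 g2 g3 g4] _ _ _] := goodP gp.
case: p {preg gp} g0 g1 g2 g3 g4 => x y /= g0 g1 g2 g3 g4.
move: g2 g3 g4; rewrite !subr_eq0 ![1 == _]eq_sym => g2 g3 g4.
exact: (spence_kummer_not_linearizable g0 g1 g2 g3 g4).
Qed.
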